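(* Let $a>0$, $x>0$, $0<\theta<1$, let $k\geq 1$ be an odd integer, and let $\nu\in\mathbb{C}$ with $\Re(\nu)>0$. Then \begin{align*} &\left(\frac{a^2x}{4}\right)^{\frac{\nu}{2}+k+1}\sum_{n=1}^{\infty} n^{\nu/2}K_{\nu}(a\sqrt{nx})\sum_{d\mid n}d^k\cos(2\pi d\theta) =\frac{(-1)^{\frac{k-1}{2}}a^{2k+2}k!}{2^{2k+4}(2\pi)^{k+1}}\Gamma(\nu)\bigl\{\zeta(k+1,\theta)+\zeta(k+1,1-\theta)\bigr\}x^{k+1}\\ &\quad+\frac{(-1)^{\frac{k+1}{2}}(2\pi)^{k+1}\Gamma(\nu+k+1)}{4}\sum_{d=1}^{\infty}d^k\sum_{m=0}^{\infty}\left\{\frac{1}{\left(\frac{16\pi^2}{a^2}\frac{d(m+\theta)}{x}+1\right)^{\nu+k+1}}+\frac{1}{\left(\frac{16\pi^2}{a^2}\frac{d(m+1-\theta)}{x}+1\right)^{\nu+k+1}}\right\} -\delta_{k,1}\frac{a^2}{16}\Gamma(1+\nu)x, \end{align*} where $\delta_{k,1}=1$ if $k=1$ and $\delta_{k,1}=0$ otherwise.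
   Context: $K_\nu$ denotes the modified Bessel function of the second kind of order $\nu$. $\zeta(s,\alpha)=\sum_{n=0}^\infty (n+\alpha)^{-s}$ (for $\Re s>1$, $0<\alpha\le 1$) is the Hurwitz zeta function. *)

(* Defs.v *)
From Stdlib Require Import Reals Arith.
From Coquelicot Require Import Coquelicot.
Open Scope R_scope.

Definition cexp (z : C) : C :=
  (exp (Re z) * cos (Im z), exp (Re z) * sin (Im z)).

Definition cpowR (r : R) (s : C) : C := cexp (s * RtoC (ln r))%C.

Definition ccosh (z : C) : C := ((cexp z + cexp (- z)) / RtoC 2)%C.

Definition CInt0inf (f : R -> C) : C :=
  (RInt_gen (fun t => Re (f t)) (at_right 0) (Rbar_locally p_infty),
   RInt_gen (fun t => Im (f t)) (at_right 0) (Rbar_locally p_infty)).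

Definition CSeries (a : nat -> C) : C :=
  (Series (fun n => Re (a n)), Series (fun n => Im (a n))).

Definition CGamma (s : C) : C :=
  CInt0inf (fun t => (cpowR t (s - RtoC 1) * RtoC (exp (- t)))%C).

(* Modified Bessel function of the second kind, for z > 0 and any complex
   order nu:  K_nu(z) = int_0^oo exp(-z cosh t) cosh(nu t) dt  (DLMF 10.32.9) *)
Definition BesselK (nu : C) (z : R) : C :=
  CInt0inf (fun t => (RtoC (exp (- z * cosh t)) * ccosh (nu * RtoC t))%C).

Definition hurwitz_zeta (s alpha : R) : R :=
  Series (fun n => Rpower (INR n + alpha) (- s)).

(* sum_{d | n} d^k cos(2 pi d theta), for n >= 1 (d ranges over 1..n) *)
Definition divsum_cos (k : nat) (theta : R) (n : nat) : R :=
  sum_f_R0 (fun i => if Nat.eqb (n mod (S i)) 0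
                     then INR (S i) ^ k * cos (2 * PI * INR (S i) * theta)
                     else 0) (n - 1).

(* Main.v *)
Require Import Defs.
From Stdlib Require Import Reals Arith Lra Lia.
From Coquelicot Require Import Coquelicot.
Open Scope R_scope.

(** K_nu is half the integral of t^(nu-1) e^(-t - z^2/4t) up to the factor (z/2)^(-nu), so the
    left-hand side is the integral of t^(nu-1) e^(-t) against the divisor generating function
    F(s) = sum_(m,d) d^k cos(2 pi d theta) e^(-mds) at s = y/t, y = a^2 x/4.  For fixed m the sum over d
    is a sum over the lattice theta + Z of real parts of (ms + 2 pi i u)^(-k-1) (Lipschitz formula,
    obtained by differentiating k times the Poisson kernel expansion).  Exchanging the sums over m
    and u and applying the Lipschitz formula again, now in m, gives a modular transformation
    s -> 4 pi^2/s of F, whose three terms integrate to the three terms of the right-hand side.  The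
    exchange is absolutely convergent for k >= 3; for k = 1 it is only conditional and produces the
    delta term.  All exchanges of sums with integrals are dominated through
    e^(-x) <= q^q x^(-q), which turns every term into a constant times t^(p-1) e^(-t). *)

(** * Series *)

(* [ring] needs the equality to be over [R] syntactically, not over a Coquelicot structure. *)
Ltac Rring := match goal with |- ?a = ?b => change (@eq R a b); ring end.

(** The Poisson kernel used here is half the real part of coth(s/2 + pi i theta), and its expansion
    over theta + Z needs neither Fourier analysis nor contour integration: the duplication formula
    of coth is iterated, and the limit is taken under a summable bound. Since k is odd, the exponent
    k + 1 = 2l is even, so exchanging the roles of ms and 2 pi u costs only the sign (-1)^l. In the
    second application of the Lipschitz formula the sum over all integers m contains m = 0, and this
    term is the source of the Hurwitz zeta values. For k = 1 the double series of |ms + 2 pi i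
    u|^(-2) diverges. The defect has one origin: each Cauchy kernel tends to 0 as s grows, but their
    sum, the Poisson kernel, tends to its constant Fourier coefficient 1/2. For the integrals over
    (0, oo) the majorants have the product form [M n * w t] with [w] a Gamma integrand; its order is
    chosen to balance decay in the summation index against integrability at t = 0. *)

Lemma ex_series_dominated (a M : nat -> R) :
  (forall n, Rabs (a n) <= M n) -> ex_series M -> ex_series a.
Proof. intros H HM. apply (ex_series_le (K := R_AbsRing) (V := R_CompleteNormedModule) a M); auto. Qed.

Lemma Series_abs_le (a M : nat -> R) :
  (forall n, Rabs (a n) <= M n) -> ex_series M -> Rabs (Series a) <= Series M.
Proof.
intros H HM.
assert (Ha : ex_series (fun n => Rabs (a n))).
{ apply ex_series_dominated with M; auto. intros n. rewrite Rabs_Rabsolu. apply H. }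
apply Rle_trans with (Series (fun n => Rabs (a n))).
- now apply Series_Rabs.
- apply Series_le; auto. intros n; split; auto. apply Rabs_pos.
Qed.

Lemma sum_n_lim (f : nat -> nat -> R) (g : nat -> R) (J : nat) :
  (forall j, is_lim_seq (fun n => f n j) (g j)) ->
  is_lim_seq (fun n => sum_n (f n) J) (sum_n g J).
Proof.
intros H. induction J as [|J IH].
- rewrite sum_O. apply is_lim_seq_ext with (fun n => f n O); auto.
  intros n. now rewrite sum_O.
- rewrite sum_Sn. apply is_lim_seq_ext with (fun n => sum_n (f n) J + f n (S J)).
  + intros n. now rewrite sum_Sn.
  + now apply is_lim_seq_plus'.
Qed.

Lemma Series_tail_split (a : nat -> R) (J : nat) :
  ex_series a -> Series a = sum_n a J + Series (fun k => a (S J + k)%nat).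
Proof.
intros H. rewrite (Series_incr_n a (S J)); auto with arith.
simpl pred. now rewrite sum_n_Reals.
Qed.

Lemma ex_series_tail (a : nat -> R) (J : nat) :
  ex_series a -> ex_series (fun k => a (J + k)%nat).
Proof. intros H. now apply ex_series_incr_n. Qed.

Lemma Series_tail_small (M : nat -> R) :
  ex_series M -> forall eps : posreal, exists J, Rabs (Series (fun k => M (S J + k)%nat)) < eps.
Proof.
intros HM eps.
assert (HL := Series_correct M HM).
change (is_lim_seq (sum_n M) (Series M)) in HL.
apply is_lim_seq_spec in HL. destruct (HL eps) as [J HJ].
exists J. specialize (HJ J (le_n _)).
rewrite (Series_tail_split M J HM), Rabs_minus_sym in HJ.
now replace (sum_n M J + Series (fun k => M (S J + k)%nat) - sum_n M J)
  with (Series (fun k => M (S J + k)%nat)) in HJ by ring.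
Qed.

(** Dominated convergence for series. Past an index J the tail of [M] is below eps/4, which controls
    the tails of [f n] and of [g]; the remaining finite sum converges term by term. *)
Lemma tannery (f : nat -> nat -> R) (g M : nat -> R) :
  (forall n j, Rabs (f n j) <= M j) -> ex_series M ->
  (forall j, is_lim_seq (fun n => f n j) (g j)) ->
  ex_series g /\ is_lim_seq (fun n => Series (f n)) (Series g).
Proof.
intros Hb HM Hl.
assert (Hg : forall j, Rabs (g j) <= M j).
{ intros j. assert (H := is_lim_seq_abs _ _ (Hl j)).
  change (Rbar_le (Rbar_abs (g j)) (M j)).
  apply (is_lim_seq_le (fun n => Rabs (f n j)) (fun _ => M j) _ _ (fun n => Hb n j) H).
  apply is_lim_seq_const. }
assert (exg : ex_series g) by now apply ex_series_dominated with M.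
split; auto.
apply is_lim_seq_spec. intros eps.
assert (He : 0 < eps / 4) by (generalize (cond_pos eps); lra).
destruct (Series_tail_small M HM (mkposreal _ He)) as [J HJ].
change (Rabs (Series (fun k => M (S J + k)%nat)) < eps / 4) in HJ.
assert (HS := sum_n_lim f g J Hl). apply is_lim_seq_spec in HS.
destruct (HS (mkposreal _ He)) as [N HN]. simpl in HN.
exists N. intros n Hn. specialize (HN n Hn).
rewrite (Series_tail_split (f n) J) by now apply ex_series_dominated with M.
rewrite (Series_tail_split g J) by auto.
assert (HMt := ex_series_tail M (S J) HM).
assert (H1 := Series_abs_le (fun k => f n (S J + k)%nat) _ (fun k => Hb n (S J + k)%nat) HMt).
assert (H2 := Series_abs_le (fun k => g (S J + k)%nat) _ (fun k => Hg (S J + k)%nat) HMt).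
assert (H3 := Rle_abs (Series (fun k => M (S J + k)%nat))).
apply Rabs_def2 in HN. apply Rabs_le_between in H1. apply Rabs_le_between in H2.
apply Rabs_def1; lra.
Qed.

Lemma is_series_sum_n (a : nat -> nat -> R) (n : nat) :
  (forall i, ex_series (a i)) ->
  is_series (fun j => sum_n (fun i => a i j) n) (sum_n (fun i => Series (a i)) n).
Proof.
intros H. induction n as [|n IH].
- rewrite sum_O. apply is_series_ext with (a O).
  + intros j. now rewrite sum_O.
  + now apply Series_correct.
- rewrite sum_Sn. apply is_series_ext with (fun j => plus (sum_n (fun i => a i j) n) (a (S n) j)).
  + intros j. now rewrite sum_Sn.
  + apply (is_series_plus (V := R_NormedModule) (fun j => sum_n (fun i => a i j) n) (a (S n)));
      auto. now apply Series_correct.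
Qed.

Lemma sum_n_abs_le (a M : nat -> R) (n : nat) :
  (forall i, Rabs (a i) <= M i) -> Rabs (sum_n a n) <= sum_n M n.
Proof.
intros H. induction n as [|n IH].
- rewrite !sum_O. apply H.
- rewrite !sum_Sn. unfold plus; simpl.
  apply Rle_trans with (1 := Rabs_triang _ _). specialize (H (S n)). lra.
Qed.

Lemma sum_n_le_Series (M : nat -> R) (n : nat) :
  (forall i, 0 <= M i) -> ex_series M -> sum_n M n <= Series M.
Proof.
intros H HM. rewrite (Series_tail_split M n HM).
assert (0 <= Series (fun k => M (S n + k)%nat)); [|lra].
replace 0 with (Series (fun k => 0 * M (S n + k)%nat)) by (rewrite Series_scal_l; ring).
apply Series_le.
- intros k; specialize (H (S n + k)%nat); lra.
- now apply ex_series_tail.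
Qed.

Lemma ex_series_scal_R (c : R) (a : nat -> R) : ex_series a -> ex_series (fun n => c * a n).
Proof. intros H. apply (ex_series_scal (V := R_NormedModule) c a H). Qed.

Lemma ex_series_product_dominated (a : nat -> nat -> R) (M N : nat -> R) :
  (forall i j, Rabs (a i j) <= M i * N j) -> ex_series M -> ex_series N ->
  (forall i, ex_series (a i)) /\ ex_series (fun i => Series (a i)).
Proof.
intros Hb HM HN.
assert (Hi : forall i, ex_series (a i)).
{ intros i. apply ex_series_dominated with (fun j => M i * N j); auto.
  now apply ex_series_scal_R. }
split; auto.
apply ex_series_dominated with (fun i => Series N * M i).
- intros i. rewrite Rmult_comm, <- Series_scal_l. apply Series_abs_le; auto.
  now apply ex_series_scal_R.
- now apply ex_series_scal_R.
Qed.

(** Fubini by way of [tannery]: the partial sums over i, as sequences in j, are dominated by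
    [Series M * N j]. A majorant of product form keeps both summations independent and is available
    for every double series below. *)
Lemma is_series_swap (a : nat -> nat -> R) (M N : nat -> R) :
  (forall i j, Rabs (a i j) <= M i * N j) ->
  (forall i, 0 <= M i) -> (forall j, 0 <= N j) -> ex_series M -> ex_series N ->
  is_series (fun i => Series (a i)) (Series (fun j => Series (fun i => a i j))).
Proof.
intros Hb HM0 HN0 HM HN.
destruct (ex_series_product_dominated a M N Hb HM HN) as [Hi _].
assert (Hj : forall j, ex_series (fun i => a i j)).
{ intros j. apply ex_series_dominated with (fun i => N j * M i).
  - intros i. rewrite Rmult_comm. apply Hb.
  - now apply ex_series_scal_R. }
destruct (tannery (fun n j => sum_n (fun i => a i j) n) (fun j => Series (fun i => a i j))
            (fun j => Series M * N j)) as [_ H].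
- intros n j. apply Rle_trans with (sum_n (fun i => M i * N j) n).
  + apply sum_n_abs_le. intros i; apply Hb.
  + rewrite (sum_n_ext _ (fun i => mult (M i) (N j))) by reflexivity.
    rewrite sum_n_mult_r. unfold mult; simpl.
    apply Rmult_le_compat_r; auto. now apply sum_n_le_Series.
- now apply ex_series_scal_R.
- intros j. exact (Series_correct _ (Hj j)).
- apply (is_lim_seq_ext _ (sum_n (fun i => Series (a i)))) in H; auto.
  intros n. apply is_series_unique. now apply is_series_sum_n.
Qed.

Lemma Series_swap (a : nat -> nat -> R) (M N : nat -> R) :
  (forall i j, Rabs (a i j) <= M i * N j) ->
  (forall i, 0 <= M i) -> (forall j, 0 <= N j) -> ex_series M -> ex_series N ->
  Series (fun i => Series (a i)) = Series (fun j => Series (fun i => a i j)).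
Proof. intros; apply is_series_unique. now apply is_series_swap with M N. Qed.

Lemma is_series_single (a : nat -> R) (n0 : nat) :
  (forall n, n <> n0 -> a n = 0) -> is_series a (a n0).
Proof.
intros H. change (is_lim_seq (sum_n a) (a n0)).
apply (is_lim_seq_ext_loc (fun _ => a n0)).
- exists n0. intros n Hn. symmetry.
  assert (Hlt : forall m, (m < n0)%nat -> sum_n a m = 0).
  { induction m as [|m IH]; intros Hm.
    - rewrite sum_O. apply H. lia.
    - rewrite sum_Sn, IH, H by lia. unfold plus; simpl; lra. }
  induction n as [|n IH].
  + rewrite sum_O. f_equal. lia.
  + rewrite sum_Sn. destruct (Nat.eq_dec n0 (S n)) as [->|Hne].
    * rewrite Hlt by lia. unfold plus; simpl; lra.
    * rewrite IH, (H (S n)) by lia. unfold plus; simpl; lra.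
- apply is_lim_seq_const.
Qed.

Lemma Series_single (a : nat -> R) (n0 : nat) :
  (forall n, n <> n0 -> a n = 0) -> Series a = a n0.
Proof. intros H. apply is_series_unique. now apply is_series_single. Qed.

Lemma Series_finite (a : nat -> R) (n : nat) :
  (forall i, (n < i)%nat -> a i = 0) -> Series a = sum_n a n.
Proof.
intros H. apply is_series_unique. change (is_lim_seq (sum_n a) (sum_n a n)).
apply (is_lim_seq_ext_loc (fun _ => sum_n a n)).
- exists n. intros m Hm. induction Hm as [|m Hm IH]; auto.
  rewrite sum_Sn, <- IH, H by lia. unfold plus; simpl; lra.
- apply is_lim_seq_const.
Qed.

(** * Series of powers, and exponentials against powers *)

Lemma exp_le (x y : R) : x <= y -> exp x <= exp y.
Proof. intros [H| ->]; [left; now apply exp_increasing|right; reflexivity]. Qed.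

Lemma Rpower_pos (x p : R) : 0 < Rpower x p.
Proof. apply exp_pos. Qed.

(** Comparison with a telescoping series: by the mean value theorem n^(-e) - (n+1)^(-e), with e = p
    - 1, is at least e (n+1)^(-p). *)
Lemma ex_series_Rpower (p : R) : 1 < p -> ex_series (fun n => Rpower (INR (S n)) (- p)).
Proof.
intros Hp. set (e := p - 1).
(* Dropping the first term leaves the argument [INR (S (S n))], the right end of the mean value
   interval, where x^(-p) is smallest. *)
apply ex_series_incr_1.
apply ex_series_dominated
  with (fun n => / e * (Rpower (INR (S n)) (- e) - Rpower (INR (S (S n))) (- e))).
- intros n. rewrite Rabs_pos_eq by (left; apply Rpower_pos).
  assert (Hn := pos_INR n).
  assert (H1 : 0 < INR (S n)) by (rewrite S_INR; lra).
  destruct (MVT_cor2 (fun x => Rpower x (- e)) (fun x => (- e) * Rpower x (- e - 1))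
              (INR (S n)) (INR (S (S n)))) as [c [Hc1 Hc2]].
  + rewrite !S_INR; lra.
  + intros c Hc. apply derivable_pt_lim_power. lra.
  + replace (INR (S (S n)) - INR (S n)) with 1 in Hc1 by (rewrite (S_INR (S n)); ring).
    replace (Rpower (INR (S n)) (- e) - Rpower (INR (S (S n))) (- e))
      with (e * Rpower c (- p)).
    * rewrite <- Rmult_assoc, Rinv_l, Rmult_1_l by (unfold e; lra).
      unfold Rpower. apply exp_le.
      assert (ln c <= ln (INR (S (S n)))) by (apply ln_le; lra).
      nra.
    * replace (- e - 1) with (- p) in Hc1 by (unfold e; ring). lra.
- apply ex_series_scal_R.
  exists (Rpower (INR 1) (- e) - 0).
  match goal with |- is_series ?a ?l => change (is_lim_seq (sum_n a) l) end.
  apply (is_lim_seq_ext (fun n => Rpower (INR 1) (- e) - Rpower (INR (S (S n))) (- e))).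
  + intros n. induction n as [|n IH].
    * now rewrite sum_O.
    * rewrite sum_Sn, <- IH. unfold plus; simpl. lra.
  + apply is_lim_seq_minus'; [apply is_lim_seq_const|].
    unfold Rpower.
    apply (is_lim_seq_ext (fun n => exp (- (e * ln (INR (n + 2)))))).
    { intros n. replace (n + 2)%nat with (S (S n)) by lia. f_equal. ring. }
    apply (is_lim_comp_seq exp (fun n => - (e * ln (INR (n + 2)))) m_infty 0).
    * apply is_lim_exp_m.
    * exists O. intros; discriminate.
    * apply (is_lim_seq_opp _ p_infty).
      assert (H : is_lim_seq (fun n => ln (INR (n + 2))) p_infty).
      { apply (is_lim_comp_seq ln _ p_infty p_infty).
        - apply is_lim_ln_p.
        - exists O. intros; discriminate.
        - apply (is_lim_seq_incr_n INR 2). apply is_lim_seq_INR. }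
      apply (is_lim_seq_scal_l _ e) in H.
      replace (Rbar_mult e p_infty) with p_infty in H; auto.
      unfold e. simpl. destruct (Rle_dec 0 (p - 1)); [|lra].
      destruct (Rle_lt_or_eq_dec 0 (p - 1) r); [reflexivity|lra].
Qed.

Lemma ex_series_Rpower_shift (p u : R) :
  1 < p -> 0 < u -> ex_series (fun n => Rpower (INR n + u) (- p)).
Proof.
intros Hp Hu. set (c := Rmin u 1).
assert (Hc : 0 < c) by (unfold c; apply Rmin_pos; lra).
apply ex_series_dominated with (fun n => Rpower c (- p) * Rpower (INR (S n)) (- p)).
- intros n. rewrite Rabs_pos_eq by (left; apply Rpower_pos).
  assert (Hn := pos_INR n).
  rewrite Rpower_mult_distr by (rewrite ?S_INR; lra).
  unfold Rpower. apply exp_le.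
  assert (ln (c * INR (S n)) <= ln (INR n + u)).
  { apply ln_le. - rewrite S_INR; nra.
    - rewrite S_INR. assert (c <= u) by apply Rmin_l. assert (c <= 1) by apply Rmin_r. nra. }
  nra.
- now apply ex_series_scal_R, ex_series_Rpower.
Qed.

(* [x^q e^{-x}] is maximal at [x = q]. *)
Lemma Rpower_le_exp (q x : R) : 0 < q -> 0 < x -> Rpower x q <= Rpower q q * exp x.
Proof.
intros Hq Hx. unfold Rpower. rewrite <- exp_plus. apply exp_le.
assert (H := exp_ineq1_le (x / q - 1)).
assert (Hxq : 0 < x / q) by (apply Rdiv_lt_0_compat; lra).
assert (Hl : ln (x / q) <= x / q - 1).
{ rewrite <- (ln_exp (x / q - 1)). apply ln_le; lra. }
unfold Rdiv in Hl at 1. rewrite ln_mult, ln_Rinv in Hl; auto; [|now apply Rinv_0_lt_compat].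
assert (q * (x / q - 1) = x - q) by (field; lra).
nra.
Qed.

Lemma exp_neg_le_Rpower (q x : R) : 0 < q -> 0 < x -> exp (- x) <= Rpower q q * Rpower x (- q).
Proof.
intros Hq Hx. assert (H := Rpower_le_exp q x Hq Hx).
rewrite exp_Ropp, Rpower_Ropp.
assert (Hp := Rpower_pos x q). assert (He := exp_pos x).
apply Rmult_le_reg_r with (exp x); auto. rewrite Rinv_l by lra.
apply Rmult_le_reg_r with (Rpower x q); auto.
replace (Rpower q q * / Rpower x q * exp x * Rpower x q) with (Rpower q q * exp x) by (field; lra).
lra.
Qed.

(** * The Poisson kernel as a sum of Cauchy kernels *)

(** Half the Poisson kernel of the unit disc at radius e^(-s) and angle 2 pi th, equivalently half
    the real part of coth(s/2 + pi i th). *)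
Definition poisson_kernel (s th : R) : R := sinh s / (2 * (cosh s - cos (2 * PI * th))).

Lemma cosh_sinh_half (x : R) : cosh x = 1 + 2 * sinh (x / 2) ^ 2.
Proof.
unfold cosh, sinh.
replace x with (x / 2 + x / 2) at 1 by field.
replace (- x) with (- (x / 2) + - (x / 2)) by field.
rewrite !exp_plus, exp_Ropp. field. apply Rgt_not_eq, exp_pos.
Qed.

Lemma cosh_minus_cos (x y : R) :
  cosh x - cos (2 * y) = 2 * (sinh (x / 2) ^ 2 + sin y ^ 2).
Proof. rewrite cosh_sinh_half, cos_2a_sin. ring. Qed.

Lemma sinh_ge (x : R) : 0 <= x -> x <= sinh x.
Proof.
intros [Hx| <-]; [|rewrite sinh_0; lra].
destruct (MVT_cor2 sinh cosh 0 x Hx) as [c [Hc1 Hc2]].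
- intros c _. apply derivable_pt_lim_sinh.
- rewrite sinh_0 in Hc1.
  assert (1 <= cosh c) by (rewrite cosh_sinh_half; nra).
  nra.
Qed.

(** The point is linearity in [e] with a factor independent of it. It serves for the numerator of
    the rescaled kernel and for the length of a shrinking window of integration. *)
Lemma sinh_scale_le (e s : R) : 0 < e <= 1 -> 0 < s -> sinh (e * s) <= e * (s * cosh s).
Proof.
intros He Hs.
assert (Hes : 0 < e * s) by nra.
destruct (MVT_cor2 sinh cosh 0 (e * s) Hes) as [c [Hc1 Hc2]].
- intros c _. apply derivable_pt_lim_sinh.
- rewrite sinh_0 in Hc1.
  assert (cosh c <= cosh s).
  { rewrite (cosh_sinh_half c), (cosh_sinh_half s).
    assert (0 <= sinh (c / 2)) by (generalize (sinh_ge (c / 2)); lra).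
    assert (sinh (c / 2) <= sinh (s / 2)).
    { unfold sinh.
      assert (exp (c / 2) <= exp (s / 2)) by (apply exp_le; nra).
      assert (exp (- (s / 2)) <= exp (- (c / 2))) by (apply exp_le; nra). lra. }
    nra. }
  nra.
Qed.

(** Up to pi/3 the derivative is at least 1/2. Beyond, sin x is at least sqrt(3)/2 > 0.85, while x/2
    <= pi/4 < 0.85 because pi < 3.4. *)
Lemma sin_ge_half (x : R) : 0 <= x <= PI / 2 -> x / 2 <= sin x.
Proof.
intros [[Hx0| <-] Hx]; [|rewrite sin_0; lra].
assert (HPI := PI_4). assert (HP0 := PI_RGT_0).
destruct (Rle_dec x (PI / 3)) as [H3|H3].
- destruct (MVT_cor2 sin cos 0 x Hx0) as [c [Hc1 Hc2]].
  + intros c _. apply derivable_pt_lim_sin.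
  + rewrite sin_0 in Hc1.
    assert (1 / 2 <= cos c).
    { rewrite <- cos_PI3. apply cos_decr_1; lra. }
    nra.
- assert (sin (PI / 3) <= sin x) by (apply sin_incr_1; lra).
  rewrite sin_PI3 in H.
  assert (Hs := sqrt_sqrt 3 ltac:(lra)). assert (Hs0 := sqrt_pos 3).
  assert (x <= 17 / 10).
  { assert (PI < 3.4); [|lra].
    generalize (PI_ineq 2). unfold PI_tg, tg_alt. simpl. lra. }
  nra.
Qed.

(** This is the duplication formula 2 coth(2z) = coth z + coth(z + pi i/2). The second angle (th +
    1)/2 is replaced by (1 - th)/2, which is allowed because the kernel is even and 1-periodic in
    [th]. *)
Lemma poisson_kernel_half (s th : R) : 0 < s ->
  poisson_kernel s th = / 2 * (poisson_kernel (s / 2) (th / 2) + poisson_kernel (s / 2) ((1 - th) / 2)).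
Proof.
intros Hs. unfold poisson_kernel.
replace (2 * PI * ((1 - th) / 2)) with (PI - 2 * PI * (th / 2)) by field.
rewrite (Rtrigo_facts.cos_pi_minus (2 * PI * (th / 2))).
set (c := cos (2 * PI * (th / 2))).
assert (Hc : cos (2 * PI * th) = 2 * c * c - 1).
{ unfold c. rewrite <- cos_2a_cos. f_equal. field. }
rewrite Hc.
assert (Hc1 : -1 <= c <= 1) by (apply COS_bound).
assert (Hh : sinh s = 2 * sinh (s / 2) * cosh (s / 2) /\ cosh s = 2 * cosh (s / 2) ^ 2 - 1).
{ replace s with (s / 2 + s / 2) at 1 4 by field. generalize (s / 2); intros h.
  unfold cosh, sinh. rewrite Ropp_plus_distr, !exp_plus, exp_Ropp.
  split; field; apply Rgt_not_eq, exp_pos. }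
destruct Hh as [-> ->].
assert (1 < cosh (s / 2)).
{ rewrite cosh_sinh_half. generalize (sinh_ge (s / 2 / 2)); nra. }
field. repeat split; nra.
Qed.

(** Halving n + 1 times produces 2^(n+1) angles; up to sign and period they are listed as the 2^n
    pairs j + th, j + 1 - th, the same pairs that enumerate the lattice in the limit. *)
Lemma poisson_kernel_dyadic (n : nat) (s th : R) : 0 < s ->
  poisson_kernel s th = / 2 ^ S n * sum_n (fun j =>
     poisson_kernel (s / 2 ^ S n) ((INR j + th) / 2 ^ S n)
     + poisson_kernel (s / 2 ^ S n) ((INR j + 1 - th) / 2 ^ S n)) (2 ^ n - 1).
Proof.
revert s th. induction n as [|n IH]; intros s th Hs.
- simpl. rewrite sum_O. rewrite poisson_kernel_half by auto. simpl.
  replace (0 + 1 - th) with (1 - th) by ring. replace (0 + th) with th by ring.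
  now replace (2 * 1) with 2 by ring.
- rewrite poisson_kernel_half by auto.
  rewrite (IH (s / 2) (th / 2)), (IH (s / 2) ((1 - th) / 2)) by lra.
  rewrite <- Rmult_plus_distr_l, <- Rmult_assoc.
  assert (H2 : 2 ^ S n <> 0) by (apply pow_nonzero; lra).
  replace (/ 2 * / 2 ^ S n) with (/ 2 ^ S (S n)) by (simpl; simpl in H2; field; lra).
  f_equal.
  set (E := 2 ^ S (S n)).
  assert (HE : E = 2 ^ S n * 2) by (unfold E; simpl; ring).
  set (g := fun j : nat => poisson_kernel (s / E) ((INR j + th) / E) + poisson_kernel (s / E) ((INR j + 1 - th) / E)).
  (* Splitting by parity matches the two halves: the pair j at th/2 gives the first member of pair
     2j and the second of pair 2j + 1, and the pair j at (1 - th)/2 gives the other two. *)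
  assert (Hdouble : forall J, sum_n g (2 * J + 1) = sum_n (fun j => g (2 * j)%nat + g (2 * j + 1)%nat) J).
  { induction J as [|J IHJ].
    - simpl. rewrite sum_Sn, !sum_O. reflexivity.
    - replace (2 * S J + 1)%nat with (S (S (2 * J + 1))) by lia.
      rewrite 2!sum_Sn, IHJ, sum_Sn.
      replace (S (2 * J + 1)) with (2 * S J)%nat by lia.
      replace (S (2 * S J)) with (2 * S J + 1)%nat by lia.
      unfold plus; simpl. ring. }
  replace (2 ^ S n - 1)%nat with (2 * (2 ^ n - 1) + 1)%nat.
  2: { assert (2 ^ n <> 0)%nat by (apply Nat.pow_nonzero; lia). simpl. lia. }
  rewrite Hdouble.
  rewrite <- (sum_n_plus (G := R_AbelianMonoid)).
  apply sum_n_ext. intros j. unfold g, plus; simpl plus.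
  rewrite HE. rewrite !plus_INR, !mult_INR. simpl (INR 2). simpl (INR 1). replace (1 + 1) with 2 by ring.
  replace (s / (2 ^ S n * 2)) with (s / 2 / 2 ^ S n) by (field; auto).
  replace ((INR j + th / 2) / 2 ^ S n) with ((2 * INR j + th) / (2 ^ S n * 2)) by (field; auto).
  replace ((INR j + 1 - th / 2) / 2 ^ S n) with ((2 * INR j + 1 + 1 - th) / (2 ^ S n * 2)) by (field; auto).
  replace ((INR j + (1 - th) / 2) / 2 ^ S n) with ((2 * INR j + 1 - th) / (2 ^ S n * 2)) by (field; auto).
  replace ((INR j + 1 - (1 - th) / 2) / 2 ^ S n) with ((2 * INR j + 1 + th) / (2 ^ S n * 2)) by (field; auto).
  unfold plus; simpl. ring.
Qed.

Definition cauchy_kernel (s u : R) : R := s / (s ^ 2 + (2 * PI * u) ^ 2).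

(** In this form every quotient by [e] is a difference quotient at 0, so that both the limit as e ->
    0 and a bound uniform in [e] can be read off. *)
Lemma poisson_kernel_scaled (e s u : R) : 0 < e -> 0 < s ->
  e * poisson_kernel (e * s) (e * u) =
  (sinh (e * s) / e) / (4 * ((sinh (e * s / 2) / e) ^ 2 + (sin (PI * (e * u)) / e) ^ 2)).
Proof.
intros He Hs. unfold poisson_kernel.
replace (2 * PI * (e * u)) with (2 * (PI * (e * u))) by ring.
rewrite cosh_minus_cos.
assert (0 < sinh (e * s / 2)) by (generalize (sinh_ge (e * s / 2)); nra).
field. repeat split; try lra; nra.
Qed.

Lemma is_lim_seq_diff_quot (f : R -> R) (l c : R) (e : nat -> R) :
  f 0 = 0 -> derivable_pt_lim f 0 l -> is_lim_seq e 0 -> (forall n, 0 < e n) ->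
  is_lim_seq (fun n => f (c * e n) / e n) (c * l).
Proof.
intros Hf0 Hf He Hp.
apply is_lim_seq_spec. intros eps.
assert (Hd : derivable_pt_lim (fun x => f (c * x)) 0 (l * c)).
{ apply (derivable_pt_lim_comp (fun x => c * x) f).
  - apply is_derive_Reals. auto_derive; auto; ring.
  - now rewrite Rmult_0_r. }
destruct (Hd eps (cond_pos eps)) as [d Hd'].
apply is_lim_seq_spec in He. destruct (He d) as [N HN].
exists N. intros n Hn. specialize (HN n Hn). specialize (Hp n).
specialize (Hd' (e n)). rewrite Rplus_0_l, Rmult_0_r, Hf0, Rminus_0_r in Hd'.
rewrite (Rmult_comm c l). apply Hd'; [lra|]. now rewrite Rminus_0_r in HN.
Qed.

Lemma is_lim_seq_poisson_kernel_scaled (s u : R) (e : nat -> R) : 0 < s ->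
  is_lim_seq e 0 -> (forall n, 0 < e n) ->
  is_lim_seq (fun n => e n * poisson_kernel (e n * s) (e n * u)) (cauchy_kernel s u).
Proof.
intros Hs He Hp.
apply is_lim_seq_ext with (fun n => (sinh (s * e n) / e n) /
  (4 * ((sinh (s / 2 * e n) / e n) ^ 2 + (sin (PI * u * e n) / e n) ^ 2))).
- intros n. rewrite poisson_kernel_scaled by auto.
  replace (e n * s) with (s * e n) by ring.
  replace (s * e n / 2) with (s / 2 * e n) by field.
  now replace (PI * (e n * u)) with (PI * u * e n) by ring.
- assert (Hsinh : derivable_pt_lim sinh 0 1).
  { rewrite <- cosh_0. apply derivable_pt_lim_sinh. }
  assert (Hsin : derivable_pt_lim sin 0 1).
  { rewrite <- cos_0. apply derivable_pt_lim_sin. }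
  assert (H1 := is_lim_seq_diff_quot sinh 1 s e sinh_0 Hsinh He Hp).
  assert (H2 := is_lim_seq_diff_quot sinh 1 (s / 2) e sinh_0 Hsinh He Hp).
  assert (H3 := is_lim_seq_diff_quot sin 1 (PI * u) e sin_0 Hsin He Hp).
  rewrite Rmult_1_r in H1, H2, H3.
  replace (Finite (cauchy_kernel s u)) with
    (Finite (s / (4 * ((s / 2) * (s / 2) + (PI * u) * (PI * u))))).
  + apply is_lim_seq_div'; auto.
    * apply (is_lim_seq_scal_l _ 4 (s / 2 * (s / 2) + PI * u * (PI * u))).
      apply is_lim_seq_plus'.
      -- apply is_lim_seq_ext with (fun n => sinh (s / 2 * e n) / e n * (sinh (s / 2 * e n) / e n)).
         { intros; ring. } now apply is_lim_seq_mult'.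
      -- apply is_lim_seq_ext with (fun n => sin (PI * u * e n) / e n * (sin (PI * u * e n) / e n)).
         { intros; ring. } now apply is_lim_seq_mult'.
    * nra.
  + f_equal. unfold cauchy_kernel. field. nra.
Qed.

(** The standard summable majorant 1/(j+1)^2, written with [Rpower] so that its exponent combines
    with real exponents. *)
Definition quad_tail (j : nat) : R := Rpower (INR (S j)) (Ropp 2).

Lemma quad_tail_eq (j : nat) : quad_tail j = / (INR j + 1) ^ 2.
Proof.
unfold quad_tail. rewrite Rpower_Ropp. f_equal.
replace 2 with (INR 2) by (simpl; ring). rewrite Rpower_pow.
- now rewrite S_INR.
- apply lt_0_INR; lia.
Qed.

Lemma quad_tail_pos (j : nat) : 0 < quad_tail j.
Proof. apply Rpower_pos. Qed.

Lemma ex_series_quad_tail : ex_series quad_tail.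
Proof. apply ex_series_Rpower. lra. Qed.

(** The factor 2 comes from (j+1)^2 <= 2 (1 + j^2), the minimum from min(1, r^2) (1 + j^2) <= r^2 +
    j^2. *)
Lemma inv_quad_le (r s v : R) (j : nat) : 0 < r <= s -> INR j <= v ->
  / (s ^ 2 + v ^ 2) <= 2 / Rmin 1 (r ^ 2) * quad_tail j.
Proof.
intros Hr Hv. rewrite quad_tail_eq. assert (Hj := pos_INR j).
set (c := Rmin 1 (r ^ 2)).
assert (Hc : 0 < c) by (unfold c; apply Rmin_pos; nra).
assert (c <= 1) by apply Rmin_l. assert (c <= r ^ 2) by apply Rmin_r.
replace (2 / c * / (INR j + 1) ^ 2) with (/ (c / 2 * (INR j + 1) ^ 2)) by (field; split; nra).
apply Rinv_le_contravar; [apply Rmult_lt_0_compat; nra|].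
assert (0 <= c * (INR j - 1) ^ 2) by (apply Rmult_le_pos; [lra|apply pow2_ge_0]).
assert (INR j ^ 2 <= v ^ 2) by (apply pow_incr; lra).
assert (r ^ 2 <= s ^ 2) by (apply pow_incr; lra).
assert (c * INR j ^ 2 <= 1 * INR j ^ 2) by (apply Rmult_le_compat_r; [apply pow2_ge_0|lra]).
nra.
Qed.

(** The condition e u <= 1/2 keeps the angle pi e u in [0, pi/2], where sin x >= x/2. The
    denominator is then at least s^2 + u^2, and the numerator at most s cosh s, uniformly in [e]. *)
Lemma poisson_kernel_scaled_bound (e s u : R) (j : nat) : 0 < s -> 0 < e <= 1 ->
  INR j <= u -> e * u <= 1 / 2 ->
  Rabs (e * poisson_kernel (e * s) (e * u)) <= 2 / Rmin 1 (s ^ 2) * (s * cosh s) * quad_tail j.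
Proof.
intros Hs He Hj Hu. assert (Hj0 := pos_INR j). assert (HPI := PI_RGT_0).
rewrite poisson_kernel_scaled by lra.
assert (Hsin : u <= sin (PI * (e * u)) / e).
{ assert (H : PI * (e * u) / 2 <= sin (PI * (e * u))) 
    by (apply sin_ge_half; split; [apply Rmult_le_pos; nra|];
        replace (PI / 2) with (PI * (1 / 2)) by field; apply Rmult_le_compat_l; lra).
  apply Rmult_le_reg_r with e; [lra|]. unfold Rdiv. rewrite Rmult_assoc, Rinv_l, Rmult_1_r by lra.
  assert (2 <= PI) by (generalize PI2_1; lra).
  assert (0 <= e * u) by nra. nra. }
assert (Hs2 : s / 2 <= sinh (e * s / 2) / e).
{ assert (H := sinh_ge (e * s / 2) ltac:(nra)).
  apply Rmult_le_reg_r with e; [lra|]. unfold Rdiv at 2.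
  rewrite Rmult_assoc, Rinv_l, Rmult_1_r by lra. lra. }
assert (Hn : 0 <= sinh (e * s) / e <= s * cosh s).
{ split.
  - apply Rdiv_le_0_compat; [|lra]. generalize (sinh_ge (e * s)); nra.
  - apply Rmult_le_reg_r with e; [lra|]. unfold Rdiv.
    rewrite Rmult_assoc, Rinv_l, Rmult_1_r by lra.
    generalize (sinh_scale_le e s He Hs); lra. }
set (X := sinh (e * s) / e) in *. set (Y := sinh (e * s / 2) / e) in *.
set (Z := sin (PI * (e * u)) / e) in *.
assert (Hden : s ^ 2 + u ^ 2 <= 4 * (Y ^ 2 + Z ^ 2)) by nra.
assert (Hpos : 0 < s ^ 2 + u ^ 2) by nra.
assert (Hq := inv_quad_le s s u j ltac:(lra) Hj).
assert (HI : / (4 * (Y ^ 2 + Z ^ 2)) <= / (s ^ 2 + u ^ 2)) by (apply Rinv_le_contravar; lra).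
assert (HI0 : 0 < / (4 * (Y ^ 2 + Z ^ 2))) by (apply Rinv_0_lt_compat; lra).
rewrite Rabs_pos_eq.
- unfold Rdiv at 1. apply Rle_trans with (s * cosh s * (2 / Rmin 1 (s ^ 2) * quad_tail j)).
  + apply Rmult_le_compat; lra.
  + right; ring.
- apply Rmult_le_pos; lra.
Qed.

(* The identity for the Poisson kernel on the circle is stable under dyadic rescaling;
   in the limit it becomes the sum over integer translates of the Cauchy kernel. *)
Lemma poisson_kernel_eq_series (s th : R) : 0 < s -> 0 <= th <= 1 ->
  is_series (fun j => cauchy_kernel s (INR j + th) + cauchy_kernel s (INR j + 1 - th)) (poisson_kernel s th).
Proof.
intros Hs Ht.
set (e := fun n : nat => / 2 ^ S n).
assert (Hp : forall n, 0 < e n) by (intros n; apply Rinv_0_lt_compat, pow_lt; lra).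
assert (He1 : forall n, e n <= 1).
{ intros n. unfold e. rewrite <- Rinv_1. apply Rinv_le_contravar; [lra|]. apply pow_R1_Rle; lra. }
assert (He : is_lim_seq e 0).
{ apply (is_lim_seq_ext (fun n => (/ 2) ^ S n)).
  - intros n. unfold e. now rewrite pow_inv.
  - apply (is_lim_seq_incr_1 (fun n => (/ 2) ^ n)). apply is_lim_seq_geom.
    rewrite Rabs_pos_eq; lra. }
(* Truncating at j < 2^n gives e_n (j + 1) <= 1/2, exactly what the uniform bound requires, and
   leaves each [Series (f n)] equal to the kernel itself. *)
set (f := fun n j => if (j <? 2 ^ n)%nat then
   e n * poisson_kernel (e n * s) (e n * (INR j + th)) + e n * poisson_kernel (e n * s) (e n * (INR j + 1 - th)) else 0).
assert (HS : forall n, Series (f n) = poisson_kernel s th).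
{ intros n. rewrite (poisson_kernel_dyadic n s th Hs).
  assert (H2 : (2 ^ n <> 0)%nat) by (apply Nat.pow_nonzero; lia).
  rewrite (Series_finite (f n) (2 ^ n - 1)).
  - rewrite <- (sum_n_mult_l (K := R_Ring)). apply sum_n_ext_loc. intros j Hj.
    unfold f. destruct (Nat.ltb_spec j (2 ^ n)); [|lia].
    unfold mult; simpl mult. unfold e, Rdiv.
    rewrite !(Rmult_comm _ (/ 2 ^ S n)). unfold mult; simpl. ring.
  - intros i Hi. unfold f. destruct (Nat.ltb_spec i (2 ^ n)); [lia|reflexivity]. }
destruct (tannery f (fun j => cauchy_kernel s (INR j + th) + cauchy_kernel s (INR j + 1 - th))
   (fun j => 2 * (2 / Rmin 1 (s ^ 2) * (s * cosh s)) * quad_tail j)) as [Hex Hlim].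
- intros n j. unfold f. destruct (Nat.ltb_spec j (2 ^ n)) as [Hj|Hj].
  + assert (Hj1 : INR j + 1 <= 2 ^ n).
    { rewrite <- S_INR. replace (2 ^ n) with (INR (2 ^ n)) by (rewrite pow_INR; reflexivity).
      now apply le_INR. }
    assert (Hen : e n * 2 ^ n = 1 / 2).
    { unfold e. simpl. field. apply pow_nonzero; lra. }
    assert (Hpn := Hp n).
    assert (B1 := poisson_kernel_scaled_bound (e n) s (INR j + th) j Hs (conj (Hp n) (He1 n)) ltac:(lra) ltac:(nra)).
    assert (B2 := poisson_kernel_scaled_bound (e n) s (INR j + 1 - th) j Hs (conj (Hp n) (He1 n)) ltac:(lra) ltac:(nra)).
    apply Rle_trans with (1 := Rabs_triang _ _). lra.
  + rewrite Rabs_R0. assert (Hq := quad_tail_pos j).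
    assert (0 <= 2 / Rmin 1 (s ^ 2)).
    { apply Rdiv_le_0_compat; [lra|]. apply Rmin_pos; nra. }
    assert (0 < cosh s) by (rewrite cosh_sinh_half; nra).
    apply Rmult_le_pos; [|lra]. apply Rmult_le_pos; [lra|]. apply Rmult_le_pos; nra.
- apply ex_series_scal_R, ex_series_quad_tail.
- intros j. apply (is_lim_seq_ext_loc (fun n =>
     e n * poisson_kernel (e n * s) (e n * (INR j + th)) + e n * poisson_kernel (e n * s) (e n * (INR j + 1 - th)))).
  + exists j. intros n Hn. unfold f. destruct (Nat.ltb_spec j (2 ^ n)) as [_|Hj]; auto.
    assert (n < 2 ^ n)%nat by (apply Nat.pow_gt_lin_r; lia). lia.
  + apply is_lim_seq_plus'; now apply is_lim_seq_poisson_kernel_scaled.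
- replace (poisson_kernel s th) with (Series (fun j => cauchy_kernel s (INR j + th) + cauchy_kernel s (INR j + 1 - th))).
  + now apply Series_correct.
  + assert (Hc : is_lim_seq (fun n => Series (f n)) (poisson_kernel s th)).
    { apply is_lim_seq_ext with (fun _ => poisson_kernel s th); [now intros; rewrite HS|apply is_lim_seq_const]. }
    apply is_lim_seq_unique in Hlim. apply is_lim_seq_unique in Hc.
    rewrite Hlim in Hc. now injection Hc.
Qed.

(** * Lipschitz formula *)

Lemma taylor1_bound (f f' f'' : R -> R) (M s0 r h : R) :
  (forall s, Rabs (s - s0) <= r -> is_derive f s (f' s)) ->
  (forall s, Rabs (s - s0) <= r -> is_derive f' s (f'' s)) ->
  (forall s, Rabs (s - s0) <= r -> Rabs (f'' s) <= M) ->
  Rabs h <= r -> Rabs (f (s0 + h) - f s0 - h * f' s0) <= M * h ^ 2.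
Proof.
intros H1 H2 HM Hh.
assert (E : s0 + h - s0 = h) by ring.
destruct (MVT_cor4 f f' s0 r H1 (s0 + h)) as [c [Hc1 Hc2]]; [now rewrite E|].
rewrite E in Hc1, Hc2. rewrite Hc1.
destruct (MVT_cor4 f' f'' s0 r H2 c) as [d [Hd1 Hd2]]; [lra|].
replace (f' c * h - h * f' s0) with (h * (f' c - f' s0)) by ring.
rewrite Hd1, !Rabs_mult, <- (pow2_abs h).
assert (Hd3 : Rabs (f'' d) <= M) by (apply HM; lra).
assert (P1 := Rabs_pos h). assert (P2 := Rabs_pos (c - s0)). assert (P3 := Rabs_pos (f'' d)).
replace (M * Rabs h ^ 2) with (Rabs h * (M * Rabs h)) by ring.
apply Rmult_le_compat_l; auto. apply Rmult_le_compat; auto.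
Qed.

(** A summable bound on the second derivatives makes the sum of the first-order Taylor remainders
    O(h^2), which gives the derivative directly, without a separate argument on uniform
    convergence. *)
Lemma is_derive_Series (f f' f'' : nat -> R -> R) (M : nat -> R) (s0 r : R) : 0 < r ->
  (forall n s, Rabs (s - s0) <= r -> is_derive (f n) s (f' n s)) ->
  (forall n s, Rabs (s - s0) <= r -> is_derive (f' n) s (f'' n s)) ->
  (forall n s, Rabs (s - s0) <= r -> Rabs (f'' n s) <= M n) ->
  ex_series M -> ex_series (fun n => f' n s0) ->
  (forall s, Rabs (s - s0) <= r -> ex_series (fun n => f n s)) ->
  is_derive (fun s => Series (fun n => f n s)) s0 (Series (fun n => f' n s0)).
Proof.
intros Hr H1 H2 HM exM exf' exf.
apply is_derive_Reals. intros eps Heps.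
set (S0 := Series M).
assert (HM0 : forall n, 0 <= M n).
{ intros n. apply Rle_trans with (2 := HM n s0 ltac:(rewrite Rminus_diag, Rabs_R0; lra)). apply Rabs_pos. }
assert (HS0 : 0 <= S0).
{ apply Rle_trans with (sum_n M 0); [rewrite sum_O; auto|now apply sum_n_le_Series]. }
(* [S0 + 1] instead of [S0] because [S0] may vanish. *)
assert (Hd : 0 < Rmin r (eps / (S0 + 1))).
{ apply Rmin_pos; auto. apply Rdiv_lt_0_compat; lra. }
exists (mkposreal _ Hd). simpl. intros h Hh0 Hh.
assert (Hhr : Rabs h <= r) by (generalize (Rmin_l r (eps / (S0 + 1))); lra).
assert (Hhe : Rabs h < eps / (S0 + 1)) by (generalize (Rmin_r r (eps / (S0 + 1))); lra).
assert (B : Rabs (Series (fun n => f n (s0 + h) - f n s0 - h * f' n s0)) <= S0 * h ^ 2).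
{ unfold S0. rewrite <- Series_scal_r. apply Series_abs_le.
  - intros n. now apply (taylor1_bound (f n) (f' n) (f'' n) (M n) s0 r h); auto.
  - apply ex_series_ext with (fun n => h ^ 2 * M n); [intros; apply Rmult_comm|].
    now apply ex_series_scal_R. }
assert (ex1 : ex_series (fun n => f n (s0 + h))).
{ apply exf. now replace (s0 + h - s0) with h by ring. }
assert (ex2 : ex_series (fun n => f n s0)) by (apply exf; rewrite Rminus_diag, Rabs_R0; lra).
rewrite Series_minus, Series_minus, Series_scal_l in B; auto.
2: now apply (ex_series_minus (V := R_NormedModule)).
2: now apply ex_series_scal_R.
set (X := Series (fun n => f n (s0 + h))) in *. set (Y := Series (fun n => f n s0)) in *.
set (Z := Series (fun n => f' n s0)) in *.
replace ((X - Y) / h - Z) with ((X - Y - h * Z) / h) by (field; auto).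
unfold Rdiv. rewrite Rabs_mult, Rabs_inv by auto.
assert (Hp := Rabs_pos_lt h Hh0).
apply Rmult_lt_reg_r with (Rabs h); auto.
rewrite Rmult_assoc, Rinv_l, Rmult_1_r by lra.
apply Rle_lt_trans with (1 := B). rewrite <- (pow2_abs h).
replace (S0 * Rabs h ^ 2) with (S0 * Rabs h * Rabs h) by ring.
apply Rmult_lt_compat_r; auto.
apply Rle_lt_trans with ((S0 + 1) * Rabs h); [nra|].
apply Rmult_lt_reg_l with (/ (S0 + 1)); [apply Rinv_0_lt_compat; lra|].
rewrite <- Rmult_assoc, Rinv_l, Rmult_1_l by lra.
unfold Rdiv in Hhe. lra.
Qed.

(** * Real parts of inverse powers and their lattice sums *)

Definition cinvpow (n : nat) (s v : R) : C := ((/ (s, v)) ^ n)%C.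
Definition invpow (n : nat) (s v : R) : R := Re (cinvpow n s v).

Lemma Re_Cmult (z w : C) : Re (z * w)%C = Re z * Re w - Im z * Im w.
Proof. reflexivity. Qed.
Lemma Im_Cmult (z w : C) : Im (z * w)%C = Re z * Im w + Im z * Re w.
Proof. reflexivity. Qed.

Lemma Re_Cinv (s v : R) : Re (/ (s, v))%C = s / (s ^ 2 + v ^ 2).
Proof. reflexivity. Qed.
Lemma Im_Cinv (s v : R) : Im (/ (s, v))%C = - v / (s ^ 2 + v ^ 2).
Proof. reflexivity. Qed.

Lemma cinvpow_S (n : nat) (s v : R) : cinvpow (S n) s v = (/ (s, v) * cinvpow n s v)%C.
Proof. apply Cpow_S. Qed.

(** Real and imaginary parts go through the induction together, because the product rule for the
    power n + 1 mixes them. With 1/(s + iv) = p + iq the base derivative is -(p + iq)^2. *)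
Lemma is_derive_cinvpow (n : nat) (s v : R) : s <> 0 ->
  is_derive (fun s => Re (cinvpow n s v)) s (- INR n * Re (cinvpow (S n) s v)) /\
  is_derive (fun s => Im (cinvpow n s v)) s (- INR n * Im (cinvpow (S n) s v)).
Proof.
intros Hs. induction n as [|n [IH1 IH2]].
- simpl INR. split.
  + apply (is_derive_ext (fun _ => 1)); [reflexivity|].
    rewrite Ropp_0, Rmult_0_l. apply (is_derive_const (V := R_NormedModule)).
  + apply (is_derive_ext (fun _ => 0)); [reflexivity|].
    rewrite Ropp_0, Rmult_0_l. apply (is_derive_const (V := R_NormedModule)).
- assert (Hden : s ^ 2 + v ^ 2 <> 0) by (assert (0 < s ^ 2) by (apply pow2_gt_0; auto); nra).
  set (p := fun s => s / (s ^ 2 + v ^ 2)). set (q := fun s => - v / (s ^ 2 + v ^ 2)).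
  assert (Hp : is_derive p s (- (p s ^ 2 - q s ^ 2))).
  { unfold p, q. auto_derive; [simpl in *; lra|]. simpl. field. simpl in *; lra. }
  assert (Hq : is_derive q s (- (2 * p s * q s))).
  { unfold p, q. auto_derive; [simpl in *; lra|]. simpl. field. simpl in *; lra. }
  apply is_derive_Reals in IH1. apply is_derive_Reals in IH2.
  apply is_derive_Reals in Hp. apply is_derive_Reals in Hq.
  split.
  + apply (is_derive_ext (fun s => p s * Re (cinvpow n s v) - q s * Im (cinvpow n s v))).
    { intros t. rewrite cinvpow_S. reflexivity. }
    apply is_derive_Reals.
    assert (H := derivable_pt_lim_minus _ _ _ _ _
      (derivable_pt_lim_mult _ _ _ _ _ Hp IH1) (derivable_pt_lim_mult _ _ _ _ _ Hq IH2)).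
    unfold mult_fct, minus_fct in H.
    match type of H with derivable_pt_lim _ _ ?l1 =>
      match goal with |- derivable_pt_lim _ _ ?l2 => replace l2 with l1; [exact H|] end end.
    rewrite !cinvpow_S, ?Re_Cmult, ?Im_Cmult, ?Re_Cmult, !Re_Cinv, !Im_Cinv, S_INR.
    unfold p, q. ring.
  + apply (is_derive_ext (fun s => p s * Im (cinvpow n s v) + q s * Re (cinvpow n s v))).
    { intros t. rewrite cinvpow_S. reflexivity. }
    apply is_derive_Reals.
    assert (H := derivable_pt_lim_plus _ _ _ _ _
      (derivable_pt_lim_mult _ _ _ _ _ Hp IH2) (derivable_pt_lim_mult _ _ _ _ _ Hq IH1)).
    unfold mult_fct, plus_fct in H.
    match type of H with derivable_pt_lim _ _ ?l1 =>
      match goal with |- derivable_pt_lim _ _ ?l2 => replace l2 with l1; [exact H|] end end.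
    rewrite !cinvpow_S, ?Im_Cmult, ?Re_Cmult, ?Im_Cmult, !Re_Cinv, !Im_Cinv, S_INR.
    unfold p, q. ring.
Qed.

Lemma is_derive_invpow (n : nat) (s v : R) : s <> 0 ->
  is_derive (fun s => invpow n s v) s (- INR n * invpow (S n) s v).
Proof. intros Hs. apply (is_derive_cinvpow n s v Hs). Qed.

Lemma pair_neq_0 (s v : R) : 0 < s ^ 2 + v ^ 2 -> (s, v) <> RtoC 0.
Proof. intros H E. injection E as -> ->. lra. Qed.

Lemma Cmod_Cinv_sqr (s v : R) : 0 < s ^ 2 + v ^ 2 ->
  Cmod (/ (s, v)) ^ 2 = / (s ^ 2 + v ^ 2).
Proof.
intros H. rewrite Cmod_inv by now apply pair_neq_0.
unfold Cmod. simpl fst; simpl snd. rewrite pow_inv, pow2_sqrt; lra.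
Qed.

Lemma Rabs_invpow_le (n : nat) (s v : R) : Rabs (invpow n s v) <= Cmod (/ (s, v)) ^ n.
Proof. unfold invpow, cinvpow. rewrite <- Cmod_pow. apply re_le_Cmod. Qed.

Lemma Cmod_Cinv_le (r s v : R) : 0 < r <= s -> Cmod (/ (s, v)) <= / r.
Proof.
intros Hr. rewrite Cmod_inv by (apply pair_neq_0; nra).
apply Rinv_le_contravar; [lra|].
apply Rle_trans with (2 := re_le_Cmod (s, v)). simpl. rewrite Rabs_pos_eq; lra.
Qed.

(** Two of the n + 2 factors 1/|s + iv| provide the decay in j; each of the others is at most
    1/r. *)
Lemma invpow_bound (n : nat) (r s v : R) (j : nat) : 0 < r <= s -> INR j <= v ->
  Rabs (invpow (S (S n)) s v) <= (/ r) ^ n * (2 / Rmin 1 (r ^ 2)) * quad_tail j.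
Proof.
intros Hr Hj. apply Rle_trans with (1 := Rabs_invpow_le _ _ _).
replace (Cmod (/ (s, v)) ^ S (S n)) with (Cmod (/ (s, v)) ^ n * Cmod (/ (s, v)) ^ 2) by (simpl; ring).
rewrite Cmod_Cinv_sqr by nra. rewrite Rmult_assoc.
apply Rmult_le_compat.
- apply pow_le, Cmod_ge_0.
- left. apply Rinv_0_lt_compat; nra.
- apply pow_incr. split; [apply Cmod_ge_0|now apply Cmod_Cinv_le].
- now apply inv_quad_le.
Qed.

(* Sum over the two representatives [j + th], [j + 1 - th] of +-u, u in th + Z: [invpow] is even in
   its last argument, so summing over [j >= 0] sums over the lattice th + Z. *)
Definition lattice (n : nat) (th s : R) (j : nat) : R :=
  invpow n s (2 * PI * (INR j + th)) + invpow n s (2 * PI * (INR j + 1 - th)).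

Lemma INR_le_2PI (j : nat) (u : R) : INR j <= u -> INR j <= 2 * PI * u.
Proof. intros H. assert (H0 := pos_INR j). generalize PI2_1. nra. Qed.

Lemma lattice_bound (n : nat) (th r s : R) (j : nat) : 0 <= th <= 1 -> 0 < r <= s ->
  Rabs (lattice (S (S n)) th s j) <= 2 * ((/ r) ^ n * (2 / Rmin 1 (r ^ 2))) * quad_tail j.
Proof.
intros Ht Hr. unfold lattice. apply Rle_trans with (1 := Rabs_triang _ _).
assert (B1 := invpow_bound n r s (2 * PI * (INR j + th)) j Hr ltac:(apply INR_le_2PI; lra)).
assert (B2 := invpow_bound n r s (2 * PI * (INR j + 1 - th)) j Hr ltac:(apply INR_le_2PI; lra)).
lra.
Qed.

Lemma lattice_1_series (th s : R) : 0 < s -> 0 <= th <= 1 -> is_series (lattice 1 th s) (poisson_kernel s th).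
Proof.
intros Hs Ht. apply is_series_ext with (2 := poisson_kernel_eq_series s th Hs Ht).
intros j. unfold lattice, invpow, cinvpow. now rewrite !Cpow_1_r.
Qed.

(** Exponent 1 is separate: the modulus of 1/(s + 2 pi i u) decays only like 1/j, and convergence
    rests on the real part, that is, on the Poisson kernel expansion. *)
Lemma ex_series_lattice (n : nat) (th s : R) : 0 < s -> 0 <= th <= 1 -> ex_series (lattice (S n) th s).
Proof.
intros Hs Ht. destruct n as [|n].
- exists (poisson_kernel s th). now apply lattice_1_series.
- eapply ex_series_dominated.
  + intros j. apply lattice_bound with (r := s); auto; lra.
  + apply ex_series_scal_R, ex_series_quad_tail.
Qed.

Lemma is_derive_Series_lattice (n : nat) (th s : R) : 0 < s -> 0 <= th <= 1 ->
  is_derive (fun s => Series (lattice (S n) th s)) s (- INR (S n) * Series (lattice (S (S n)) th s)).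
Proof.
intros Hs Ht. rewrite <- Series_scal_l.
assert (Hd : forall m j t, Rabs (t - s) <= s / 2 ->
  is_derive (fun t => lattice m th t j) t (- INR m * lattice (S m) th t j)).
{ intros m j t H. apply Rabs_le_between in H. unfold lattice. rewrite (Rmult_plus_distr_l (- INR m)).
  apply (is_derive_plus (V := R_NormedModule)); apply is_derive_invpow; lra. }
apply (is_derive_Series (fun j s => lattice (S n) th s j) (fun j s => - INR (S n) * lattice (S (S n)) th s j)
  (fun j s => - INR (S n) * (- INR (S (S n)) * lattice (S (S (S n))) th s j))
  (fun j => INR (S n) * INR (S (S n)) * (2 * ((/ (s / 2)) ^ S n * (2 / Rmin 1 ((s / 2) ^ 2)))) * quad_tail j)
  s (s / 2)).
- lra.
- intros j t H. now apply Hd.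
- intros j t H. apply (is_derive_scal (fun t => lattice (S (S n)) th t j)). now apply Hd.
- intros j t H. apply Rabs_le_between in H.
  rewrite !Rabs_mult, !Rabs_Ropp, !(Rabs_pos_eq (INR _)) by apply pos_INR.
  rewrite <- !Rmult_assoc. rewrite 2!(Rmult_assoc (INR (S n) * INR (S (S n)))).
  rewrite (Rmult_assoc _ _ (quad_tail j)).
  apply Rmult_le_compat_l; [apply Rmult_le_pos; apply pos_INR|].
  rewrite (Rmult_assoc 2). apply lattice_bound; lra.
- apply ex_series_scal_R, ex_series_quad_tail.
- now apply ex_series_scal_R, ex_series_lattice.
- intros t H. apply Rabs_le_between in H. apply ex_series_lattice; auto; lra.
Qed.

(** * Exponential cosine series *)

Definition cosexp (k : nat) (th s : R) (d : nat) : R :=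
  INR (S d) ^ k * exp (- (INR (S d) * s)) * cos (2 * PI * INR (S d) * th).

(** The bound e^(-x) <= q^q x^(-q) is used with q = k + 2: against d^k it leaves d^(-2). *)
Lemma pow_exp_bound (k : nat) (r : R) (d : nat) : 0 < r ->
  INR (S d) ^ k * exp (- (INR (S d) * r)) <=
  Rpower (INR k + 2) (INR k + 2) * Rpower r (- (INR k + 2)) * quad_tail d.
Proof.
intros Hr. assert (HD : 0 < INR (S d)) by (apply lt_0_INR; lia).
assert (Hk := pos_INR k).
assert (H := exp_neg_le_Rpower (INR k + 2) (INR (S d) * r) ltac:(lra) ltac:(nra)).
rewrite <- Rpower_mult_distr in H by lra.
unfold quad_tail. rewrite <- Rpower_pow by auto.
apply Rle_trans with (Rpower (INR (S d)) (INR k) *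
  (Rpower (INR k + 2) (INR k + 2) * (Rpower (INR (S d)) (- (INR k + 2)) * Rpower r (- (INR k + 2))))).
- apply Rmult_le_compat_l; auto. left; apply Rpower_pos.
- right. replace (Rpower (INR (S d)) (Ropp 2))
    with (Rpower (INR (S d)) (INR k) * Rpower (INR (S d)) (- (INR k + 2))).
  + ring.
  + rewrite <- Rpower_plus. f_equal. ring.
Qed.

Lemma cosexp_bound (k : nat) (th r s : R) (d : nat) : 0 < r <= s ->
  Rabs (cosexp k th s d) <= Rpower (INR k + 2) (INR k + 2) * Rpower r (- (INR k + 2)) * quad_tail d.
Proof.
intros Hr. apply Rle_trans with (2 := pow_exp_bound k r d ltac:(lra)).
unfold cosexp. rewrite Rabs_mult. assert (HD := pos_INR (S d)).
assert (H1 : 0 <= INR (S d) ^ k * exp (- (INR (S d) * s))).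
{ apply Rmult_le_pos; [now apply pow_le|left; apply exp_pos]. }
rewrite (Rabs_pos_eq (_ * _)) by auto.
assert (Hc : Rabs (cos (2 * PI * INR (S d) * th)) <= 1) by (apply Rabs_le, COS_bound).
apply Rle_trans with (INR (S d) ^ k * exp (- (INR (S d) * s)) * 1).
- now apply Rmult_le_compat_l.
- rewrite Rmult_1_r. apply Rmult_le_compat_l; [now apply pow_le|]. apply exp_le. nra.
Qed.

Lemma ex_series_cosexp (k : nat) (th s : R) : 0 < s -> ex_series (cosexp k th s).
Proof.
intros Hs. eapply ex_series_dominated.
- intros d. apply cosexp_bound with (r := s); lra.
- apply ex_series_scal_R, ex_series_quad_tail.
Qed.

Lemma is_derive_Series_cosexp (k : nat) (th s : R) : 0 < s ->
  is_derive (fun s => Series (cosexp k th s)) s (- Series (cosexp (S k) th s)).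
Proof.
intros Hs. rewrite <- Series_opp.
assert (Hd : forall m d t, is_derive (fun t => cosexp m th t d) t (- cosexp (S m) th t d)).
{ intros m d t. unfold cosexp. generalize (INR (S d)); intros D. auto_derive; auto. simpl pow. ring. }
apply (is_derive_Series (fun d s => cosexp k th s d) (fun d s => - cosexp (S k) th s d)
  (fun d s => cosexp (S (S k)) th s d)
  (fun d => Rpower (INR (S (S k)) + 2) (INR (S (S k)) + 2) * Rpower (s / 2) (- (INR (S (S k)) + 2)) * quad_tail d)
  s (s / 2)).
- lra.
- intros; apply Hd.
- intros d t _. apply (is_derive_ext (fun t => - cosexp (S k) th t d)); [reflexivity|].
  rewrite <- (Ropp_involutive (cosexp (S (S k)) th t d)).
  apply (is_derive_opp (V := R_NormedModule) (fun t => cosexp (S k) th t d)). apply Hd.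
- intros d t H. apply Rabs_le_between in H. apply cosexp_bound; lra.
- apply ex_series_scal_R, ex_series_quad_tail.
- apply (ex_series_opp (V := R_NormedModule)). now apply ex_series_cosexp.
- intros t H. apply Rabs_le_between in H. apply ex_series_cosexp; lra.
Qed.

(** The real part of a geometric series, kept real: x_n = q^n cos(2 pi n th) satisfies a two-term
    recurrence with characteristic factor 1 - 2qc + q^2, and multiplying the partial sums by this
    factor makes them telescope. *)
Lemma poisson_sum (s th : R) : 0 < s -> / 2 + Series (cosexp 0 th s) = poisson_kernel s th.
Proof.
intros Hs. set (q := exp (- s)). set (c := cos (2 * PI * th)).
assert (Hq : 0 < q < 1).
{ split; [apply exp_pos|]. unfold q. rewrite <- exp_0. apply exp_increasing; lra. }
assert (Hc : -1 <= c <= 1) by apply COS_bound.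
assert (HD : 0 < 1 - 2 * q * c + q ^ 2) by nra.
assert (Hexp : forall d, exp (- (INR d * s)) = q ^ d).
{ induction d as [|d IHd].
  - simpl. now rewrite Rmult_0_l, Ropp_0, exp_0.
  - rewrite S_INR. replace (- ((INR d + 1) * s)) with (- s + - (INR d * s)) by ring.
    rewrite exp_plus, IHd. reflexivity. }
set (x := fun n : nat => q ^ n * cos (2 * PI * INR n * th)).
assert (Hrec : forall n, x (S (S n)) = 2 * q * c * x (S n) - q ^ 2 * x n).
{ intros n. unfold x, c. rewrite !S_INR.
  replace (2 * PI * (INR n + 1 + 1) * th) with (2 * PI * (INR n + 1) * th + 2 * PI * th) by ring.
  replace (2 * PI * INR n * th) with (2 * PI * (INR n + 1) * th - 2 * PI * th) by ring.
  rewrite cos_plus, cos_minus. simpl. ring. }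
assert (Hx0 : x O = 1) by (unfold x; simpl; rewrite Rmult_0_r, Rmult_0_l, cos_0; ring).
assert (Hx1 : x 1%nat = q * c) by (unfold x, c; simpl; rewrite !Rmult_1_r; ring).
assert (Hsum : forall n, sum_n (cosexp 0 th s) n =
  (q * c - q ^ 2 - x (S (S n)) + q ^ 2 * x (S n)) / (1 - 2 * q * c + q ^ 2)).
{ intros n.
  assert (Hl : forall d, cosexp 0 th s d = x (S d)).
  { intros d. unfold cosexp, x. rewrite Hexp. simpl. ring. }
  induction n as [|n IH].
  - rewrite sum_O, Hl, Hrec, Hx1, Hx0.
    match goal with |- ?a = ?b => change (@eq R a b) end. field. lra.
  - rewrite sum_Sn, IH, Hl, (Hrec (S n)). unfold plus; simpl plus.
    match goal with |- ?a = ?b => change (@eq R a b) end. simpl. field. lra. }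
assert (Hg : is_lim_seq (fun n => q ^ n) 0).
{ apply is_lim_seq_geom. rewrite Rabs_pos_eq; lra. }
assert (Hlx : is_lim_seq x 0).
{ apply (is_lim_seq_le_le (fun n => - q ^ n) x (fun n => q ^ n)).
  - intros n. unfold x. assert (0 < q ^ n) by (apply pow_lt; lra).
    generalize (COS_bound (2 * PI * INR n * th)); nra.
  - apply is_lim_seq_opp in Hg. simpl in Hg. now rewrite Ropp_0 in Hg.
  - exact Hg. }
assert (HS : is_series (cosexp 0 th s) ((q * c - q ^ 2) / (1 - 2 * q * c + q ^ 2))).
{ match goal with |- is_series ?a ?l => change (is_lim_seq (sum_n a) l) end.
  apply is_lim_seq_ext with (fun n => (q * c - q ^ 2 - x (S (S n)) + q ^ 2 * x (S n)) / (1 - 2 * q * c + q ^ 2)).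
  { intros n; now rewrite Hsum. }
  replace ((q * c - q ^ 2) / (1 - 2 * q * c + q ^ 2))
    with ((q * c - q ^ 2 - 0 + q ^ 2 * 0) / (1 - 2 * q * c + q ^ 2)) by (field; lra).
  apply is_lim_seq_div'; [|apply is_lim_seq_const|lra].
  apply is_lim_seq_plus'.
  - apply is_lim_seq_minus'; [apply is_lim_seq_const|].
    apply (is_lim_seq_incr_1 (fun n => x (S n))). now apply (is_lim_seq_incr_1 x).
  - apply is_lim_seq_mult'; [apply is_lim_seq_const|]. now apply (is_lim_seq_incr_1 x). }
rewrite (is_series_unique _ _ HS). unfold poisson_kernel. fold c. unfold sinh, cosh.
fold q. replace (exp s) with (/ q) by (unfold q; rewrite exp_Ropp, Rinv_inv; auto).
field. repeat split; try lra; nra.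
Qed.

(** Both sides of the case k are differentiated in s and the derivatives compared. The exponential
    side gains a sign, the lattice side the factor -(k + 1), hence the factorial; the constant 1/2
    survives only for k = 0. *)
Lemma lipschitz_formula (k : nat) (th s : R) : 0 < s -> 0 <= th <= 1 ->
  (match k with O => / 2 | _ => 0 end) + Series (cosexp k th s) =
  INR (fact k) * Series (lattice (S k) th s).
Proof.
intros Hs Ht. revert s Hs. induction k as [|k IH]; intros s Hs.
- rewrite poisson_sum by auto. rewrite (is_series_unique _ _ (lattice_1_series th s Hs Ht)).
  simpl. ring.
- assert (H1 : is_derive (fun s => match k with O => / 2 | _ => 0 end + Series (cosexp k th s)) s
    (- Series (cosexp (S k) th s))).
  { rewrite <- (Rplus_0_l (- _)).
    apply (is_derive_plus (V := R_NormedModule) (fun _ => match k with O => / 2 | _ => 0 end)).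
    - apply (is_derive_const (V := R_NormedModule)).
    - now apply is_derive_Series_cosexp. }
  assert (H2 : is_derive (fun s => match k with O => / 2 | _ => 0 end + Series (cosexp k th s)) s
    (INR (fact k) * (- INR (S k) * Series (lattice (S (S k)) th s)))).
  { apply (is_derive_ext_loc (fun s => INR (fact k) * Series (lattice (S k) th s))).
    - exists (mkposreal _ Hs). intros t Ht'. symmetry. apply IH.
      apply Rabs_lt_between' in Ht'. simpl in Ht'. lra.
    - apply (is_derive_scal (fun s => Series (lattice (S k) th s))). now apply is_derive_Series_lattice. }
  apply is_derive_unique in H1. apply is_derive_unique in H2. rewrite H1 in H2.
  rewrite fact_simpl, mult_INR. lra.
Qed.

(** * Modular transformation *)

Lemma invpow_real (n : nat) (v : R) : 0 < v -> invpow n v 0 = / v ^ n.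
Proof.
intros Hv. unfold invpow, cinvpow. change (v, 0) with (RtoC v).
rewrite <- RtoC_inv, <- RtoC_pow by lra. simpl. now rewrite pow_inv.
Qed.

(* z = v + iu equals i times the conjugate of u + iv; only even powers occur, so i disappears. *)
Lemma invpow_rotate (l : nat) (c u v : R) : 0 < c -> 0 < v ->
  invpow (2 * l) (c * v) (c * u) = / c ^ (2 * l) * (-1) ^ l * invpow (2 * l) u v.
Proof.
intros Hc Hv. unfold invpow, cinvpow.
assert (Hz : (u, v) <> RtoC 0) by (apply pair_neq_0; nra).
assert (Hzc : Cconj (u, v) <> RtoC 0).
{ unfold Cconj; simpl. apply pair_neq_0. nra. }
assert (Hcc : RtoC c <> RtoC 0) by (intros E; injection E; lra).
assert (E : (/ (c * v, c * u)%R)%C = (RtoC (/ c) * (- Ci * Cconj (/ (u, v))))%C).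
{ replace (c * v, c * u) with (RtoC c * (Ci * Cconj (u, v)))%C.
  - replace (Cconj (/ (u, v)))%C with (/ Cconj (u, v))%C.
    + rewrite RtoC_inv by lra. field_simplify_eq.
      * unfold Ci, Cmult, Copp, Cpow, RtoC; simpl. f_equal; ring.
      * repeat split; auto. intros E. injection E. lra.
    + unfold Cconj, Cinv; simpl. f_equal; field; nra.
  - unfold Cconj, Ci, Cmult; simpl. f_equal; ring. }
rewrite E, !Cpow_mult_l, !Cpow_mult_r.
assert (Ei : ((- Ci) ^ 2)%C = RtoC (-1)).
{ unfold Ci, Copp, Cpow, Cmult, RtoC; simpl. f_equal; ring. }
rewrite Ei, <- !RtoC_pow, <- !Cpow_mult_r, <- Cpow_conj.
assert (Re_scal : forall a b z, Re (RtoC a * (RtoC b * Cconj z))%C = a * b * Re z).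
{ intros a b [z1 z2]. simpl. ring. }
rewrite Re_scal, <- pow_mult, pow_inv. reflexivity.
Qed.

Lemma Cmod_Cinv_sqr_le (x v : R) : 0 < x -> 0 < v -> Cmod (/ (x, v)) ^ 2 <= / (2 * x * v).
Proof.
intros Hx Hv. rewrite Cmod_Cinv_sqr by nra.
assert (0 < x * v) by nra.
apply Rinv_le_contravar; [nra|]. assert (0 <= (x - v) ^ 2) by apply pow2_ge_0. nra.
Qed.

(** From x^2 + v^2 >= 2xv the variables separate, which yields a product majorant. It is summable in
    each variable for l >= 2; for l = 1 it is harmonic. *)
Lemma invpow_even_le (l : nat) (x v : R) : 0 < x -> 0 < v ->
  Rabs (invpow (2 * l) x v) <= (/ (2 * x)) ^ l * (/ v) ^ l.
Proof.
intros Hx Hv. apply Rle_trans with (1 := Rabs_invpow_le _ _ _).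
rewrite pow_mult, <- Rpow_mult_distr. apply pow_incr. split; [apply pow2_ge_0|].
rewrite <- Rinv_mult. now apply Cmod_Cinv_sqr_le.
Qed.

Lemma inv_pow_Rpower (x : R) (l : nat) : 0 < x -> (/ x) ^ l = Rpower x (- INR l).
Proof. intros Hx. rewrite Rpower_Ropp, Rpower_pow, pow_inv; auto. Qed.

Lemma ex_series_inv_pow (c u : R) (l : nat) : 0 < c -> 0 < u -> (2 <= l)%nat ->
  ex_series (fun m => (/ (c * (INR m + u))) ^ l).
Proof.
intros Hc Hu Hl.
apply ex_series_ext with (fun m => (/ c) ^ l * Rpower (INR m + u) (- INR l)).
- intros m. assert (0 <= INR m) by apply pos_INR.
  rewrite Rinv_mult, Rpow_mult_distr, (inv_pow_Rpower (INR m + u)); auto; lra.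
- apply ex_series_scal_R, ex_series_Rpower_shift; auto.
  apply le_INR in Hl. simpl in Hl. lra.
Qed.

Definition invsum (l : nat) (s v : R) : R := Series (fun m => invpow (2 * l) (INR (S m) * s) v).

(** A quarter turn moves ms to the imaginary position, where [invpow_bound] gives quadratic decay
    also for l = 1. The scale c = 2 pi / s turns ms into 2 pi m. *)
Lemma ex_series_invsum (l : nat) (s v : R) : (1 <= l)%nat -> 0 < s -> 0 < v ->
  ex_series (fun m => invpow (2 * l) (INR m * s) v).
Proof.
intros Hl Hs Hv. assert (HPI := PI_RGT_0).
set (c := 2 * PI / s). assert (Hc : 0 < c) by (apply Rdiv_lt_0_compat; lra).
destruct l as [|l]; [lia|].
apply ex_series_ext with (fun m => c ^ (2 * S l) * (-1) ^ S l * invpow (2 * S l) (c * v) (2 * PI * INR m)).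
- intros m. replace (2 * PI * INR m) with (c * (INR m * s)) by (unfold c; field; lra).
  rewrite invpow_rotate by auto.
  assert (E1 : (-1) ^ S l * (-1) ^ S l = 1).
  { rewrite <- Rpow_mult_distr. replace (-1 * -1) with 1 by ring. apply pow1. }
  assert (E2 : c ^ (2 * S l) <> 0) by (apply pow_nonzero; lra).
  transitivity ((c ^ (2 * S l) * / c ^ (2 * S l)) * ((-1) ^ S l * (-1) ^ S l) * invpow (2 * S l) (INR m * s) v).
  + Rring.
  + rewrite E1, Rinv_r by auto. Rring.
- apply ex_series_scal_R.
  eapply ex_series_dominated.
  + intros m. replace (2 * S l)%nat with (S (S (2 * l))) by lia.
    apply invpow_bound with (r := c * v); [nra|]. apply INR_le_2PI, Rle_refl.
  + apply ex_series_scal_R, ex_series_quad_tail.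
Qed.

(** The Lipschitz formula in the variable m, at angle 0. There [lattice] pairs m with m + 1, so that
    0 is counted once and every positive integer twice; removing the term m = 0 produces 1/v^(2l),
    from which the zeta values arise. *)
Lemma invsum_eq (l : nat) (s v : R) : (1 <= l)%nat -> 0 < s -> 0 < v ->
  INR (fact (2 * l - 1)) * invsum l s v =
  (-1) ^ l / 2 * ((2 * PI / s) ^ (2 * l) * Series (cosexp (2 * l - 1) 0 (2 * PI / s * v))
    - INR (fact (2 * l - 1)) * / v ^ (2 * l)).
Proof.
intros Hl Hs Hv. assert (HPI := PI_RGT_0).
set (c := 2 * PI / s). assert (Hc : 0 < c) by (apply Rdiv_lt_0_compat; lra).
assert (H := lipschitz_formula (2 * l - 1) 0 (c * v) ltac:(nra) ltac:(lra)).
replace (S (2 * l - 1)) with (2 * l)%nat in H by lia.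
assert (E0 : match (2 * l - 1)%nat with O => / 2 | _ => 0 end = 0).
{ destruct (2 * l - 1)%nat eqn:E; [lia|reflexivity]. }
rewrite E0, Rplus_0_l in H. rewrite H.
assert (exg := ex_series_invsum l s v Hl Hs Hv).
set (g := fun m => invpow (2 * l) (INR m * s) v) in exg.
assert (E : Series (lattice (2 * l) 0 (c * v)) = / c ^ (2 * l) * (-1) ^ l * (g O + 2 * invsum l s v)).
{ rewrite (Series_ext _ (fun m => / c ^ (2 * l) * (-1) ^ l * (g m + g (S m)))).
  - rewrite Series_scal_l, Series_plus; auto.
    + rewrite (Series_incr_1 g) by auto. unfold invsum. fold (g). unfold g. ring.
    + now apply (ex_series_incr_1 g).
  - intros m. unfold lattice, g. rewrite Rplus_0_r, Rminus_0_r, <- S_INR.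
    replace (2 * PI * INR m) with (c * (INR m * s)) by (unfold c; field; lra).
    replace (2 * PI * INR (S m)) with (c * (INR (S m) * s)) by (unfold c; field; lra).
    rewrite !invpow_rotate by auto.
    Rring. }
assert (E1 : (-1) ^ l * (-1) ^ l = 1).
{ rewrite <- Rpow_mult_distr. replace (-1 * -1) with 1 by ring. apply pow1. }
(* The rotation with scale 1 evaluates the term m = 0, where the complex number iv is purely
   imaginary. *)
assert (Eg : / v ^ (2 * l) = (-1) ^ l * g O).
{ rewrite <- invpow_real by auto. unfold g. simpl INR. rewrite Rmult_0_l.
  replace v with (1 * v) at 1 by ring. replace 0 with (1 * 0) at 1 by ring.
  rewrite invpow_rotate by lra. rewrite pow1. field. }
rewrite E, Eg.
assert (E2 : c ^ (2 * l) <> 0) by (apply pow_nonzero; lra).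
set (f := INR (fact (2 * l - 1))). set (e := (-1) ^ l) in *.
replace (c ^ (2 * l) * (f * (/ c ^ (2 * l) * e * (g O + 2 * invsum l s v))))
  with (f * e * (g O + 2 * invsum l s v)) by (field; auto).
transitivity ((e * e) * f * invsum l s v); [rewrite E1; ring|field].
Qed.

Lemma ex_series_even_odd_lattice (th c : R) (l : nat) : 0 < th < 1 -> 0 < c -> (2 <= l)%nat ->
  ex_series (fun j => (/ (c * (INR j + th))) ^ l + (/ (c * (INR j + 1 - th))) ^ l).
Proof.
intros Ht Hc Hl. apply (ex_series_plus (V := R_NormedModule)).
- apply ex_series_inv_pow; auto; lra.
- apply ex_series_ext with (fun j => (/ (c * (INR j + (1 - th)))) ^ l).
  + intros j. do 3 f_equal. ring.
  + apply ex_series_inv_pow; auto; lra.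
Qed.

Definition invsum_pair (l : nat) (th s : R) (j : nat) : R :=
  invsum l s (2 * PI * (INR j + th)) + invsum l s (2 * PI * (INR j + 1 - th)).

Lemma lattice_swap_ge2 (l : nat) (th s : R) : (2 <= l)%nat -> 0 < th < 1 -> 0 < s ->
  ex_series (invsum_pair l th s) /\
  Series (fun m => Series (lattice (2 * l) th (INR (S m) * s))) = Series (invsum_pair l th s).
Proof.
intros Hl Ht Hs. assert (HPI := PI_RGT_0).
set (M := fun m => (/ (2 * s * (INR m + 1))) ^ l).
set (N := fun j => (/ (2 * PI * (INR j + th))) ^ l + (/ (2 * PI * (INR j + 1 - th))) ^ l).
assert (Hj : forall j, 0 < 2 * PI * (INR j + th) /\ 0 < 2 * PI * (INR j + 1 - th)).
{ intros j. assert (0 <= INR j) by apply pos_INR. split; apply Rmult_lt_0_compat; lra. }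
assert (Hb : forall m j, Rabs (lattice (2 * l) th (INR (S m) * s) j) <= M m * N j).
{ intros m j. destruct (Hj j) as [H1 H2]. assert (0 <= INR m) by apply pos_INR.
  assert (0 < INR (S m) * s) by (rewrite S_INR; nra).
  unfold lattice, M, N. apply Rle_trans with (1 := Rabs_triang _ _). rewrite (Rmult_plus_distr_l (_ ^ l)).
  replace (2 * s * (INR m + 1)) with (2 * (INR (S m) * s)) by (rewrite S_INR; ring).
  apply Rplus_le_compat; now apply invpow_even_le. }
assert (HM0 : forall m, 0 <= M m).
{ intros m. assert (0 <= INR m) by apply pos_INR. apply pow_le. left; apply Rinv_0_lt_compat; nra. }
assert (HN0 : forall j, 0 <= N j).
{ intros j. destruct (Hj j) as [H1 H2]. unfold N.
  apply Rplus_le_le_0_compat; apply pow_le; left; now apply Rinv_0_lt_compat. }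
assert (HM : ex_series M) by (apply ex_series_inv_pow; auto; lra).
assert (HN : ex_series N) by (apply ex_series_even_odd_lattice; auto; lra).
assert (E : forall j, Series (fun m => lattice (2 * l) th (INR (S m) * s) j) = invsum_pair l th s j).
{ intros j. destruct (Hj j) as [H1 H2]. unfold lattice, invsum_pair, invsum.
  apply Series_plus.
  - apply (ex_series_incr_1 (fun m => invpow (2 * l) (INR m * s) (2 * PI * (INR j + th)))).
    apply ex_series_invsum; auto; lia.
  - apply (ex_series_incr_1 (fun m => invpow (2 * l) (INR m * s) (2 * PI * (INR j + 1 - th)))).
    apply ex_series_invsum; auto; lia. }
split.
- apply ex_series_ext with (1 := E).
  apply (ex_series_product_dominated (fun j m => lattice (2 * l) th (INR (S m) * s) j) N M); auto.
  intros j m. rewrite (Rmult_comm (N j)). apply Hb.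
- rewrite (Series_swap _ M N); auto. now apply Series_ext.
Qed.

(* The double series for k = 1 converges only conditionally.  Subtracting the real part of
   1/(z^2 - s^2/4) = (1/(z - s/2) - 1/(z + s/2))/s, z = ms + iv, which telescopes in m, makes it
   absolutely convergent. *)
Definition regularized_term (s v : R) (m : nat) : R :=
  invpow 2 (INR (S m) * s) v
  - / s * (invpow 1 ((INR m + / 2) * s) v - invpow 1 ((INR (S m) + / 2) * s) v).

(** With h = s/2 one has 1/z^2 - 1/(z^2 - h^2) = -h^2 / (z^2 (z - h)(z + h)). The gain of two powers
    lets x^2 + v^2 >= 2xv be used twice, leaving 1/(m^2 v^2), summable in both variables. *)
Lemma regularized_term_bound (s v : R) (m : nat) : 0 < s -> 0 < v ->
  Rabs (regularized_term s v m) <= (/ (2 * (INR m + 1))) ^ 2 * (/ v) ^ 2.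
Proof.
intros Hs Hv. assert (Hm := pos_INR m). unfold regularized_term. rewrite S_INR.
set (x := (INR m + 1) * s).
replace ((INR m + / 2) * s) with (x - s / 2) by (unfold x; field).
replace ((INR m + 1 + / 2) * s) with (x + s / 2) by (unfold x; field).
set (z := (x, v) : C). set (w1 := (x - s / 2, v) : C). set (w2 := (x + s / 2, v) : C).
assert (Hx : 0 < x) by (unfold x; nra).
assert (Hx1 : 0 < x - s / 2) by (unfold x; nra).
assert (Hz : z <> RtoC 0) by (apply pair_neq_0; nra).
assert (Hw1 : w1 <> RtoC 0) by (apply pair_neq_0; nra).
assert (Hw2 : w2 <> RtoC 0) by (apply pair_neq_0; nra).
assert (Hsc : RtoC s <> RtoC 0) by (intros E; injection E; lra).
assert (E : invpow 2 x v - / s * (invpow 1 (x - s / 2) v - invpow 1 (x + s / 2) v) =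
  Re (- RtoC (s ^ 2 / 4) * ((/ z) ^ 2 * (/ w1 * / w2)))%C).
{ replace (- RtoC (s ^ 2 / 4) * ((/ z) ^ 2 * (/ w1 * / w2)))%C
    with ((/ z) ^ 2 - RtoC (/ s) * ((/ w1) ^ 1 - (/ w2) ^ 1))%C.
  - unfold invpow, cinvpow. fold z w1 w2.
    generalize ((/ z) ^ 2)%C ((/ w1) ^ 1)%C ((/ w2) ^ 1)%C. intros [a1 a2] [b1 b2] [c1 c2].
    simpl. ring.
  - assert (E1 : w1 = (z - RtoC (s / 2))%C) by (unfold w1, z, Cminus, Cplus, Copp, RtoC; simpl; f_equal; ring).
    assert (E2 : w2 = (z + RtoC (s / 2))%C) by (unfold w2, z, Cplus, RtoC; simpl; f_equal; ring).
    rewrite E1 in *. rewrite E2 in *.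
    (* Everything is expressed through h = s/2 as an opaque complex number, so that the identity
       becomes one of rational functions in z and h. *)
    replace (RtoC (s ^ 2 / 4)) with (RtoC (s / 2) * RtoC (s / 2))%C.
    2: { rewrite <- RtoC_mult. f_equal. field. }
    replace (RtoC (/ s)) with (/ (RtoC (s / 2) + RtoC (s / 2)))%C.
    2: { rewrite <- RtoC_plus, <- RtoC_inv by lra. f_equal. field. lra. }
    assert (Hh : RtoC (s / 2) <> RtoC 0) by (intros Eh; injection Eh; lra).
    assert (H2h : (RtoC (s / 2) + RtoC (s / 2))%C <> RtoC 0).
    { rewrite <- RtoC_plus. intros Eh; injection Eh; lra. }
    generalize dependent (RtoC (s / 2)). clear - Hz. intros h. intros.
    field. repeat split; auto. }
rewrite E. apply Rle_trans with (1 := re_le_Cmod _).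
rewrite Cmod_mult, Cmod_opp, Cmod_R, Rabs_pos_eq by nra.
rewrite !Cmod_mult, Cmod_pow.
assert (B0 := Cmod_Cinv_sqr_le x v Hx Hv). fold z in B0.
assert (B1 := Cmod_Cinv_sqr_le (x - s / 2) v Hx1 Hv). fold w1 in B1.
assert (B2 : Cmod (/ w2) <= Cmod (/ w1)).
{ rewrite !Cmod_inv by auto. apply Rinv_le_contravar; [now apply Cmod_gt_0|].
  unfold Cmod, w1, w2. simpl fst; simpl snd. apply sqrt_le_1_alt. nra. }
assert (G1 := Cmod_ge_0 (/ w1)%C). assert (G2 := Cmod_ge_0 (/ w2)%C).
assert (B3 : Cmod (/ w1) * Cmod (/ w2) <= / (x * v)).
{ apply Rle_trans with (Cmod (/ w1) ^ 2); [nra|]. apply Rle_trans with (1 := B1).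
  apply Rinv_le_contravar; [nra|]. assert (x <= 2 * (x - s / 2)); [unfold x; nra|nra]. }
apply Rle_trans with (s ^ 2 / 4 * (/ (2 * x * v) * / (x * v))).
- apply Rmult_le_compat_l; [nra|]. apply Rmult_le_compat; auto.
  + apply pow2_ge_0. + nra.
- replace ((/ (2 * (INR m + 1))) ^ 2 * (/ v) ^ 2) with (2 * (s ^ 2 / 4 * (/ (2 * x * v) * / (x * v)))).
  + assert (0 <= s ^ 2 / 4 * (/ (2 * x * v) * / (x * v))); [|lra].
    apply Rmult_le_pos; [nra|]. apply Rmult_le_pos; left; apply Rinv_0_lt_compat; nra.
  + unfold x. field. lra.
Qed.

Lemma is_series_telescope (a : nat -> R) (l : R) : is_lim_seq a l ->
  is_series (fun m => a m - a (S m)) (a O - l).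
Proof.
intros H. change (is_lim_seq (sum_n (fun m => a m - a (S m))) (a O - l)).
apply is_lim_seq_ext with (fun n => a O - a (S n)).
- induction n as [|n IH].
  + now rewrite sum_O.
  + rewrite sum_Sn, <- IH. unfold plus; simpl. ring.
- apply is_lim_seq_minus'; [apply is_lim_seq_const|]. now apply (is_lim_seq_incr_1 a).
Qed.

Lemma is_lim_seq_inv_lin (s : R) : 0 < s -> is_lim_seq (fun m => / ((INR m + / 2) * s)) 0.
Proof.
intros Hs. replace (Finite 0) with (Rbar_inv p_infty) by reflexivity.
apply is_lim_seq_inv; [|discriminate].
apply is_lim_seq_le_p_loc with (fun m => s * INR m).
- exists O. intros m _. assert (0 <= INR m) by apply pos_INR. nra.
- assert (H := is_lim_seq_scal_l INR s p_infty is_lim_seq_INR).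
  replace (Rbar_mult s p_infty) with p_infty in H; auto.
  simpl. destruct (Rle_dec 0 s); [|lra]. destruct (Rle_lt_or_eq_dec 0 s r); [reflexivity|lra].
Qed.

Lemma is_lim_seq_invpow1 (s v : R) : 0 < s -> is_lim_seq (fun m => invpow 1 ((INR m + / 2) * s) v) 0.
Proof.
intros Hs. apply is_lim_seq_abs_0.
apply (is_lim_seq_le_le (fun _ => 0) _ (fun m => / ((INR m + / 2) * s))).
- intros m. assert (0 <= INR m) by apply pos_INR. split; [apply Rabs_pos|].
  apply Rle_trans with (1 := Rabs_invpow_le _ _ _). rewrite pow_1.
  apply Cmod_Cinv_le. nra.
- apply is_lim_seq_const.
- now apply is_lim_seq_inv_lin.
Qed.

(** The limit is the constant Fourier coefficient, the cosine series being exponentially small. Each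
    lattice term of the same kernel tends to 0, so limit and lattice sum do not commute; this
    discrepancy is the delta term. *)
Lemma is_lim_seq_poisson_kernel (s th : R) : 0 < s -> is_lim_seq (fun m => poisson_kernel ((INR m + / 2) * s) th) (/ 2).
Proof.
intros Hs. set (K := Rpower (INR 0 + 2) (INR 0 + 2)).
set (r := fun m : nat => (INR m + / 2) * s).
assert (Hr : forall m, 0 < r m).
{ intros m. assert (0 <= INR m) by apply pos_INR. unfold r. nra. }
apply is_lim_seq_ext with (fun m => / 2 + Series (cosexp 0 th (r m))).
{ intros m. now rewrite poisson_sum. }
replace (Finite (/ 2)) with (Finite (/ 2 + 0)) by (now rewrite Rplus_0_r).
apply is_lim_seq_plus'; [apply is_lim_seq_const|].
apply is_lim_seq_abs_0.
apply (is_lim_seq_le_le (fun _ => 0) _ (fun m => K * Series quad_tail * (/ r m * / r m))).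
- intros m. split; [apply Rabs_pos|].
  replace (K * Series quad_tail * (/ r m * / r m)) with (K * Rpower (r m) (- (INR 0 + 2)) * Series quad_tail).
  + rewrite <- Series_scal_l. apply Series_abs_le.
    * intros d. apply cosexp_bound. specialize (Hr m); lra.
    * apply ex_series_scal_R, ex_series_quad_tail.
  + replace (INR 0 + 2) with (INR 2) by (simpl; ring).
    rewrite <- inv_pow_Rpower by auto. simpl. ring.
- apply is_lim_seq_const.
- replace (Finite 0) with (Finite (K * Series quad_tail * (0 * 0))) by (f_equal; ring).
  apply is_lim_seq_mult'; [apply is_lim_seq_const|].
  apply is_lim_seq_mult'; now apply is_lim_seq_inv_lin.
Qed.

Lemma ex_series_cosexp_double (k : nat) (th s : R) : 0 < s ->
  ex_series (fun m => Series (cosexp k th (INR (S m) * s))).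
Proof.
intros Hs.
apply (ex_series_product_dominated (fun m => cosexp k th (INR (S m) * s))
  (fun m => Rpower (INR k + 2) (INR k + 2) * Rpower s (- (INR k + 2)) * Rpower (INR (S m)) (- (INR k + 2)))
  quad_tail).
- intros m d. assert (H : 0 < INR (S m)) by (apply lt_0_INR; lia).
  apply Rle_trans with (1 := cosexp_bound k th (INR (S m) * s) (INR (S m) * s) d ltac:(nra)).
  rewrite <- Rpower_mult_distr by auto. right; ring.
- apply ex_series_scal_R, ex_series_Rpower. generalize (pos_INR k); lra.
- apply ex_series_quad_tail.
Qed.

(** The regularized double series may be swapped. Its subtracted part sums to (P 0 - 1/2)/s when j
    is summed before m, but to (P 0)/s when m is summed before j; the difference is 1/(2s). *)
Lemma lattice_swap_1 (th s : R) : 0 < th < 1 -> 0 < s ->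
  ex_series (invsum_pair 1 th s) /\
  Series (fun m => Series (lattice 2 th (INR (S m) * s))) = Series (invsum_pair 1 th s) - / (2 * s).
Proof.
intros Ht Hs. assert (HPI := PI_RGT_0).
set (b := fun m j => regularized_term s (2 * PI * (INR j + th)) m + regularized_term s (2 * PI * (INR j + 1 - th)) m).
set (M := fun m => (/ (2 * (INR m + 1))) ^ 2).
set (N := fun j => (/ (2 * PI * (INR j + th))) ^ 2 + (/ (2 * PI * (INR j + 1 - th))) ^ 2).
assert (Hj : forall j, 0 < 2 * PI * (INR j + th) /\ 0 < 2 * PI * (INR j + 1 - th)).
{ intros j. assert (0 <= INR j) by apply pos_INR. split; apply Rmult_lt_0_compat; lra. }
assert (Hb : forall m j, Rabs (b m j) <= M m * N j).
{ intros m j. destruct (Hj j) as [H1 H2].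
  unfold b, M, N. apply Rle_trans with (1 := Rabs_triang _ _). rewrite (Rmult_plus_distr_l (_ ^ 2)).
  apply Rplus_le_compat; now apply regularized_term_bound. }
assert (HM0 : forall m, 0 <= M m) by (intros m; apply pow2_ge_0).
assert (HN0 : forall j, 0 <= N j) by (intros j; unfold N; apply Rplus_le_le_0_compat; apply pow2_ge_0).
assert (HM : ex_series M) by (apply ex_series_inv_pow; auto; lra).
assert (HN : ex_series N) by (apply ex_series_even_odd_lattice; auto; lra).
set (P := fun m => poisson_kernel ((INR m + / 2) * s) th).
assert (HP : is_series (fun m => P m - P (S m)) (P O - / 2)) by (apply is_series_telescope; now apply is_lim_seq_poisson_kernel).
assert (Hrow : forall m, Series (b m) = Series (lattice 2 th (INR (S m) * s)) - / s * (P m - P (S m))).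
{ intros m. assert (Hm : 0 <= INR m) by apply pos_INR. assert (HSm : INR (S m) = INR m + 1) by apply S_INR.
  assert (H1 := lattice_1_series th ((INR m + / 2) * s) ltac:(nra) ltac:(lra)).
  assert (H2 := lattice_1_series th ((INR (S m) + / 2) * s) ltac:(rewrite HSm; nra) ltac:(lra)).
  assert (H0 := Series_correct _ (ex_series_lattice 1 th (INR (S m) * s) ltac:(rewrite HSm; nra) ltac:(lra))).
  apply is_series_unique.
  assert (H3 := is_series_minus (V := R_NormedModule) _ _ _ _ H0
     (is_series_scal (/ s) _ _ (is_series_minus (V := R_NormedModule) _ _ _ _ H1 H2))).
  apply is_series_ext with (2 := H3).
  intros j. unfold b, regularized_term, lattice, minus, plus, opp, scal; simpl. unfold mult; simpl. ring. }
assert (Hcol : forall j, is_series (fun m => b m j) (invsum_pair 1 th s j - / s * lattice 1 th (s / 2) j)).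
{ intros j. destruct (Hj j) as [H1 H2].
  assert (Hone : forall v, 0 < v -> is_series (regularized_term s v) (invsum 1 s v - / s * invpow 1 (s / 2) v)).
  { intros v Hv. assert (T := is_series_telescope _ _ (is_lim_seq_invpow1 s v Hs)).
    assert (E := Series_correct _ (proj1 (ex_series_incr_1 (fun m => invpow (2 * 1) (INR m * s) v))
       (ex_series_invsum 1 s v (le_n 1) Hs Hv))).
    assert (H3 := is_series_minus (V := R_NormedModule) _ _ _ _ E (is_series_scal (/ s) _ _ T)).
    replace (invsum 1 s v - / s * invpow 1 (s / 2) v)
      with (minus (invsum 1 s v) (scal (/ s) (invpow 1 ((INR 0 + / 2) * s) v - 0))).
    - apply is_series_ext with (2 := H3). intros m. reflexivity.
    - unfold minus, plus, opp, scal; simpl. unfold mult; simpl.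
      replace ((0 + / 2) * s) with (s / 2) by field. ring. }
  assert (H3 := is_series_plus (V := R_NormedModule) _ _ _ _ (Hone _ H1) (Hone _ H2)).
  replace (invsum_pair 1 th s j - / s * lattice 1 th (s / 2) j) with
    (plus (invsum 1 s (2 * PI * (INR j + th)) - / s * invpow 1 (s / 2) (2 * PI * (INR j + th)))
          (invsum 1 s (2 * PI * (INR j + 1 - th)) - / s * invpow 1 (s / 2) (2 * PI * (INR j + 1 - th)))).
  - exact H3.
  - unfold invsum_pair, lattice, plus; simpl. ring. }
assert (exj : ex_series (fun j => Series (fun m => b m j))).
{ apply (ex_series_product_dominated (fun j m => b m j) N M); auto.
  intros j m. rewrite (Rmult_comm (N j)). apply Hb. }
assert (HL := lattice_1_series th (s / 2) ltac:(lra) ltac:(lra)).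
assert (exL : ex_series (lattice 1 th (s / 2))) by (exists (poisson_kernel (s / 2) th); exact HL).
assert (Ecol : forall j, Series (fun m => b m j) + / s * lattice 1 th (s / 2) j = invsum_pair 1 th s j).
{ intros j. rewrite (is_series_unique _ _ (Hcol j)). ring. }
assert (exI : ex_series (invsum_pair 1 th s)).
{ apply ex_series_ext with (1 := Ecol).
  apply (ex_series_plus (V := R_NormedModule)); auto. now apply ex_series_scal_R. }
split; auto.
assert (EI : Series (invsum_pair 1 th s) = Series (fun j => Series (fun m => b m j)) + / s * P O).
{ rewrite <- (Series_ext _ _ Ecol), Series_plus, Series_scal_l; auto.
  - rewrite (is_series_unique _ _ HL). unfold P. simpl INR. do 3 f_equal. field.
  - now apply ex_series_scal_R. }
(* No absolute bound on the double series gives this; the Lipschitz formula turns each row into an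
   exponentially decaying cosine series. *)
assert (exm : ex_series (fun m => Series (lattice 2 th (INR (S m) * s)))).
{ apply ex_series_ext with (2 := ex_series_cosexp_double 1 th s Hs).
  intros m. assert (Hm : 0 <= INR m) by apply pos_INR. assert (HSm : INR (S m) = INR m + 1) by apply S_INR.
  assert (H := lipschitz_formula 1 th (INR (S m) * s) ltac:(rewrite HSm; nra) ltac:(lra)).
  simpl (INR (fact 1)) in H. lra. }
rewrite EI, <- (Series_swap b M N), (Series_ext _ _ Hrow); auto.
rewrite Series_minus, Series_scal_l, (is_series_unique _ _ HP); auto.
- field. lra.
- apply ex_series_scal_R. now exists (P O - / 2).
Qed.

(* The transformation s -> 4 pi^2/s with k = 2l - 1; 1/(2s) is the quasi-modular defect of weight 2. *)
Lemma modular_identity (l : nat) (th s : R) : (1 <= l)%nat -> 0 < th < 1 -> 0 < s ->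
  is_series (fun j =>
    (-1) ^ l / 2 * ((2 * PI / s) ^ (2 * l) *
       (Series (cosexp (2 * l - 1) 0 (2 * PI / s * (2 * PI * (INR j + th))))
        + Series (cosexp (2 * l - 1) 0 (2 * PI / s * (2 * PI * (INR j + 1 - th)))))
    - INR (fact (2 * l - 1)) * (/ (2 * PI * (INR j + th)) ^ (2 * l) + / (2 * PI * (INR j + 1 - th)) ^ (2 * l))))
  (Series (fun m => Series (cosexp (2 * l - 1) th (INR (S m) * s))) + (if Nat.eqb l 1 then / (2 * s) else 0)).
Proof.
intros Hl Ht Hs. assert (HPI := PI_RGT_0).
assert (H : ex_series (invsum_pair l th s) /\
  Series (fun m => Series (lattice (2 * l) th (INR (S m) * s))) =
  Series (invsum_pair l th s) - (if Nat.eqb l 1 then / (2 * s) else 0)).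
{ destruct (Nat.eqb_spec l 1) as [->|Hne].
  - now apply lattice_swap_1.
  - rewrite Rminus_0_r. apply lattice_swap_ge2; auto. lia. }
destruct H as [Hex Heq].
set (f := INR (fact (2 * l - 1))).
assert (EL : Series (fun m => Series (cosexp (2 * l - 1) th (INR (S m) * s))) =
   f * Series (fun m => Series (lattice (2 * l) th (INR (S m) * s)))).
{ rewrite <- Series_scal_l. apply Series_ext. intros m.
  assert (Hm : 0 <= INR m) by apply pos_INR. assert (HSm : INR (S m) = INR m + 1) by apply S_INR.
  assert (H := lipschitz_formula (2 * l - 1) th (INR (S m) * s) ltac:(rewrite HSm; nra) ltac:(lra)).
  replace (S (2 * l - 1)) with (2 * l)%nat in H by lia.
  destruct (2 * l - 1)%nat eqn:E; [lia|]. unfold f. rewrite <- H. ring. }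
(* The factorial may multiply the defect because it equals 1 when l = 1. *)
assert (Ef : (if Nat.eqb l 1 then / (2 * s) else 0) = f * (if Nat.eqb l 1 then / (2 * s) else 0)).
{ destruct (Nat.eqb_spec l 1) as [->|_]; [unfold f; simpl; ring|ring]. }
rewrite Ef, EL, Heq.
replace (f * (Series (invsum_pair l th s) - (if (l =? 1)%nat then / (2 * s) else 0)) +
  f * (if (l =? 1)%nat then / (2 * s) else 0)) with (f * Series (invsum_pair l th s)) by ring.
apply is_series_ext with (fun j => f * invsum_pair l th s j).
- intros j. assert (0 <= INR j) by apply pos_INR. unfold invsum_pair.
  rewrite Rmult_plus_distr_l. unfold f. rewrite !invsum_eq; auto.
  + Rring. + apply Rmult_lt_0_compat; lra. + apply Rmult_lt_0_compat; lra.
- apply (is_series_scal (V := R_NormedModule) f). now apply Series_correct.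
Qed.

(** * Improper integrals over (0, oo) *)

Definition is_RInt_0_oo (f : R -> R) (l : R) : Prop := is_RInt_gen f (at_right 0) (Rbar_locally p_infty) l.

Lemma is_RInt_0_oo_intro (f : R -> R) (l : R) :
  (forall a b, 0 < a < b -> ex_RInt f a b) ->
  (forall eps, 0 < eps -> exists d T, 0 < d < T /\
     forall a b, 0 < a < d -> T < b -> Rabs (RInt f a b - l) < eps) -> is_RInt_0_oo f l.
Proof.
intros Hex H P [eps HP]. destruct (H eps (cond_pos eps)) as [d [T [HdT Hlim]]].
apply (Filter_prod _ _ _ (fun a => 0 < a < d) (fun b => T < b)).
- exists (mkposreal d (proj1 HdT)). intros y Hy Hy0. apply Rabs_lt_between' in Hy. simpl in Hy. lra.
- now exists T.
- intros a b Ha Hb. exists (RInt f a b). split.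
  + apply (RInt_correct f). apply Hex. lra.
  + apply HP. now apply Hlim.
Qed.

(** The filter gives integrability only on sufficiently large windows; every smaller interval
    inherits it by restriction. *)
Lemma is_RInt_0_oo_elim (f : R -> R) (l : R) : is_RInt_0_oo f l ->
  (forall a b, 0 < a <= b -> ex_RInt f a b) /\
  (forall eps, 0 < eps -> exists d T, 0 < d < T /\
     forall a b, 0 < a < d -> T < b -> Rabs (RInt f a b - l) < eps).
Proof.
intros H.
assert (Hlim : forall eps, 0 < eps -> exists d T, 0 < d < T /\
     forall a b, 0 < a < d -> T < b -> ex_RInt f a b /\ Rabs (RInt f a b - l) < eps).
{ intros eps Heps.
  destruct (H (ball l (mkposreal eps Heps)) (locally_ball l _)) as [Q1 Q2 HQ1 HQ2 HQ].
  destruct HQ1 as [d Hd]. destruct HQ2 as [T HT].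
  set (d' := Rmin d 1). assert (Hd' : 0 < d' <= 1).
  { split; [apply Rmin_pos; [apply cond_pos|lra]|apply Rmin_r]. }
  assert (Hdd : d' <= d) by apply Rmin_l.
  exists d', (Rmax T 2). assert (HT2 := Rmax_r T 2). assert (HT1 := Rmax_l T 2).
  split; [lra|]. intros a b Ha Hb.
  destruct (HQ a b) as [y [Hy1 Hy2]].
  - apply Hd; [|lra]. apply Rabs_lt_between'. lra.
  - apply HT. lra.
  - simpl in Hy1. split; [now exists y|]. rewrite (is_RInt_unique _ _ _ _ Hy1). exact Hy2. }
split.
- intros a b Hab. destruct (Hlim 1 Rlt_0_1) as [d [T [HdT HdT2]]].
  set (a0 := Rmin a (d / 2)). set (b0 := Rmax b (T + 1)).
  assert (H1 := Rmin_l a (d / 2)). assert (H2 := Rmin_r a (d / 2)).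
  assert (H3 := Rmax_l b (T + 1)). assert (H4 := Rmax_r b (T + 1)).
  assert (Ha0 : 0 < a0) by (apply Rmin_pos; lra).
  fold a0 in H1, H2. fold b0 in H3, H4.
  apply (ex_RInt_Chasles_2 f a0); [lra|]. apply (ex_RInt_Chasles_1 f a0 b b0); [lra|].
  apply HdT2; lra.
- intros eps Heps. destruct (Hlim eps Heps) as [d [T [HdT HdT2]]].
  exists d, T. split; auto. intros; now apply HdT2.
Qed.

Lemma is_RInt_0_oo_scal (c : R) (f : R -> R) (l : R) : is_RInt_0_oo f l -> is_RInt_0_oo (fun t => c * f t) (c * l).
Proof. intros H. exact (is_RInt_gen_scal (V := R_NormedModule) f c l H). Qed.

Lemma is_RInt_0_oo_plus (f g : R -> R) (l m : R) : is_RInt_0_oo f l -> is_RInt_0_oo g m -> is_RInt_0_oo (fun t => f t + g t) (l + m).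
Proof. intros Hf Hg. exact (is_RInt_gen_plus (V := R_NormedModule) f g l m Hf Hg). Qed.

Lemma is_RInt_0_oo_ext (f g : R -> R) (l : R) : (forall t, 0 < t -> f t = g t) -> is_RInt_0_oo f l -> is_RInt_0_oo g l.
Proof.
intros H. apply is_RInt_gen_ext.
apply (Filter_prod _ _ _ (fun a => 0 < a) (fun b => 0 < b)).
- exists (mkposreal 1 Rlt_0_1). auto.
- exists 0; auto.
- intros a b Ha Hb x Hx. apply H. simpl in Hx.
  apply Rle_lt_trans with (2 := proj1 Hx). left. now apply Rmin_pos.
Qed.

Lemma is_RInt_0_oo_unique (f : R -> R) (l : R) : is_RInt_0_oo f l ->
  RInt_gen f (at_right 0) (Rbar_locally p_infty) = l.
Proof. intros H. exact (is_RInt_gen_unique (V := R_CompleteNormedModule) f l H). Qed.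

Lemma is_RInt_0_oo_antiderivative (G g : R -> R) (L0 L1 : R) :
  (forall t, 0 < t -> is_derive G t (g t)) -> (forall t, 0 < t -> continuous g t) ->
  (forall eps, 0 < eps -> exists d, 0 < d /\ forall t, 0 < t < d -> Rabs (G t - L0) < eps) ->
  (forall eps, 0 < eps -> exists T, forall t, T < t -> Rabs (G t - L1) < eps) ->
  is_RInt_0_oo g (L1 - L0).
Proof.
intros Hd Hc H0 H1.
assert (HI : forall a b, 0 < a < b -> is_RInt g a b (G b - G a)).
{ intros a b Hab. apply (is_RInt_derive (V := R_CompleteNormedModule) G g a b); intros x Hx;
  rewrite Rmin_left in Hx by lra; [apply Hd|apply Hc]; lra. }
apply is_RInt_0_oo_intro.
- intros a b Hab. exists (G b - G a). now apply HI.
- intros eps Heps. destruct (H0 (eps / 2) ltac:(lra)) as [d [Hd0 Hd1]].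
  destruct (H1 (eps / 2) ltac:(lra)) as [T HT].
  exists d, (Rmax T (d + 1)). assert (M1 := Rmax_l T (d + 1)). assert (M2 := Rmax_r T (d + 1)).
  split; [lra|]. intros a b Ha Hb.
  rewrite (is_RInt_unique _ _ _ _ (HI a b ltac:(lra))).
  specialize (Hd1 a Ha). specialize (HT b ltac:(lra)).
  apply Rabs_def2 in Hd1. apply Rabs_def2 in HT. apply Rabs_def1; lra.
Qed.

Lemma RInt_abs_le (f w : R -> R) (a b : R) : a <= b -> ex_RInt f a b -> ex_RInt w a b ->
  (forall t, a <= t <= b -> Rabs (f t) <= w t) -> Rabs (RInt f a b) <= RInt w a b.
Proof.
intros Hab Hf Hw H.
apply (norm_RInt_le (V := R_NormedModule) f w a b _ _ Hab H); now apply (RInt_correct (V := R_CompleteNormedModule)).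
Qed.

Lemma RInt_tail_le (f w : R -> R) (a0 a b b0 : R) : 0 < a0 <= a -> a <= b -> b <= b0 ->
  (forall a b, 0 < a <= b -> ex_RInt f a b) -> (forall a b, 0 < a <= b -> ex_RInt w a b) ->
  (forall t, 0 < t -> Rabs (f t) <= w t) ->
  Rabs (RInt f a0 b0 - RInt f a b) <= RInt w a0 b0 - RInt w a b.
Proof.
intros Ha0 Hab Hb0 Hf Hw H.
assert (Hsplit : forall g, (forall a b, 0 < a <= b -> ex_RInt g a b) ->
  RInt g a0 b0 = RInt g a0 a + RInt g a b + RInt g b b0).
{ intros g Hg. rewrite <- (RInt_Chasles g a0 b b0), <- (RInt_Chasles g a0 a b); auto; apply Hg; lra. }
rewrite (Hsplit f Hf), (Hsplit w Hw).
assert (H1 : forall u v, 0 < u <= v -> Rabs (RInt f u v) <= RInt w u v).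
{ intros u v Huv. apply RInt_abs_le; auto; [lra|]. intros t Ht. apply H. lra. }
assert (Ha := H1 a0 a ltac:(lra)). assert (Hb := H1 b b0 ltac:(lra)).
replace (RInt f a0 a + RInt f a b + RInt f b b0 - RInt f a b) with (RInt f a0 a + RInt f b b0) by ring.
apply Rle_trans with (1 := Rabs_triang _ _). lra.
Qed.

(** The truncation error of [f] is at most that of its majorant. For a family bounded by [M n * w]
    this gives errors proportional to [M n] on a common window. *)
Lemma is_RInt_0_oo_tail (f w : R -> R) (l W a b : R) : is_RInt_0_oo f l -> is_RInt_0_oo w W ->
  (forall t, 0 < t -> Rabs (f t) <= w t) -> 0 < a <= b ->
  Rabs (RInt f a b - l) <= W - RInt w a b.
Proof.
intros Hf Hw H Hab.
destruct (is_RInt_0_oo_elim f l Hf) as [Hf1 Hf2]. destruct (is_RInt_0_oo_elim w W Hw) as [Hw1 Hw2].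
apply Rnot_lt_le. intros Hlt.
set (e := (Rabs (RInt f a b - l) - (W - RInt w a b)) / 2).
assert (He : 0 < e) by (unfold e; lra).
destruct (Hf2 e He) as [d1 [T1 [HdT1 HF]]]. destruct (Hw2 e He) as [d2 [T2 [HdT2 HW]]].
set (a0 := Rmin a (Rmin d1 d2 / 2)). set (b0 := Rmax b (Rmax T1 T2 + 1)).
assert (Hd : 0 < Rmin d1 d2) by (apply Rmin_pos; lra).
assert (M1 := Rmin_l d1 d2). assert (M2 := Rmin_r d1 d2).
assert (M3 := Rmin_l a (Rmin d1 d2 / 2)). assert (M4 := Rmin_r a (Rmin d1 d2 / 2)). fold a0 in M3, M4.
assert (N1 := Rmax_l T1 T2). assert (N2 := Rmax_r T1 T2).
assert (N3 := Rmax_l b (Rmax T1 T2 + 1)). assert (N4 := Rmax_r b (Rmax T1 T2 + 1)). fold b0 in N3, N4.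
assert (Ha0 : 0 < a0) by (apply Rmin_pos; lra).
specialize (HF a0 b0 ltac:(lra) ltac:(lra)). specialize (HW a0 b0 ltac:(lra) ltac:(lra)).
assert (Ht := RInt_tail_le f w a0 a b b0 ltac:(lra) ltac:(lra) ltac:(lra) Hf1 Hw1 H).
assert (Htri : Rabs (RInt f a b - l) <= Rabs (RInt f a0 b0 - l) + Rabs (RInt f a0 b0 - RInt f a b)).
{ replace (RInt f a b - l) with ((RInt f a0 b0 - l) - (RInt f a0 b0 - RInt f a b)) by ring.
  unfold Rminus at 1. apply Rle_trans with (1 := Rabs_triang _ _). rewrite Rabs_Ropp. lra. }
apply Rabs_def2 in HW. unfold e in *. lra.
Qed.

(** Cauchy criterion: two windows are both compared with the smallest window containing them, and
    the excess is controlled by the integral of [w]. *)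
Lemma ex_RInt_0_oo_dominated (f w : R -> R) (W : R) : is_RInt_0_oo w W ->
  (forall a b, 0 < a <= b -> ex_RInt f a b) ->
  (forall t, 0 < t -> Rabs (f t) <= w t) -> exists l, is_RInt_0_oo f l.
Proof.
intros Hw Hf H. destruct (is_RInt_0_oo_elim w W Hw) as [Hw1 Hw2].
destruct (proj1 (filterlim_locally_cauchy (U := R_CompleteNormedModule)
   (F := filter_prod (at_right 0) (Rbar_locally p_infty))
   (fun ab => RInt f (fst ab) (snd ab)))) as [l Hl].
- intros eps. assert (He : 0 < eps / 4) by (generalize (cond_pos eps); lra).
  destruct (Hw2 _ He) as [d [T [HdT HW]]].
  exists (fun ab => 0 < fst ab < d /\ T < snd ab). split.
  + apply (Filter_prod _ _ _ (fun a => 0 < a < d) (fun b => T < b)); auto.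
    * exists (mkposreal d (proj1 HdT)). intros y Hy Hy0. apply Rabs_lt_between' in Hy. simpl in Hy. lra.
    * now exists T.
  + intros [a b] [a' b'] [Ha Hb] [Ha' Hb']. simpl in *.
    set (a0 := Rmin a a'). set (b0 := Rmax b b').
    assert (M1 := Rmin_l a a'). assert (M2 := Rmin_r a a'). fold a0 in M1, M2.
    assert (N1 := Rmax_l b b'). assert (N2 := Rmax_r b b'). fold b0 in N1, N2.
    assert (Ha0 : 0 < a0) by (apply Rmin_pos; lra).
    assert (H1 := RInt_tail_le f w a0 a b b0 ltac:(lra) ltac:(lra) ltac:(lra) Hf Hw1 H).
    assert (H2 := RInt_tail_le f w a0 a' b' b0 ltac:(lra) ltac:(lra) ltac:(lra) Hf Hw1 H).
    assert (W0 := HW a0 b0 ltac:(lra) ltac:(lra)). assert (W1 := HW a b Ha Hb). assert (W2 := HW a' b' Ha' Hb').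
    apply Rabs_def2 in W0. apply Rabs_def2 in W1. apply Rabs_def2 in W2.
    apply Rabs_le_between in H1. apply Rabs_le_between in H2.
    apply Rabs_def1; unfold minus, plus, opp; simpl; lra.
- exists l. apply is_RInt_0_oo_intro.
  + intros a b Hab. apply Hf. lra.
  + intros eps Heps.
    destruct (Hl (ball l (mkposreal eps Heps)) (locally_ball l _)) as [Q1 Q2 [d Hd] [T HT] HQ].
    exists (Rmin d 1), (Rmax T 2).
    assert (M1 := Rmin_l d 1). assert (M2 := Rmin_r d 1).
    assert (N1 := Rmax_l T 2). assert (N2 := Rmax_r T 2).
    assert (0 < Rmin d 1) by (apply Rmin_pos; [apply cond_pos|lra]).
    split; [lra|]. intros a b Ha Hb. apply (HQ a b).
    * apply Hd; [|lra]. apply Rabs_lt_between'. lra.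
    * apply HT. lra.
Qed.

Lemma is_RInt_sum_n (f : nat -> R -> R) (I : nat -> R) (a b : R) (N : nat) :
  (forall n, is_RInt (f n) a b (I n)) ->
  is_RInt (fun t => sum_n (fun n => f n t) N) a b (sum_n I N).
Proof.
intros H. induction N as [|N IH].
- rewrite sum_O. apply (is_RInt_ext (f O)); auto. intros; now rewrite sum_O.
- rewrite sum_Sn. apply (is_RInt_ext (fun t => plus (sum_n (fun n => f n t) N) (f (S N) t))).
  + intros; now rewrite sum_Sn.
  + now apply (is_RInt_plus (V := R_NormedModule)).
Qed.

Lemma RInt_Series (f : nat -> R -> R) (M : nat -> R) (w : R -> R) (a b : R) : a <= b ->
  (forall n, ex_RInt (f n) a b) -> ex_RInt w a b -> ex_series M ->
  (forall n t, a <= t <= b -> Rabs (f n t) <= M n * w t) ->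
  is_RInt (fun t => Series (fun n => f n t)) a b (Series (fun n => RInt (f n) a b)).
Proof.
intros Hab Hf Hw HM H.
(* [filterlim_RInt] asks for uniform convergence on the whole line, whereas the majorant holds on
   [a, b]; clamping the argument extends it without changing the integrals. *)
set (c := fun t => Rmax a (Rmin t b)).
assert (Hc : forall t, a <= c t <= b).
{ intros t. unfold c. split; [apply Rmax_l|]. apply Rmax_lub; [lra|apply Rmin_r]. }
assert (Hci : forall t, Rmin a b < t < Rmax a b -> c t = t).
{ intros t. rewrite Rmin_left, Rmax_right by lra. intros Ht. unfold c.
  rewrite Rmin_left, Rmax_right; lra. }
destruct (ex_RInt_ub w a b Hw) as [B HB]. rewrite Rmin_left, Rmax_right in HB by lra.
assert (HB0 : 0 <= B) by (apply Rle_trans with (2 := HB a ltac:(lra)); apply norm_ge_0).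
assert (Hw0 : forall t, a <= t <= b -> w t <= B).
{ intros t Ht. apply Rle_trans with (2 := HB t Ht). apply Rle_abs. }
assert (Hex : forall t, a <= t <= b -> ex_series (fun n => f n t)).
{ intros t Ht. apply ex_series_dominated with (fun n => w t * M n).
  - intros n. rewrite Rmult_comm. now apply H.
  - now apply ex_series_scal_R. }
destruct (filterlim_RInt (V := R_CompleteNormedModule)
  (fun N t => sum_n (fun n => f n (c t)) N) a b eventually _ (fun t => Series (fun n => f n (c t)))
  (fun N => sum_n (fun n => RInt (f n) a b) N)) as [If [H1 H2]].
- intros N. apply (is_RInt_ext (fun t => sum_n (fun n => f n t) N)).
  + intros t Ht. now rewrite (Hci t Ht).
  + apply is_RInt_sum_n. intros n. now apply (RInt_correct (V := R_CompleteNormedModule)).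
- apply filterlim_locally. intros eps.
  assert (HMl := Series_correct M HM). change (is_lim_seq (sum_n M) (Series M)) in HMl.
  apply is_lim_seq_spec in HMl.
  assert (He : 0 < eps / (B + 1)) by (apply Rdiv_lt_0_compat; [apply cond_pos|lra]).
  destruct (HMl (mkposreal _ He)) as [N0 HN0]. simpl in HN0.
  exists N0. intros N HN t. specialize (HN0 N HN).
  set (u := c t). assert (Hu : a <= u <= b) by apply Hc.
  rewrite (Series_tail_split M N HM) in HN0.
  change (Rabs (sum_n (fun n => f n u) N - Series (fun n => f n u)) < eps).
  rewrite (Series_tail_split (fun n => f n u) N (Hex u Hu)).
  replace (sum_n (fun n => f n u) N - (sum_n (fun n => f n u) N + Series (fun k => f (S N + k)%nat u)))
    with (- Series (fun k => f (S N + k)%nat u)) by ring.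
  rewrite Rabs_Ropp.
  set (r := Series (fun k => M (S N + k)%nat)) in *.
  assert (Hr : Rabs r < eps / (B + 1)).
  { rewrite <- Rabs_Ropp. now replace (- r) with (sum_n M N - (sum_n M N + r)) by ring. }
  apply Rle_lt_trans with (w u * r).
  + unfold r. rewrite <- Series_scal_l. apply Series_abs_le.
    * intros k. rewrite Rmult_comm. now apply H.
    * apply ex_series_scal_R. now apply ex_series_tail.
  + assert (Hwu : Rabs (w u) <= B) by (apply (HB u Hu)).
    apply Rle_lt_trans with (B * Rabs r).
    * apply Rle_trans with (1 := Rle_abs _). rewrite Rabs_mult.
      apply Rmult_le_compat_r; [apply Rabs_pos|auto].
    * apply Rle_lt_trans with (B * (eps / (B + 1))).
      -- apply Rmult_le_compat_l; lra.
      -- replace (pos eps) with ((B + 1) * (eps / (B + 1))) at 2 by (field; lra). nra.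
- apply (is_RInt_ext (fun t => Series (fun n => f n (c t)))).
  + intros t Ht. now rewrite (Hci t Ht).
  + replace (Series (fun n => RInt (f n) a b)) with If; auto.
    symmetry. apply is_series_unique. exact H1.
Qed.

(** The n-th truncation error is at most [M n] times that of [w], so one window serves all n; on a
    window the exchange is the Weierstrass test of [RInt_Series]. *)
Lemma is_RInt_0_oo_Series (f : nat -> R -> R) (I M : nat -> R) (w : R -> R) (W : R) :
  is_RInt_0_oo w W -> ex_series M -> (forall n, is_RInt_0_oo (f n) (I n)) ->
  (forall n t, 0 < t -> Rabs (f n t) <= M n * w t) ->
  ex_series I /\ is_RInt_0_oo (fun t => Series (fun n => f n t)) (Series I).
Proof.
intros Hw HM Hf H. destruct (is_RInt_0_oo_elim w W Hw) as [Hw1 Hw2].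
assert (Hf1 : forall n a b, 0 < a <= b -> ex_RInt (f n) a b).
{ intros n. apply (is_RInt_0_oo_elim _ _ (Hf n)). }
assert (Htail : forall n a b, 0 < a <= b -> Rabs (RInt (f n) a b - I n) <= M n * (W - RInt w a b)).
{ intros n a b Hab.
  apply Rle_trans with (1 := is_RInt_0_oo_tail (f n) (fun t => M n * w t) (I n) (M n * W) a b (Hf n)
    (is_RInt_0_oo_scal (M n) w W Hw) (H n) Hab).
  right. replace (RInt (fun t => M n * w t) a b) with (M n * RInt w a b); [ring|].
  symmetry. apply (RInt_scal (V := R_CompleteNormedModule) w a b (M n)). now apply Hw1. }
assert (HRI : forall a b, 0 < a <= b -> ex_series (fun n => RInt (f n) a b)).
{ intros a b Hab. apply ex_series_dominated with (fun n => RInt w a b * M n).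
  - intros n. rewrite Rmult_comm.
    replace (M n * RInt w a b) with (RInt (fun t => M n * w t) a b).
    + apply RInt_abs_le; auto; [lra| |].
      * apply (ex_RInt_scal (V := R_NormedModule)); auto.
      * intros t Ht. apply H. lra.
    + apply (RInt_scal (V := R_CompleteNormedModule) w a b (M n)); auto.
  - now apply ex_series_scal_R. }
assert (Hdiff : forall a b, 0 < a <= b -> ex_series (fun n => RInt (f n) a b - I n)).
{ intros a b Hab. apply ex_series_dominated with (fun n => (W - RInt w a b) * M n).
  - intros n. rewrite Rmult_comm. now apply Htail.
  - now apply ex_series_scal_R. }
(* Summability of the full integrals is read off from any single window, here [1, 2]: window
   integral minus truncation error, both summable. *)
assert (HexI : ex_series I).
{ apply ex_series_ext with (fun n => RInt (f n) 1 2 - (RInt (f n) 1 2 - I n)).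
  - intros n. Rring.
  - apply (ex_series_minus (V := R_NormedModule)); [apply HRI|apply Hdiff]; lra. }
split; auto.
assert (HS : forall a b, 0 < a <= b ->
  is_RInt (fun t => Series (fun n => f n t)) a b (Series (fun n => RInt (f n) a b))).
{ intros a b Hab. apply RInt_Series with M w; auto; [lra|]. intros n t Ht. apply H. lra. }
apply is_RInt_0_oo_intro.
- intros a b Hab. eexists. apply HS. lra.
- intros eps Heps. set (K := Rabs (Series M) + 1).
  assert (HK : 0 < K) by (unfold K; generalize (Rabs_pos (Series M)); lra).
  destruct (Hw2 (eps / K) ltac:(apply Rdiv_lt_0_compat; lra)) as [d [T [HdT HW]]].
  exists d, T. split; auto. intros a b Ha Hb. specialize (HW a b Ha Hb).
  rewrite (is_RInt_unique _ _ _ _ (HS a b ltac:(lra))).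
  rewrite <- Series_minus by (auto; apply HRI; lra).
  apply Rle_lt_trans with ((W - RInt w a b) * Series M).
  + rewrite <- Series_scal_l. apply Series_abs_le.
    * intros n. rewrite Rmult_comm. apply Htail; lra.
    * now apply ex_series_scal_R.
  + apply Rle_lt_trans with (1 := Rle_abs _). rewrite Rabs_mult, Rabs_minus_sym.
    apply Rle_lt_trans with (Rabs (RInt w a b - W) * K).
    * apply Rmult_le_compat_l; [apply Rabs_pos|unfold K; lra].
    * apply Rmult_lt_reg_r with (/ K); [now apply Rinv_0_lt_compat|].
      rewrite Rmult_assoc, Rinv_r, Rmult_1_r by lra. exact HW.
Qed.

(** * The Gamma integrand as majorant, and substitutions *)

Definition gamma_weight (p t : R) : R := Rpower t (p - 1) * exp (- t).

Lemma continuous_Rpower (p t : R) : 0 < t -> continuous (fun t => Rpower t p) t.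
Proof.
intros Ht. apply (ex_derive_continuous (fun t => Rpower t p)). unfold Rpower. auto_derive. auto.
Qed.

Lemma Rpower_lt_inv (x y p : R) : 0 < p -> 0 < x -> 0 < y -> x < Rpower y (/ p) -> Rpower x p < y.
Proof.
intros Hp Hx Hy H. rewrite <- (Rpower_1 y Hy). rewrite <- (Rinv_l p) by lra.
rewrite <- Rpower_mult. apply Rlt_Rpower_l; auto.
Qed.

(** Comparison with the derivative of -1/(1 + t^p), whose antiderivative runs from -1 to 0 and which
    behaves like t^(p-1) at 0; both ends are handled by one majorant. *)
Lemma ex_RInt_0_oo_gamma_weight (p : R) : 0 < p -> exists W, is_RInt_0_oo (gamma_weight p) W.
Proof.
intros Hp.
set (g := fun t => p * Rpower t (p - 1) / (1 + Rpower t p) ^ 2).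
assert (Hg : is_RInt_0_oo g (0 - -1)).
{ apply (is_RInt_0_oo_antiderivative (fun t => - / (1 + Rpower t p))).
  - intros t Ht. unfold g, Rpower. assert (He := exp_pos (p * ln t)).
    auto_derive; [split; [auto|split; [lra|auto]]|].
    replace ((p - 1) * ln t) with (p * ln t + - ln t) by ring.
    rewrite exp_plus, exp_Ropp, exp_ln by auto. field. split; lra.
  - intros t Ht. apply (ex_derive_continuous g). unfold g, Rpower.
    assert (He := exp_pos (p * ln t)). auto_derive. repeat split; auto.
    simpl. nra.
  - intros eps Heps. exists (Rpower eps (/ p)). split; [apply Rpower_pos|].
    intros t Ht. assert (H := Rpower_lt_inv t eps p Hp (proj1 Ht) Heps (proj2 Ht)).
    assert (Hpos := Rpower_pos t p).
    replace (- / (1 + Rpower t p) - -1) with (Rpower t p / (1 + Rpower t p)) by (field; lra).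
    rewrite Rabs_pos_eq by (apply Rdiv_le_0_compat; lra).
    apply Rmult_lt_reg_r with (1 + Rpower t p); [lra|].
    unfold Rdiv. rewrite Rmult_assoc, Rinv_l, Rmult_1_r by lra. nra.
  - intros eps Heps. exists (Rmax 0 (Rpower (/ eps) (/ p))). intros t Ht.
    assert (M1 := Rmax_l 0 (Rpower (/ eps) (/ p))). assert (M2 := Rmax_r 0 (Rpower (/ eps) (/ p))).
    assert (H : / eps < Rpower t p).
    { assert (Hie : 0 < / eps) by now apply Rinv_0_lt_compat.
      rewrite <- (Rpower_1 (/ eps) Hie), <- (Rinv_l p), <- Rpower_mult by lra.
      apply Rlt_Rpower_l; [lra|]. split; [apply Rpower_pos|lra]. }
    assert (Hpos := Rpower_pos t p).
    rewrite Rminus_0_r, Rabs_Ropp, Rabs_pos_eq by (left; apply Rinv_0_lt_compat; lra).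
    rewrite <- (Rinv_inv eps). apply Rinv_lt_contravar; [|lra].
    apply Rmult_lt_0_compat; [now apply Rinv_0_lt_compat|lra]. }
(* From (1 + t^p)^2 <= 2 (1 + t^(2p)) <= 2 (1 + (2p)^(2p)) e^t; the division by p cancels the factor
   p in [g]. *)
set (K := 2 * (1 + Rpower (2 * p) (2 * p)) / p).
apply (ex_RInt_0_oo_dominated (gamma_weight p) (fun t => K * g t) (K * (0 - -1))).
- now apply is_RInt_0_oo_scal.
- intros a b Hab. apply (ex_RInt_continuous (V := R_CompleteNormedModule)). intros t Ht.
  rewrite Rmin_left in Ht by lra. unfold gamma_weight.
  apply (continuous_mult (K := R_AbsRing)); [apply continuous_Rpower; lra|].
  apply (ex_derive_continuous (fun t => exp (- t))). auto_derive; auto.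
- intros t Ht. unfold gamma_weight, g, K. assert (Hpos := Rpower_pos t p). assert (H1 := Rpower_pos t (p - 1)).
  assert (He := exp_pos (- t)).
  rewrite Rabs_pos_eq by nra.
  replace (2 * (1 + Rpower (2 * p) (2 * p)) / p * (p * Rpower t (p - 1) / (1 + Rpower t p) ^ 2))
    with (Rpower t (p - 1) * (2 * (1 + Rpower (2 * p) (2 * p)) / (1 + Rpower t p) ^ 2)) by (field; lra).
  apply Rmult_le_compat_l; [lra|].
  apply Rmult_le_reg_r with ((1 + Rpower t p) ^ 2); [nra|].
  unfold Rdiv. rewrite Rmult_assoc, Rinv_l, Rmult_1_r by nra.
  assert (B := Rpower_le_exp (2 * p) t ltac:(lra) Ht).
  assert (E : Rpower t (2 * p) = Rpower t p ^ 2).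
  { replace (2 * p) with (p + p) by ring. rewrite Rpower_plus. ring. }
  assert (Het : exp (- t) * exp t = 1) by (rewrite <- exp_plus, Rplus_opp_l; apply exp_0).
  assert (He1 : 1 <= exp t) by (rewrite <- exp_0; apply exp_le; lra).
  assert (Hq : (1 + Rpower t p) ^ 2 <= 2 * (1 + Rpower (2 * p) (2 * p)) * exp t).
  { rewrite E in B. assert (0 <= (1 - Rpower t p) ^ 2) by apply pow2_ge_0. nra. }
  apply Rle_trans with (exp (- t) * (2 * (1 + Rpower (2 * p) (2 * p)) * exp t)).
  + apply Rmult_le_compat_l; lra.
  + replace (exp (- t) * (2 * (1 + Rpower (2 * p) (2 * p)) * exp t))
      with (2 * (1 + Rpower (2 * p) (2 * p)) * (exp (- t) * exp t)) by ring.
    rewrite Het. lra.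
Qed.

Lemma is_RInt_0_oo_comp_scal (f : R -> R) (l c : R) : 0 < c -> is_RInt_0_oo f l -> is_RInt_0_oo (fun t => c * f (c * t)) l.
Proof.
intros Hc Hf. destruct (is_RInt_0_oo_elim f l Hf) as [H1 H2].
assert (HI : forall a b, 0 < a <= b -> is_RInt (fun t => c * f (c * t)) a b (RInt f (c * a) (c * b))).
{ intros a b Hab.
  apply (is_RInt_ext (fun t => scal c (f (c * t + 0)))).
  - intros t _. now rewrite Rplus_0_r.
  - apply (is_RInt_comp_lin (V := R_NormedModule) f c 0 a b). rewrite !Rplus_0_r.
    apply (RInt_correct (V := R_CompleteNormedModule)). apply H1. split; nra. }
apply is_RInt_0_oo_intro.
- intros a b Hab. eexists. apply HI. lra.
- intros eps Heps. destruct (H2 eps Heps) as [d [T [HdT H]]].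
  exists (d / c), (T / c). assert (Hic : 0 < / c) by now apply Rinv_0_lt_compat.
  assert (Ed : c * (d / c) = d) by (field; lra). assert (ET : c * (T / c) = T) by (field; lra).
  split; [split; [apply Rdiv_lt_0_compat; lra|unfold Rdiv; nra]|].
  intros a b Ha Hb. assert (0 < T / c) by (apply Rdiv_lt_0_compat; lra).
  assert (Hab : d / c < T / c) by (unfold Rdiv; nra).
  rewrite (is_RInt_unique _ _ _ _ (HI a b ltac:(lra))).
  apply H; nra.
Qed.

(* Substituting [tau = c e^t] maps the real line to (0, oo); folding t -> -t gives (0, oo). *)
Lemma is_RInt_0_oo_comp_exp (g : R -> R) (l c : R) : 0 < c -> (forall t, 0 < t -> continuous g t) -> is_RInt_0_oo g l ->
  is_RInt_0_oo (fun t => c * exp t * g (c * exp t) + c * exp (- t) * g (c * exp (- t))) l.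
Proof.
intros Hc Hg HI. destruct (is_RInt_0_oo_elim g l HI) as [H1 H2].
assert (Hce : forall t, 0 < c * exp t) by (intros t; apply Rmult_lt_0_compat; [lra|apply exp_pos]).
assert (Hmono : forall s t, s <= t -> c * exp s <= c * exp t).
{ intros s t Hst. apply Rmult_le_compat_l; [lra|]. now apply exp_le. }
(* The folded integrand has primitive [Phi], which tends to 0 at 0, where the window shrinks to the
   point c, and to [l] at infinity. *)
set (Phi := fun t => RInt g (c * exp (- t)) (c * exp t)).
assert (HR : forall a b, 0 < a <= b ->
  is_RInt (fun t => c * exp t * g (c * exp t) + c * exp (- t) * g (c * exp (- t))) a b (Phi b - Phi a)).
{ intros a b Hab.
  assert (I1 : is_RInt (fun t => scal (c * exp t) (g (c * exp t))) a b (RInt g (c * exp a) (c * exp b))).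
  { apply (is_RInt_comp (V := R_CompleteNormedModule) g (fun t => c * exp t) (fun t => c * exp t)).
    - intros t _. apply Hg, Hce.
    - intros t _. split; [auto_derive; auto; ring|].
      apply (ex_derive_continuous (fun t => c * exp t)). auto_derive; auto. }
  assert (I2 : is_RInt (fun t => scal (- (c * exp (- t))) (g (c * exp (- t)))) a b
     (RInt g (c * exp (- a)) (c * exp (- b)))).
  { apply (is_RInt_comp (V := R_CompleteNormedModule) g (fun t => c * exp (- t)) (fun t => - (c * exp (- t)))).
    - intros t _. apply Hg, Hce.
    - intros t _. split; [auto_derive; auto; ring|].
      apply (ex_derive_continuous (fun t => - (c * exp (- t)))). auto_derive; auto. }
  assert (I3 := is_RInt_minus (V := R_NormedModule) _ _ _ _ _ _ I1 I2).
  assert (ex : forall u v, exists l, is_RInt g (c * exp u) (c * exp v) l).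
  { intros u v. destruct (Rle_dec u v).
    - apply (H1 (c * exp u) (c * exp v)). split; auto.
    - apply (ex_RInt_swap (V := R_NormedModule)). apply H1. split; auto. apply Hmono. lra. }
  replace (Phi b - Phi a) with (minus (RInt g (c * exp a) (c * exp b)) (RInt g (c * exp (- a)) (c * exp (- b)))).
  - apply (is_RInt_ext _ _ _ _ _) with (2 := I3). intros t _.
    unfold minus, plus, opp, scal; simpl; unfold mult; simpl. ring.
  - unfold Phi.
    rewrite <- (RInt_Chasles g (c * exp (- b)) (c * exp (- a)) (c * exp b)) by apply ex.
    rewrite <- (RInt_Chasles g (c * exp (- a)) (c * exp a) (c * exp b)) by apply ex.
    rewrite <- (opp_RInt_swap g (c * exp (- b)) (c * exp (- a))) by apply ex.
    unfold minus, plus, opp; simpl. ring. }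
apply is_RInt_0_oo_intro.
- intros a b Hab. eexists. apply HR. lra.
- intros eps Heps. destruct (H2 (eps / 2) ltac:(lra)) as [d [T [HdT H]]].
  destruct (ex_RInt_ub g (c * exp (- (1))) (c * exp 1)) as [B HB].
  { apply H1. split; auto. apply Hmono. lra. }
  rewrite Rmin_left, Rmax_right in HB by (apply Hmono; lra).
  assert (HB0 : 0 <= B).
  { apply Rle_trans with (2 := HB (c * exp 1) (conj (Hmono (-(1)) 1 ltac:(lra)) (Rle_refl _))). apply norm_ge_0. }
  assert (HC1 : 0 < cosh 1) by (rewrite cosh_sinh_half; nra).
  (* For a <= 1 the window has length 2c sinh a <= 2c a cosh 1, so [Phi a] is at most a K; the added
     1 makes K positive even if B = 0. *)
  set (K := B * (2 * c * cosh 1) + 1). assert (HK : 0 < K) by (unfold K; assert (0 <= B * (2 * c * cosh 1)) by (apply Rmult_le_pos; nra); lra).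
  assert (Hd1 : 0 < Rmin 1 (eps / 2 / K)) by (apply Rmin_pos; [lra|apply Rdiv_lt_0_compat; lra]).
  assert (HPhi0 : forall a, 0 < a < Rmin 1 (eps / 2 / K) -> Rabs (Phi a) < eps / 2).
  { intros a Ha. assert (M1 := Rmin_l 1 (eps / 2 / K)). assert (M2 := Rmin_r 1 (eps / 2 / K)).
    assert (Hle : c * exp (- a) <= c * exp a) by (apply Hmono; lra).
    apply Rle_lt_trans with (RInt (fun _ => B) (c * exp (- a)) (c * exp a)).
    - apply RInt_abs_le; auto.
      + apply (ex_RInt_const (V := R_NormedModule)).
      + intros t Ht. apply HB. split; [apply Rle_trans with (2 := proj1 Ht)|apply Rle_trans with (1 := proj2 Ht)]; apply Hmono; lra.
    - rewrite (RInt_const (V := R_CompleteNormedModule)). unfold scal; simpl; unfold mult; simpl.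
      assert (Hs := sinh_scale_le a 1 ltac:(lra) ltac:(lra)). rewrite Rmult_1_r, Rmult_1_l in Hs.
      assert (Es : c * exp a - c * exp (- a) = 2 * c * sinh a) by (unfold sinh; field).
      rewrite Es.
      apply Rle_lt_trans with (a * K).
      + unfold K. assert (2 * c * sinh a * B <= 2 * c * (a * cosh 1) * B).
        { apply Rmult_le_compat_r; auto. apply Rmult_le_compat_l; lra. }
        nra.
      + apply Rmult_lt_reg_r with (/ K); [now apply Rinv_0_lt_compat|].
        rewrite Rmult_assoc, Rinv_r, Rmult_1_r by lra. unfold Rdiv in M2 at 1. lra. }
  set (T' := Rmax 2 (Rmax (ln (T / c)) (- ln (d / c)))).
  assert (N1 := Rmax_l 2 (Rmax (ln (T / c)) (- ln (d / c)))).
  assert (N2 := Rmax_r 2 (Rmax (ln (T / c)) (- ln (d / c)))). fold T' in N1, N2.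
  assert (N3 := Rmax_l (ln (T / c)) (- ln (d / c))). assert (N4 := Rmax_r (ln (T / c)) (- ln (d / c))).
  exists (Rmin 1 (eps / 2 / K)), T'. assert (M1 := Rmin_l 1 (eps / 2 / K)).
  split; [lra|]. intros a b Ha Hb.
  rewrite (is_RInt_unique _ _ _ _ (HR a b ltac:(lra))).
  assert (HPhi1 : Rabs (Phi b - l) < eps / 2).
  { apply H.
    - split; auto. apply Rlt_le_trans with (c * exp (ln (d / c))).
      + apply Rmult_lt_compat_l; auto. apply exp_increasing. lra.
      + rewrite exp_ln by (apply Rdiv_lt_0_compat; lra). right. field. lra.
    - apply Rle_lt_trans with (c * exp (ln (T / c))).
      + rewrite exp_ln by (apply Rdiv_lt_0_compat; lra). right. field. lra.
      + apply Rmult_lt_compat_l; auto. apply exp_increasing. lra. }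
  assert (HPhia := HPhi0 a Ha).
  apply Rabs_def2 in HPhi1. apply Rabs_def2 in HPhia. apply Rabs_def1; lra.
Qed.

(** * Gamma and Bessel integrals *)

Lemma cexp_plus (z w : C) : cexp (z + w)%C = (cexp z * cexp w)%C.
Proof.
destruct z as [a b], w as [c d]. unfold cexp, Cmult, Cplus; simpl.
rewrite exp_plus, cos_plus, sin_plus. f_equal; ring.
Qed.

Lemma cpowR_polar (r : R) (s : C) :
  cpowR r s = (Rpower r (Re s) * cos (Im s * ln r), Rpower r (Re s) * sin (Im s * ln r)).
Proof.
unfold cpowR, cexp, Rpower. destruct s as [a b]; simpl.
replace (a * ln r - b * 0) with (a * ln r) by ring.
now replace (a * 0 + b * ln r) with (b * ln r) by ring.
Qed.

Lemma Cmod_cpowR (r : R) (s : C) : Cmod (cpowR r s) = Rpower r (Re s).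
Proof.
rewrite cpowR_polar. unfold Cmod; simpl fst; simpl snd.
set (p := Rpower r (Re s)). set (t := Im s * ln r).
replace ((p * cos t) ^ 2 + (p * sin t) ^ 2) with (p ^ 2).
- apply sqrt_pow2. left; apply Rpower_pos.
- assert (H := sin2_cos2 t). unfold Rsqr in H.
  replace ((p * cos t) ^ 2 + (p * sin t) ^ 2) with (p ^ 2 * (sin t * sin t + cos t * cos t)) by ring.
  rewrite H. ring.
Qed.

Lemma cpowR_plus (r : R) (s t : C) : cpowR r (s + t)%C = (cpowR r s * cpowR r t)%C.
Proof. unfold cpowR. rewrite <- cexp_plus. f_equal. ring. Qed.

Lemma cpowR_mult (r q : R) (s : C) : 0 < r -> 0 < q -> cpowR (r * q) s = (cpowR r s * cpowR q s)%C.
Proof.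
intros Hr Hq. unfold cpowR. rewrite <- cexp_plus, ln_mult by auto. f_equal.
rewrite RtoC_plus. ring.
Qed.

Lemma cpowR_INR (r : R) (n : nat) : 0 < r -> cpowR r (RtoC (INR n)) = RtoC (r ^ n).
Proof.
intros Hr. rewrite cpowR_polar. simpl. rewrite Rmult_0_l, cos_0, sin_0, Rpower_pow by auto.
unfold RtoC. f_equal; ring.
Qed.

Lemma cpowR_0 (r : R) : 0 < r -> cpowR r (RtoC 0) = RtoC 1.
Proof. intros Hr. now apply (cpowR_INR r 0). Qed.

Lemma cpowR_opp_l (r : R) (s : C) : 0 < r -> (cpowR r (- s) * cpowR r s)%C = RtoC 1.
Proof.
intros Hr. rewrite <- cpowR_plus, <- (cpowR_0 r) by auto. f_equal. ring.
Qed.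

(** [CInt0inf] and [CSeries] are total and have a value even without convergence. This predicate and
    the next record convergence as well as the value, and arguments are carried out with them. *)
Definition is_CInt_0_oo (f : R -> C) (l : C) : Prop :=
  is_RInt_0_oo (fun t => Re (f t)) (Re l) /\ is_RInt_0_oo (fun t => Im (f t)) (Im l).
Definition is_Cseries (a : nat -> C) (l : C) : Prop :=
  is_series (fun n => Re (a n)) (Re l) /\ is_series (fun n => Im (a n)) (Im l).

Lemma is_CInt_0_oo_CInt0inf (f : R -> C) (l : C) : is_CInt_0_oo f l -> CInt0inf f = l.
Proof.
intros [H1 H2]. unfold CInt0inf. rewrite (is_RInt_0_oo_unique _ _ H1), (is_RInt_0_oo_unique _ _ H2). now destruct l.
Qed.

Lemma is_CInt_0_oo_unique (f : R -> C) (l m : C) : is_CInt_0_oo f l -> is_CInt_0_oo f m -> l = m.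
Proof. intros H1 H2. now rewrite <- (is_CInt_0_oo_CInt0inf _ _ H1), (is_CInt_0_oo_CInt0inf _ _ H2). Qed.

Lemma is_CInt_0_oo_ext (f g : R -> C) (l : C) : (forall t, 0 < t -> f t = g t) -> is_CInt_0_oo f l -> is_CInt_0_oo g l.
Proof.
intros H [H1 H2]. split.
- apply is_RInt_0_oo_ext with (2 := H1). intros t Ht. now rewrite H.
- apply is_RInt_0_oo_ext with (2 := H2). intros t Ht. now rewrite H.
Qed.

Lemma is_CInt_0_oo_plus (f g : R -> C) (l m : C) : is_CInt_0_oo f l -> is_CInt_0_oo g m -> is_CInt_0_oo (fun t => f t + g t)%C (l + m)%C.
Proof. intros [H1 H2] [H3 H4]. split; [apply (is_RInt_0_oo_plus _ _ _ _ H1 H3)|apply (is_RInt_0_oo_plus _ _ _ _ H2 H4)]. Qed.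

Lemma is_CInt_0_oo_scal (c : C) (f : R -> C) (l : C) : is_CInt_0_oo f l -> is_CInt_0_oo (fun t => c * f t)%C (c * l)%C.
Proof.
intros [H1 H2]. split.
- rewrite Re_Cmult.
  apply is_RInt_0_oo_ext with (fun t => Re c * Re (f t) + (- Im c) * Im (f t)).
  + intros t _. rewrite Re_Cmult. ring.
  + replace (Re c * Re l - Im c * Im l) with (Re c * Re l + - Im c * Im l) by ring.
    apply is_RInt_0_oo_plus; now apply is_RInt_0_oo_scal.
- rewrite Im_Cmult.
  apply is_RInt_0_oo_ext with (fun t => Re c * Im (f t) + Im c * Re (f t)).
  + intros t _. rewrite Im_Cmult. ring.
  + apply is_RInt_0_oo_plus; now apply is_RInt_0_oo_scal.
Qed.

Lemma is_Cseries_CSeries (a : nat -> C) (l : C) : is_Cseries a l -> CSeries a = l.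
Proof.
intros [H1 H2]. unfold CSeries. rewrite (is_series_unique _ _ H1), (is_series_unique _ _ H2).
now destruct l.
Qed.

Lemma is_Cseries_ext (a b : nat -> C) (l : C) : (forall n, a n = b n) -> is_Cseries a l -> is_Cseries b l.
Proof.
intros H [H1 H2]. split.
- apply is_series_ext with (2 := H1). intros n. now rewrite H.
- apply is_series_ext with (2 := H2). intros n. now rewrite H.
Qed.

Lemma is_Cseries_scal (c : C) (a : nat -> C) (l : C) : is_Cseries a l -> is_Cseries (fun n => c * a n)%C (c * l)%C.
Proof.
intros [H1 H2]. split.
- rewrite Re_Cmult.
  apply (is_series_minus (V := R_NormedModule) (fun n => Re c * Re (a n)) (fun n => Im c * Im (a n)));
  now apply (is_series_scal (V := R_NormedModule)).
- rewrite Im_Cmult.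
  apply (is_series_plus (V := R_NormedModule) (fun n => Re c * Im (a n)) (fun n => Im c * Re (a n)));
  now apply (is_series_scal (V := R_NormedModule)).
Qed.

Lemma Re_Cmult_R (z : C) (r : R) : Re (z * RtoC r)%C = Re z * r.
Proof. destruct z; simpl; ring. Qed.
Lemma Im_Cmult_R (z : C) (r : R) : Im (z * RtoC r)%C = Im z * r.
Proof. destruct z; simpl; ring. Qed.

Lemma im_le_Cmod (z : C) : Rabs (Im z) <= Cmod z.
Proof. apply Rle_trans with (2 := Rmax_Cmod z). apply Rmax_r. Qed.

Lemma is_CInt_0_oo_Series (E : R -> C) (r : nat -> R -> R) (I : nat -> C) (M : nat -> R) (w : R -> R) (W : R) :
  is_RInt_0_oo w W -> ex_series M -> (forall n, is_CInt_0_oo (fun t => E t * RtoC (r n t))%C (I n)) ->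
  (forall n t, 0 < t -> Cmod (E t) * Rabs (r n t) <= M n * w t) ->
  is_Cseries I (CSeries I) /\ is_CInt_0_oo (fun t => E t * RtoC (Series (fun n => r n t)))%C (CSeries I).
Proof.
intros Hw HM Hf H.
destruct (is_RInt_0_oo_Series (fun n t => Re (E t * RtoC (r n t))%C) (fun n => Re (I n)) M w W) as [S1 S2]; auto.
- intros n. exact (proj1 (Hf n)).
- intros n t Ht. apply Rle_trans with (2 := H n t Ht).
  rewrite Re_Cmult_R, Rabs_mult. apply Rmult_le_compat_r; [apply Rabs_pos|apply re_le_Cmod].
- destruct (is_RInt_0_oo_Series (fun n t => Im (E t * RtoC (r n t))%C) (fun n => Im (I n)) M w W) as [T1 T2]; auto.
  + intros n. exact (proj2 (Hf n)).
  + intros n t Ht. apply Rle_trans with (2 := H n t Ht).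
    rewrite Im_Cmult_R, Rabs_mult. apply Rmult_le_compat_r; [apply Rabs_pos|].
    apply im_le_Cmod.
  + split; [split; now apply Series_correct|]. split.
    * apply is_RInt_0_oo_ext with (2 := S2). intros t _. rewrite Re_Cmult_R, <- Series_scal_l.
      apply Series_ext. intros n. apply Re_Cmult_R.
    * apply is_RInt_0_oo_ext with (2 := T2). intros t _. rewrite Im_Cmult_R, <- Series_scal_l.
      apply Series_ext. intros n. apply Im_Cmult_R.
Qed.

Lemma continuous_cpowR_mult (s : C) (rho : R -> R) (t : R) : 0 < t -> continuous rho t ->
  continuous (fun t => Re (cpowR t s * RtoC (rho t))%C) t /\
  continuous (fun t => Im (cpowR t s * RtoC (rho t))%C) t.
Proof.
intros Ht Hrho. split.
- apply (continuous_ext (fun t => (Rpower t (Re s) * cos (Im s * ln t)) * rho t)).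
  + intros u. now rewrite Re_Cmult_R, cpowR_polar.
  + apply (continuous_mult (K := R_AbsRing) (fun t => Rpower t (Re s) * cos (Im s * ln t)) rho); auto.
    apply (ex_derive_continuous (fun t => Rpower t (Re s) * cos (Im s * ln t))).
    unfold Rpower. auto_derive. repeat split; auto.
- apply (continuous_ext (fun t => (Rpower t (Re s) * sin (Im s * ln t)) * rho t)).
  + intros u. now rewrite Im_Cmult_R, cpowR_polar.
  + apply (continuous_mult (K := R_AbsRing) (fun t => Rpower t (Re s) * sin (Im s * ln t)) rho); auto.
    apply (ex_derive_continuous (fun t => Rpower t (Re s) * sin (Im s * ln t))).
    unfold Rpower. auto_derive. repeat split; auto.
Qed.

(** With [CInt0inf] of the integrand itself as the value, the conclusion is convergence; domination
    by a Gamma integrand settles both ends. *)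
Lemma is_CInt_0_oo_cpowR (s : C) (rho : R -> R) (p : R) : 0 < p ->
  (forall t, 0 < t -> continuous rho t) ->
  (forall t, 0 < t -> Rpower t (Re s) * Rabs (rho t) <= gamma_weight p t) ->
  is_CInt_0_oo (fun t => cpowR t s * RtoC (rho t))%C (CInt0inf (fun t => cpowR t s * RtoC (rho t))%C).
Proof.
intros Hp Hc Hb. destruct (ex_RInt_0_oo_gamma_weight p Hp) as [W HW].
assert (Hex : forall f : R -> R, (forall t, 0 < t -> continuous f t) ->
  (forall t, 0 < t -> Rabs (f t) <= gamma_weight p t) -> exists l, is_RInt_0_oo f l).
{ intros f Hfc Hfb. apply (ex_RInt_0_oo_dominated f (gamma_weight p) W); auto.
  intros a b Hab. apply (ex_RInt_continuous (V := R_CompleteNormedModule)). intros t Ht.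
  rewrite Rmin_left in Ht by lra. apply Hfc; lra. }
destruct (Hex (fun t => Re (cpowR t s * RtoC (rho t))%C)) as [l1 H1].
- intros t Ht. exact (proj1 (continuous_cpowR_mult s rho t Ht (Hc t Ht))).
- intros t Ht. apply Rle_trans with (2 := Hb t Ht).
  rewrite <- (Cmod_cpowR t s), <- (Cmod_R (rho t)), <- Cmod_mult. apply re_le_Cmod.
- destruct (Hex (fun t => Im (cpowR t s * RtoC (rho t))%C)) as [l2 H2].
  + intros t Ht. exact (proj2 (continuous_cpowR_mult s rho t Ht (Hc t Ht))).
  + intros t Ht. apply Rle_trans with (2 := Hb t Ht).
    rewrite <- (Cmod_cpowR t s), <- (Cmod_R (rho t)), <- Cmod_mult. apply im_le_Cmod.
  + assert (HC : is_CInt_0_oo (fun t => cpowR t s * RtoC (rho t))%C (l1, l2)) by (split; assumption).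
    now rewrite (is_CInt_0_oo_CInt0inf _ _ HC).
Qed.

Lemma continuous_exp_neg (t : R) : continuous (fun t => exp (- t)) t.
Proof. apply (ex_derive_continuous (fun t => exp (- t))). auto_derive; auto. Qed.

Lemma Re_minus_1 (q : C) : Re (q - RtoC 1)%C = Re q - 1.
Proof. reflexivity. Qed.

Lemma is_CInt_0_oo_CGamma (q : C) : 0 < Re q ->
  is_CInt_0_oo (fun t => cpowR t (q - RtoC 1) * RtoC (exp (- t)))%C (CGamma q).
Proof.
intros Hq. apply (is_CInt_0_oo_cpowR (q - RtoC 1)%C (fun t => exp (- t)) (Re q)); auto.
- intros t _. apply continuous_exp_neg.
- intros t Ht. rewrite Rabs_pos_eq by (left; apply exp_pos). rewrite Re_minus_1. apply Rle_refl.
Qed.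

Lemma is_CInt_0_oo_CGamma_scaled (q : C) (c : R) : 0 < Re q -> 0 < c ->
  is_CInt_0_oo (fun t => cpowR t (q - RtoC 1) * RtoC (exp (- (c * t))))%C (cpowR c (- q) * CGamma q)%C.
Proof.
intros Hq Hc. destruct (is_CInt_0_oo_CGamma q Hq) as [H1 H2].
assert (H : is_CInt_0_oo (fun t => RtoC c * (cpowR (c * t) (q - RtoC 1) * RtoC (exp (- (c * t)))))%C (CGamma q)).
{ split.
  - apply is_RInt_0_oo_ext with (2 := is_RInt_0_oo_comp_scal _ _ c Hc H1). intros t _.
    generalize (cpowR (c * t) (q - RtoC 1) * RtoC (exp (- (c * t))))%C. intros [z1 z2]. simpl. ring.
  - apply is_RInt_0_oo_ext with (2 := is_RInt_0_oo_comp_scal _ _ c Hc H2). intros t _.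
    generalize (cpowR (c * t) (q - RtoC 1) * RtoC (exp (- (c * t))))%C. intros [z1 z2]. simpl. ring. }
apply is_CInt_0_oo_ext with (2 := is_CInt_0_oo_scal (cpowR c (- q)) _ _ H).
intros t Ht. rewrite cpowR_mult by auto.
assert (E : (cpowR c (- q) * RtoC c * cpowR c (q - RtoC 1))%C = RtoC 1).
{ transitivity (cpowR c (- q) * cpowR c q)%C; [|now apply cpowR_opp_l]. replace (RtoC c) with (cpowR c (RtoC (INR 1))).
  - rewrite <- !cpowR_plus. f_equal. simpl INR. ring.
  - rewrite cpowR_INR by auto. now rewrite pow_1. }
transitivity ((cpowR c (- q) * RtoC c * cpowR c (q - RtoC 1)) * (cpowR t (q - RtoC 1) * RtoC (exp (- (c * t)))))%C.
- ring.
- rewrite E. ring.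
Qed.

Definition bessel_integrand (nu : C) (b t : R) : C := (cpowR t (nu - RtoC 1) * RtoC (exp (- t) * exp (- (b / t))))%C.

Lemma continuous_exp_bessel_integrand (b t : R) : 0 < t -> continuous (fun t => exp (- t) * exp (- (b / t))) t.
Proof.
intros Ht. apply (ex_derive_continuous (fun t => exp (- t) * exp (- (b / t)))). auto_derive. lra.
Qed.

Lemma is_CInt_0_oo_bessel_integrand (nu : C) (b : R) : 0 < Re nu -> 0 < b -> is_CInt_0_oo (bessel_integrand nu b) (CInt0inf (bessel_integrand nu b)).
Proof.
intros Hnu Hb. apply (is_CInt_0_oo_cpowR (nu - RtoC 1)%C (fun t => exp (- t) * exp (- (b / t))) (Re nu)); auto.
- intros t Ht. now apply continuous_exp_bessel_integrand.
- intros t Ht. rewrite Re_minus_1. unfold gamma_weight.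
  apply Rmult_le_compat_l; [left; apply Rpower_pos|].
  assert (H1 := exp_pos (- t)). assert (H2 := exp_pos (- (b / t))).
  assert (H3 : exp (- (b / t)) <= 1).
  { rewrite <- exp_0. apply exp_le. assert (0 < b / t) by now apply Rdiv_lt_0_compat. lra. }
  rewrite Rabs_pos_eq by nra. nra.
Qed.

(** The substitution tau = c e^t turns tau + c^2/tau into 2c cosh t and tau^nu into c^nu e^(nu t);
    folding t with -t turns e^(nu t) into 2 cosh(nu t). *)
Lemma BesselK_bessel_integrand (nu : C) (c : R) : 0 < Re nu -> 0 < c ->
  BesselK nu (2 * c) = (RtoC (/ 2) * cpowR c (- nu) * CInt0inf (bessel_integrand nu (c ^ 2)))%C.
Proof.
intros Hnu Hc. assert (Hc2 : 0 < c ^ 2) by nra.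
destruct (is_CInt_0_oo_bessel_integrand nu (c ^ 2) Hnu Hc2) as [H1 H2].
assert (Hcont : forall t, 0 < t -> continuous (fun t => Re (bessel_integrand nu (c ^ 2) t)) t /\
   continuous (fun t => Im (bessel_integrand nu (c ^ 2) t)) t).
{ intros t Ht. apply continuous_cpowR_mult; auto. now apply continuous_exp_bessel_integrand. }
assert (H : is_CInt_0_oo (fun t => RtoC (c * exp t) * bessel_integrand nu (c ^ 2) (c * exp t)
   + RtoC (c * exp (- t)) * bessel_integrand nu (c ^ 2) (c * exp (- t)))%C (CInt0inf (bessel_integrand nu (c ^ 2)))).
{ split.
  - apply is_RInt_0_oo_ext with (2 := is_RInt_0_oo_comp_exp _ _ c Hc (fun t Ht => proj1 (Hcont t Ht)) H1).
    intros t _. generalize (bessel_integrand nu (c ^ 2) (c * exp t)) (bessel_integrand nu (c ^ 2) (c * exp (- t))).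
    intros [z1 z2] [w1 w2]. simpl. ring.
  - apply is_RInt_0_oo_ext with (2 := is_RInt_0_oo_comp_exp _ _ c Hc (fun t Ht => proj2 (Hcont t Ht)) H2).
    intros t _. generalize (bessel_integrand nu (c ^ 2) (c * exp t)) (bessel_integrand nu (c ^ 2) (c * exp (- t))).
    intros [z1 z2] [w1 w2]. simpl. ring. }
unfold BesselK. apply is_CInt_0_oo_CInt0inf.
apply is_CInt_0_oo_ext with (2 := is_CInt_0_oo_scal (RtoC (/ 2) * cpowR c (- nu)) _ _ H).
intros t Ht.
assert (Hone : forall u, (RtoC (c * exp u) * bessel_integrand nu (c ^ 2) (c * exp u))%C =
  (cpowR c nu * (cexp (nu * RtoC u) * RtoC (exp (- (2 * c) * cosh u))))%C).
{ intros u. assert (Hu := exp_pos u). unfold bessel_integrand.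
  rewrite <- (pow_1 (c * exp u)) at 1. rewrite <- (cpowR_INR (c * exp u) 1) by nra.
  rewrite Cmult_assoc, <- cpowR_plus.
  replace (RtoC (INR 1) + (nu - RtoC 1))%C with nu by (simpl INR; ring).
  rewrite cpowR_mult by auto. unfold cpowR at 2. rewrite ln_exp.
  rewrite <- Cmult_assoc. do 3 f_equal. rewrite <- exp_plus. f_equal.
  unfold cosh. rewrite exp_Ropp. field. lra. }
rewrite (Hone t), (Hone (- t)).
assert (Ecosh : cosh (- t) = cosh t) by (unfold cosh; rewrite Ropp_involutive; lra).
rewrite Ecosh. unfold ccosh.
replace (- (nu * RtoC t))%C with (nu * RtoC (- t))%C by (rewrite RtoC_opp; ring).
set (A := cexp (nu * RtoC t)). set (B := cexp (nu * RtoC (- t))). set (X := RtoC (exp (- (2 * c) * cosh t))).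
transitivity ((cpowR c (- nu) * cpowR c nu) * RtoC (/ 2) * (X * (A + B)))%C; [ring|].
rewrite cpowR_opp_l by auto. rewrite RtoC_inv by lra. field.
Qed.

(** * Divisor sums as double series *)

Lemma divsum_cos_Series (k : nat) (th : R) (n : nat) :
  divsum_cos k th (S n) =
  Series (fun i => if Nat.eqb (S n mod S i) 0 then INR (S i) ^ k * cos (2 * PI * INR (S i) * th) else 0).
Proof.
unfold divsum_cos. rewrite <- sum_n_Reals. symmetry. apply Series_finite.
intros i Hi. rewrite Nat.mod_small by lia. reflexivity.
Qed.

Lemma Rabs_divsum_cos_le (k : nat) (th : R) (n : nat) :
  Rabs (divsum_cos k th (S n)) <= INR (S n) ^ (k + 1).
Proof.
unfold divsum_cos. rewrite <- sum_n_Reals. replace (S n - 1)%nat with n by lia.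
assert (H : forall i, (i <= n)%nat ->
  Rabs (if Nat.eqb (S n mod S i) 0 then INR (S i) ^ k * cos (2 * PI * INR (S i) * th) else 0) <= INR (S n) ^ k).
{ intros i Hi. assert (P1 := pos_INR (S i)). assert (P2 := pos_INR (S n)).
  destruct (Nat.eqb _ 0); [|rewrite Rabs_R0; now apply pow_le].
  rewrite Rabs_mult, (Rabs_pos_eq (_ ^ k)) by now apply pow_le.
  assert (Rabs (cos (2 * PI * INR (S i) * th)) <= 1) by (apply Rabs_le, COS_bound).
  assert (INR (S i) ^ k <= INR (S n) ^ k) by (apply pow_incr; split; auto; apply le_INR; lia).
  assert (0 <= INR (S i) ^ k) by now apply pow_le.
  assert (0 <= Rabs (cos (2 * PI * INR (S i) * th))) by apply Rabs_pos. nra. }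
revert H. set (B := INR (S n) ^ k).
set (f := fun i => if Nat.eqb (S n mod S i) 0 then INR (S i) ^ k * cos (2 * PI * INR (S i) * th) else 0).
intros H.
assert (Hm : forall m, (m <= n)%nat -> Rabs (sum_n f m) <= INR (S m) * B).
{ induction m as [|m IH]; intros Hm.
  - rewrite sum_O. simpl INR. rewrite Rmult_1_l. apply H. lia.
  - rewrite sum_Sn, (S_INR (S m)). unfold plus; simpl plus.
    apply Rle_trans with (1 := Rabs_triang _ _).
    specialize (IH ltac:(lia)). specialize (H (S m) Hm). fold (f (S m)) in H. lra. }
apply Rle_trans with (1 := Hm n (le_n n)). unfold B. rewrite pow_add, pow_1. right; ring.
Qed.

Definition divisor_term (k : nat) (th s : R) (n d : nat) : R :=
  if Nat.eqb (S n mod S d) 0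
  then INR (S d) ^ k * cos (2 * PI * INR (S d) * th) * exp (- (INR (S n) * s)) else 0.

(** A divisor is at most the number it divides, so summability in the divisor can be bought with two
    powers of n, which the exponential absorbs. *)
Lemma quad_tail_le (i n : nat) : (i <= n)%nat -> 1 <= quad_tail i * INR (S n) ^ 2.
Proof.
intros Hi. rewrite quad_tail_eq, <- S_INR. assert (H0 : 0 < INR (S i)) by (apply lt_0_INR; lia).
assert (H1 : INR (S i) <= INR (S n)) by (apply le_INR; lia).
rewrite <- pow_inv, <- Rpow_mult_distr. apply pow_R1_Rle.
apply Rmult_le_reg_l with (INR (S i)); auto. rewrite <- Rmult_assoc, Rinv_r by lra. lra.
Qed.

Lemma ex_series_pow_exp (k : nat) (r : R) : 0 < r ->
  ex_series (fun n => INR (S n) ^ k * exp (- (INR (S n) * r))).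
Proof.
intros Hr. eapply ex_series_dominated.
- intros n. rewrite Rabs_pos_eq.
  + now apply pow_exp_bound.
  + apply Rmult_le_pos; [apply pow_le, pos_INR|left; apply exp_pos].
- apply ex_series_scal_R, ex_series_quad_tail.
Qed.

Lemma Rabs_pow_cos_le (k d : nat) (x : R) : Rabs (INR (S d) ^ k * cos x) <= INR (S d) ^ k.
Proof.
assert (P := pow_le _ k (pos_INR (S d))).
rewrite Rabs_mult, (Rabs_pos_eq (_ ^ k)) by auto.
assert (Rabs (cos x) <= 1) by (apply Rabs_le, COS_bound).
assert (0 <= Rabs (cos x)) by apply Rabs_pos. nra.
Qed.

Lemma mod_eqb_true (n d : nat) : Nat.eqb (S n mod S d) 0 = true -> exists m, S n = (S d * S m)%nat.
Proof.
intros H. apply Nat.eqb_eq in H. assert (E := Nat.div_mod (S n) (S d) ltac:(lia)).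
rewrite H, Nat.add_0_r in E. destruct (S n / S d)%nat as [|m]; [lia|]. now exists m.
Qed.

Lemma divisor_term_bound (k : nat) (th s : R) (n d : nat) :
  Rabs (divisor_term k th s n d) <= INR (S n) ^ (k + 2) * exp (- (INR (S n) * s)) * quad_tail d.
Proof.
unfold divisor_term. assert (He := exp_pos (- (INR (S n) * s))). assert (Hq := quad_tail_pos d).
assert (HN := pos_INR (S n)).
destruct (Nat.eqb (S n mod S d) 0) eqn:E.
- destruct (mod_eqb_true n d E) as [m Hm]. assert (Hd : (d <= n)%nat) by nia.
  rewrite Rabs_mult, (Rabs_pos_eq (exp _)) by lra.
  assert (B := Rabs_pow_cos_le k d (2 * PI * INR (S d) * th)).
  assert (B2 : INR (S d) ^ k <= INR (S n) ^ k) by (apply pow_incr; split; [apply pos_INR|apply le_INR; lia]).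
  assert (B3 := quad_tail_le d n Hd). assert (B4 := pow_le _ k HN).
  rewrite pow_add.
  replace (INR (S n) ^ k * INR (S n) ^ 2 * exp (- (INR (S n) * s)) * quad_tail d)
    with (INR (S n) ^ k * (quad_tail d * INR (S n) ^ 2) * exp (- (INR (S n) * s))) by ring.
  apply Rmult_le_compat_r; [lra|]. nra.
- rewrite Rabs_R0. apply Rmult_le_pos; [|lra]. apply Rmult_le_pos; [now apply pow_le|lra].
Qed.

(** Divisibility is expanded into a sum over cofactors m of the indicator of n = dm, with at most
    one nonzero term; after the swap the sum over n collapses instead. *)
Lemma Series_divisor_term_n (k : nat) (th s : R) (d : nat) : 0 < s ->
  Series (fun n => divisor_term k th s n d) = Series (fun m => cosexp k th (INR (S m) * s) d).
Proof.
intros Hs. set (B := INR (S d) ^ k * cos (2 * PI * INR (S d) * th)).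
set (c := fun n m => if Nat.eqb (S n) (S d * S m) then B * exp (- (INR (S n) * s)) else 0).
transitivity (Series (fun n => Series (c n))).
- apply Series_ext. intros n. unfold divisor_term. destruct (Nat.eqb (S n mod S d) 0) eqn:E.
  + destruct (mod_eqb_true n d E) as [m0 Hm0].
    rewrite (Series_single (c n) m0).
    * unfold c. rewrite Hm0, Nat.eqb_refl. reflexivity.
    * intros m Hm. unfold c. destruct (Nat.eqb_spec (S n) (S d * S m)); [exfalso; nia|reflexivity].
  + rewrite (Series_ext (c n) (fun _ => 0 * 0)).
    * rewrite Series_scal_l. ring.
    * intros m. unfold c. destruct (Nat.eqb_spec (S n) (S d * S m)) as [Em|]; [|ring].
      exfalso. rewrite Em, Nat.mul_comm, Nat.Div0.mod_mul in E. discriminate.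
- rewrite (Series_swap c (fun n => Rabs B * (INR (S n) ^ 2 * exp (- (INR (S n) * s)))) quad_tail).
  + apply Series_ext. intros m.
    rewrite (Series_single (fun n => c n m) (S d * S m - 1)).
    * unfold c. replace (S (S d * S m - 1)) with (S d * S m)%nat by lia.
      rewrite Nat.eqb_refl. unfold cosexp, B. rewrite mult_INR, <- Rmult_assoc. ring.
    * intros n Hn. unfold c. destruct (Nat.eqb_spec (S n) (S d * S m)); [exfalso; lia|reflexivity].
  + intros n m. unfold c. assert (He := exp_pos (- (INR (S n) * s))). assert (Hq := quad_tail_pos m).
    assert (HB := Rabs_pos B).
    destruct (Nat.eqb_spec (S n) (S d * S m)) as [Em|].
    * assert (Hm : (m <= n)%nat) by nia. assert (B3 := quad_tail_le m n Hm).
      rewrite Rabs_mult, (Rabs_pos_eq (exp _)) by lra.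
      replace (Rabs B * (INR (S n) ^ 2 * exp (- (INR (S n) * s))) * quad_tail m)
        with (Rabs B * exp (- (INR (S n) * s)) * (quad_tail m * INR (S n) ^ 2)) by ring.
      assert (0 <= Rabs B * exp (- (INR (S n) * s))) by nra. nra.
    * rewrite Rabs_R0. apply Rmult_le_pos; [|lra]. apply Rmult_le_pos; [lra|].
      apply Rmult_le_pos; [apply pow2_ge_0|lra].
  + intros n. apply Rmult_le_pos; [apply Rabs_pos|].
    apply Rmult_le_pos; [apply pow2_ge_0|left; apply exp_pos].
  + intros m. left; apply quad_tail_pos.
  + apply ex_series_scal_R. now apply ex_series_pow_exp.
  + apply ex_series_quad_tail.
Qed.

Lemma Series_divsum_exp (k : nat) (th s : R) : 0 < s ->
  Series (fun n => divsum_cos k th (S n) * exp (- (INR (S n) * s))) =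
  Series (fun m => Series (cosexp k th (INR (S m) * s))).
Proof.
intros Hs.
transitivity (Series (fun n => Series (divisor_term k th s n))).
{ apply Series_ext. intros n. rewrite divsum_cos_Series, <- Series_scal_r. apply Series_ext. intros d.
  unfold divisor_term. destruct (Nat.eqb _ 0); ring. }
rewrite (Series_swap (divisor_term k th s) (fun n => INR (S n) ^ (k + 2) * exp (- (INR (S n) * s))) quad_tail).
- rewrite (Series_ext _ _ (fun d => Series_divisor_term_n k th s d Hs)).
  symmetry.
  apply (Series_swap (fun m d => cosexp k th (INR (S m) * s) d)
    (fun m => Rpower (INR k + 2) (INR k + 2) * Rpower s (- (INR k + 2)) * Rpower (INR (S m)) (- (INR k + 2)))
    quad_tail).
  + intros m d. assert (H : 0 < INR (S m)) by (apply lt_0_INR; lia).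
    apply Rle_trans with (1 := cosexp_bound k th (INR (S m) * s) (INR (S m) * s) d ltac:(nra)).
    rewrite <- Rpower_mult_distr by auto. right; ring.
  + intros m. left. apply Rmult_lt_0_compat; [apply Rmult_lt_0_compat|]; apply Rpower_pos.
  + intros d. left; apply quad_tail_pos.
  + apply ex_series_scal_R, ex_series_Rpower. generalize (pos_INR k); lra.
  + apply ex_series_quad_tail.
- intros n d. apply divisor_term_bound.
- intros n. apply Rmult_le_pos; [apply pow_le, pos_INR|left; apply exp_pos].
- intros d. left; apply quad_tail_pos.
- now apply ex_series_pow_exp.
- apply ex_series_quad_tail.
Qed.

(** * Termwise integration *)

Definition gamma_kernel (q : C) (t : R) : C := (cpowR t (q - RtoC 1) * RtoC (exp (- t)))%C.

Lemma Cmod_gamma_kernel (q : C) (t : R) : Cmod (gamma_kernel q t) = gamma_weight (Re q) t.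
Proof.
unfold gamma_kernel, gamma_weight. rewrite Cmod_mult, Cmod_cpowR, Cmod_R, Re_minus_1, Rabs_pos_eq; auto.
left; apply exp_pos.
Qed.

Lemma Rpower_Rinv_l (t p : R) : 0 < t -> Rpower (/ t) (- p) = Rpower t p.
Proof. intros Ht. unfold Rpower. rewrite ln_Rinv by auto. f_equal. ring. Qed.

Lemma gamma_weight_Rpower (p q t : R) : gamma_weight p t * Rpower t q = gamma_weight (p + q) t.
Proof.
unfold gamma_weight. replace (p + q - 1) with (p - 1 + q) by ring. rewrite Rpower_plus. ring.
Qed.

(** The divisor sum is at most n^(k+1), so e^(-ny/t) is bounded with exponent q = k + 3, leaving
    n^(-2). The factor t^q only raises the order of the Gamma integrand. *)
Lemma divsum_bessel_integrand_integral (k : nat) (th y : R) (nu : C) : 0 < y -> 0 < Re nu ->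
  let I := fun n => (RtoC (divsum_cos k th (S n)) * CInt0inf (bessel_integrand nu (y * INR (S n))))%C in
  is_Cseries I (CSeries I) /\
  is_CInt_0_oo (fun t => gamma_kernel nu t * RtoC (Series (fun n => divsum_cos k th (S n) * exp (- (INR (S n) * (y / t))))%R))%C
    (CSeries I).
Proof.
intros Hy Hnu I. set (q := INR k + 3). assert (Hk := pos_INR k).
destruct (ex_RInt_0_oo_gamma_weight (Re nu + q) ltac:(unfold q; lra)) as [W HW].
apply (is_CInt_0_oo_Series (gamma_kernel nu) (fun n t => divsum_cos k th (S n) * exp (- (INR (S n) * (y / t)))) I
  (fun n => Rpower q q * Rpower y (- q) * quad_tail n) (gamma_weight (Re nu + q)) W HW).
- apply ex_series_scal_R, ex_series_quad_tail.
- intros n. assert (HN : 0 < INR (S n)) by (apply lt_0_INR; lia).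
  apply is_CInt_0_oo_ext with (2 := is_CInt_0_oo_scal (RtoC (divsum_cos k th (S n))) _ _
    (is_CInt_0_oo_bessel_integrand nu (y * INR (S n)) Hnu (Rmult_lt_0_compat _ _ Hy HN))).
  intros t Ht. unfold bessel_integrand, gamma_kernel. rewrite !RtoC_mult.
  replace (y * INR (S n) / t) with (INR (S n) * (y / t)) by (field; lra). ring.
- intros n t Ht. rewrite Cmod_gamma_kernel. assert (HN : 0 < INR (S n)) by (apply lt_0_INR; lia).
  assert (Hyt : 0 < y / t) by now apply Rdiv_lt_0_compat.
  assert (B1 := Rabs_divsum_cos_le k th n).
  assert (B2 := exp_neg_le_Rpower q (INR (S n) * (y / t)) ltac:(unfold q; lra) ltac:(nra)).
  unfold Rdiv in B2. rewrite <- !Rpower_mult_distr, Rpower_Rinv_l in B2 by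
    (auto; try apply Rmult_lt_0_compat; auto; now apply Rinv_0_lt_compat).
  fold (y / t) in B2.
  rewrite Rabs_mult, (Rabs_pos_eq (exp _)) by (left; apply exp_pos).
  rewrite <- gamma_weight_Rpower.
  assert (Hq : quad_tail n = INR (S n) ^ (k + 1) * Rpower (INR (S n)) (- q)).
  { rewrite <- Rpower_pow, <- Rpower_plus by auto. unfold quad_tail. f_equal. rewrite plus_INR.
    unfold q. simpl. ring. }
  rewrite Hq.
  apply Rle_trans with (gamma_weight (Re nu) t * (INR (S n) ^ (k + 1) *
    (Rpower q q * (Rpower (INR (S n)) (- q) * (Rpower y (- q) * Rpower t q))))).
  + apply Rmult_le_compat_l.
    * unfold gamma_weight. apply Rmult_le_pos; left; [apply Rpower_pos|apply exp_pos].
    * apply Rmult_le_compat; auto; [apply Rabs_pos|left; apply exp_pos].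
  + right; ring.
Qed.

Lemma Cmod_le_Re_Im (z : C) : Cmod z <= Rabs (Re z) + Rabs (Im z).
Proof.
assert (P1 := Rabs_pos (Re z)). assert (P2 := Rabs_pos (Im z)).
unfold Cmod. rewrite <- (sqrt_pow2 (Rabs (Re z) + Rabs (Im z))) by lra.
apply sqrt_le_1_alt. rewrite <- (pow2_abs (fst z)), <- (pow2_abs (snd z)).
change (fst z) with (Re z). change (snd z) with (Im z). nra.
Qed.

Lemma is_Cseries_dominated (a : nat -> C) (M : nat -> R) :
  (forall n, Cmod (a n) <= M n) -> ex_series M ->
  is_Cseries a (CSeries a) /\ Cmod (CSeries a) <= 2 * Series M.
Proof.
intros H HM.
assert (H1 : forall n, Rabs (Re (a n)) <= M n) by (intros n; apply Rle_trans with (2 := H n); apply re_le_Cmod).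
assert (H2 : forall n, Rabs (Im (a n)) <= M n) by (intros n; apply Rle_trans with (2 := H n); apply im_le_Cmod).
split.
- split; apply Series_correct; now apply ex_series_dominated with M.
- apply Rle_trans with (1 := Cmod_le_Re_Im _).
  assert (B1 := Series_abs_le _ _ H1 HM). assert (B2 := Series_abs_le _ _ H2 HM).
  unfold CSeries. simpl. lra.
Qed.

(** Integrating this pair of exponentials against [gamma_kernel q] gives Gamma(q) times [powterm];
    [hurwitz_pair] carries the decay of both in j. *)
Definition expterm (c th t : R) (j : nat) : R :=
  exp (- (c * (INR j + th) * t)) + exp (- (c * (INR j + 1 - th) * t)).

Definition powterm (q : C) (c th : R) (j : nat) : C :=
  (cpowR (c * (INR j + th) + 1) (- q) + cpowR (c * (INR j + 1 - th) + 1) (- q))%C.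

Definition hurwitz_pair (p th : R) (j : nat) : R := Rpower (INR j + th) (- p) + Rpower (INR j + 1 - th) (- p).

Lemma ex_series_hurwitz_pair (p th : R) : 1 < p -> 0 < th < 1 -> ex_series (hurwitz_pair p th).
Proof.
intros Hp Ht. apply (ex_series_plus (V := R_NormedModule)).
- apply ex_series_Rpower_shift; lra.
- apply ex_series_ext with (fun j => Rpower (INR j + (1 - th)) (- p)).
  + intros j. f_equal. ring.
  + apply ex_series_Rpower_shift; lra.
Qed.

Lemma shift_pos (th : R) (j : nat) : 0 < th < 1 -> 0 < INR j + th /\ 0 < INR j + 1 - th.
Proof. intros Ht. assert (0 <= INR j) by apply pos_INR. lra. Qed.

Lemma is_CInt_0_oo_exp_single (q : C) (c : R) : 0 < Re q -> 0 < c ->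
  is_CInt_0_oo (fun t => gamma_kernel q t * RtoC (exp (- (c * t))))%C (cpowR (c + 1) (- q) * CGamma q)%C.
Proof.
intros Hq Hc. apply is_CInt_0_oo_ext with (2 := is_CInt_0_oo_CGamma_scaled q (c + 1) Hq ltac:(lra)).
intros t _. unfold gamma_kernel. replace (- ((c + 1) * t)) with (- t + - (c * t)) by ring.
rewrite exp_plus, RtoC_mult. ring.
Qed.

(** The order Re q is split: p is spent on the decay (cu)^(-p), and w remains for integrability at t
    = 0. *)
Lemma gamma_kernel_exp_bound (q : C) (p w c u t : R) : Re q = p + w -> 0 < p -> 0 < c -> 0 < u -> 0 < t ->
  gamma_weight (Re q) t * exp (- (c * u * t)) <=
  Rpower p p * Rpower c (- p) * Rpower u (- p) * gamma_weight (w) t.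
Proof.
intros Re_q Hp Hc Hu Htt.
assert (B := exp_neg_le_Rpower p (c * u * t) ltac:(lra) ltac:(apply Rmult_lt_0_compat; auto; nra)).
rewrite <- !Rpower_mult_distr in B by (auto; nra).
assert (E : gamma_weight (w) t = gamma_weight (Re q) t * Rpower t (- p)).
{ rewrite gamma_weight_Rpower, Re_q. f_equal. ring. }
rewrite E.
apply Rle_trans with (gamma_weight (Re q) t * (Rpower p p * (Rpower c (- p) * Rpower u (- p) * Rpower t (- p)))).
- apply Rmult_le_compat_l; auto. unfold gamma_weight. apply Rmult_le_pos; left; [apply Rpower_pos|apply exp_pos].
- right; ring.
Qed.

Lemma powterm_summable (q : C) (p w c th : R) : Re q = p + w -> 1 < p -> 0 < w -> 0 < th < 1 -> 0 < c ->
  is_Cseries (powterm q c th) (CSeries (powterm q c th)) /\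
  Cmod (CSeries (powterm q c th)) <= 2 * Rpower c (- p) * Series (hurwitz_pair p th).
Proof.
intros Re_q Hp Hw Ht Hc. rewrite Rmult_assoc, <- Series_scal_l.
apply is_Cseries_dominated.
- intros j. destruct (shift_pos th j Ht) as [H1 H2].
  assert (B : forall u, 0 < u -> Cmod (cpowR (c * u + 1) (- q)) <= Rpower c (- p) * Rpower u (- p)).
  { intros u Hu. rewrite Cmod_cpowR, Rpower_mult_distr by auto.
    replace (Re (- q)%C) with (- Re q) by reflexivity. rewrite Re_q.
    unfold Rpower. apply exp_le.
    assert (L1 : 0 <= ln (c * u + 1)) by (rewrite <- ln_1; apply ln_le; nra).
    assert (L2 : ln (c * u) <= ln (c * u + 1)) by (apply ln_le; nra).
    nra. }
  unfold powterm, hurwitz_pair. apply Rle_trans with (1 := Cmod_triangle _ _).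
  rewrite (Rmult_plus_distr_l (Rpower _ _)). apply Rplus_le_compat; now apply B.
- apply ex_series_scal_R, ex_series_hurwitz_pair; auto.
Qed.

(** The second conclusion keeps the dependence c^(-p) explicit; with dc in place of c it is the
    majorant for the later sum over d. *)
Lemma is_CInt_0_oo_expterm_sum (q : C) (p w c th : R) : Re q = p + w -> 1 < p -> 0 < w -> 0 < th < 1 -> 0 < c ->
  is_CInt_0_oo (fun t => gamma_kernel q t * RtoC (Series (expterm c th t)))%C (CSeries (powterm q c th) * CGamma q)%C /\
  (forall t, 0 < t -> gamma_weight (Re q) t * Rabs (Series (expterm c th t)) <=
     Rpower p p * Rpower c (- p) * Series (hurwitz_pair p th) * gamma_weight (w) t).
Proof.
intros Re_q Hp Hw Ht Hc. assert (Re_q_pos : 0 < Re q) by lra.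
assert (Hb : forall j t, 0 < t -> gamma_weight (Re q) t * Rabs (expterm c th t j) <=
  Rpower p p * Rpower c (- p) * hurwitz_pair p th j * gamma_weight (w) t).
{ intros j t Htt. destruct (shift_pos th j Ht) as [H1 H2]. unfold expterm, hurwitz_pair.
  assert (P1 := exp_pos (- (c * (INR j + th) * t))). assert (P2 := exp_pos (- (c * (INR j + 1 - th) * t))).
  rewrite Rabs_pos_eq by lra.
  assert (B1 := gamma_kernel_exp_bound q p w c _ t Re_q ltac:(lra) Hc H1 Htt). assert (B2 := gamma_kernel_exp_bound q p w c _ t Re_q ltac:(lra) Hc H2 Htt). lra. }
assert (exH : ex_series (hurwitz_pair p th)) by now apply ex_series_hurwitz_pair.
assert (HM : ex_series (fun j => Rpower p p * Rpower c (- p) * hurwitz_pair p th j)) by now apply ex_series_scal_R.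
split.
- destruct (ex_RInt_0_oo_gamma_weight (w) ltac:(lra)) as [W HW].
  destruct (is_CInt_0_oo_Series (gamma_kernel q) (fun j t => expterm c th t j) (fun j => CGamma q * powterm q c th j)%C
    (fun j => Rpower p p * Rpower c (- p) * hurwitz_pair p th j) (gamma_weight (w)) W HW) as [_ H]; auto.
  + intros j. destruct (shift_pos th j Ht) as [H1 H2].
    replace (CGamma q * powterm q c th j)%C with
      (cpowR (c * (INR j + th) + 1) (- q) * CGamma q + cpowR (c * (INR j + 1 - th) + 1) (- q) * CGamma q)%C
      by (unfold powterm; ring).
    assert (C1 : 0 < c * (INR j + th)) by nra. assert (C2 : 0 < c * (INR j + 1 - th)) by nra.
    apply is_CInt_0_oo_ext with (2 := is_CInt_0_oo_plus _ _ _ _ (is_CInt_0_oo_exp_single q _ Re_q_pos C1) (is_CInt_0_oo_exp_single q _ Re_q_pos C2)).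
    intros t _. unfold expterm. rewrite RtoC_plus. ring.
  + intros j t Htt. rewrite Cmod_gamma_kernel. now apply Hb.
  + rewrite (is_Cseries_CSeries _ _ (is_Cseries_scal (CGamma q) _ _ (proj1 (powterm_summable q p w c th Re_q Hp Hw Ht Hc)))) in H.
    now rewrite Cmult_comm.
- intros t Htt.
  assert (Hw0 : 0 < gamma_weight (Re q) t) by (apply Rmult_lt_0_compat; [apply Rpower_pos|apply exp_pos]).
  rewrite <- (Rabs_pos_eq (gamma_weight (Re q) t)) by lra. rewrite <- Rabs_mult, <- Series_scal_l.
  replace (Rpower p p * Rpower c (- p) * Series (hurwitz_pair p th) * gamma_weight (w) t) with
    (Series (fun j => gamma_weight (w) t * (Rpower p p * Rpower c (- p) * hurwitz_pair p th j))).
  + apply Series_abs_le.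
    * intros j. rewrite Rabs_mult, (Rabs_pos_eq (gamma_weight (Re q) t)) by lra. specialize (Hb j t Htt). lra.
    * now apply ex_series_scal_R.
  + rewrite !Series_scal_l. ring.
Qed.

(** With p = k + 1 + Re(nu)/2, half of Re(nu) makes d^(k-p) = d^(-1-Re(nu)/2) summable and the other
    half makes t^(Re(nu)/2 - 1) integrable at 0. Any Re(nu) > 0 is thus enough. *)
Lemma lattice_integral (k : nat) (th : R) (nu : C) (c : R) : 0 < th < 1 -> 0 < Re nu -> 0 < c ->
  let q := (nu + RtoC (INR k + 1))%C in
  is_CInt_0_oo (fun t => gamma_kernel q t * RtoC (Series (fun d => INR (S d) ^ k * Series (expterm (INR (S d) * c) th t))%R))%C
    (CGamma q * CSeries (fun d => RtoC (INR (S d) ^ k) * CSeries (powterm q (INR (S d) * c) th)))%C.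
Proof.
intros Ht Hnu Hc q. set (p := INR k + 1 + Re nu / 2).
assert (Hp : 1 < p) by (unfold p; generalize (pos_INR k); lra).
assert (Re_q : Re q = p + Re nu / 2) by (unfold p; change (Re q) with (Re nu + (INR k + 1)); field).
assert (Hw : 0 < Re nu / 2) by lra.
assert (HD : forall d, 0 < INR (S d)) by (intros d; apply lt_0_INR; lia).
assert (HDk : forall d, INR (S d) ^ k * Rpower (INR (S d) * c) (- p) =
   Rpower c (- p) * Rpower (INR (S d)) (- (1 + Re nu / 2))).
{ intros d. rewrite <- Rpower_mult_distr by auto. rewrite <- Rpower_pow by auto.
  replace (- (1 + Re nu / 2)) with (INR k + - p) by (unfold p; ring). rewrite Rpower_plus. ring. }
assert (HP : forall d, 0 <= INR (S d) ^ k) by (intros d; apply pow_le, pos_INR).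
assert (exP : ex_series (fun d => Rpower (INR (S d)) (- (1 + Re nu / 2)))) by (apply ex_series_Rpower; lra).
assert (HS : is_Cseries (fun d => RtoC (INR (S d) ^ k) * CSeries (powterm q (INR (S d) * c) th))%C
  (CSeries (fun d => RtoC (INR (S d) ^ k) * CSeries (powterm q (INR (S d) * c) th))%C)).
{ apply (is_Cseries_dominated _ (fun d => 2 * Series (hurwitz_pair p th) * Rpower c (- p) * Rpower (INR (S d)) (- (1 + Re nu / 2)))).
  - intros d. rewrite Cmod_mult, Cmod_R, Rabs_pos_eq by auto.
    assert (B := proj2 (powterm_summable q p (Re nu / 2) (INR (S d) * c) th Re_q Hp Hw Ht (Rmult_lt_0_compat _ _ (HD d) Hc))).
    apply Rle_trans with (INR (S d) ^ k * (2 * Rpower (INR (S d) * c) (- p) * Series (hurwitz_pair p th))).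
    + now apply Rmult_le_compat_l.
    + right. specialize (HDk d).
      transitivity (2 * Series (hurwitz_pair p th) * (INR (S d) ^ k * Rpower (INR (S d) * c) (- p))); [ring|].
      rewrite HDk. ring.
  - now apply ex_series_scal_R. }
destruct (ex_RInt_0_oo_gamma_weight (Re nu / 2) ltac:(lra)) as [W HW].
destruct (is_CInt_0_oo_Series (gamma_kernel q) (fun d t => INR (S d) ^ k * Series (expterm (INR (S d) * c) th t))
  (fun d => CGamma q * (RtoC (INR (S d) ^ k) * CSeries (powterm q (INR (S d) * c) th)))%C
  (fun d => Rpower p p * Series (hurwitz_pair p th) * Rpower c (- p) * Rpower (INR (S d)) (- (1 + Re nu / 2)))
  (gamma_weight (Re nu / 2)) W HW) as [_ H].
- now apply ex_series_scal_R.
- intros d. destruct (is_CInt_0_oo_expterm_sum q p (Re nu / 2) (INR (S d) * c) th Re_q Hp Hw Ht (Rmult_lt_0_compat _ _ (HD d) Hc)) as [H _].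
  replace (CGamma q * (RtoC (INR (S d) ^ k) * CSeries (powterm q (INR (S d) * c) th)))%C
    with (RtoC (INR (S d) ^ k) * (CSeries (powterm q (INR (S d) * c) th) * CGamma q))%C by ring.
  apply is_CInt_0_oo_ext with (2 := is_CInt_0_oo_scal _ _ _ H). intros t _. rewrite RtoC_mult. ring.
- intros d t Htt. rewrite Cmod_gamma_kernel, Rabs_mult, (Rabs_pos_eq (_ ^ k)) by auto.
  destruct (is_CInt_0_oo_expterm_sum q p (Re nu / 2) (INR (S d) * c) th Re_q Hp Hw Ht (Rmult_lt_0_compat _ _ (HD d) Hc)) as [_ B].
  specialize (B t Htt). specialize (HDk d).
  apply Rle_trans with (INR (S d) ^ k *
    (Rpower p p * Rpower (INR (S d) * c) (- p) * Series (hurwitz_pair p th) * gamma_weight (Re nu / 2) t)).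
  + replace (gamma_weight (Re q) t * (INR (S d) ^ k * Rabs (Series (expterm (INR (S d) * c) th t))))
      with (INR (S d) ^ k * (gamma_weight (Re q) t * Rabs (Series (expterm (INR (S d) * c) th t)))) by ring.
    now apply Rmult_le_compat_l.
  + right.
    transitivity (Rpower p p * Series (hurwitz_pair p th) * gamma_weight (Re nu / 2) t * (INR (S d) ^ k * Rpower (INR (S d) * c) (- p)));
      [ring|]. rewrite HDk. ring.
- now rewrite (is_Cseries_CSeries _ _ (is_Cseries_scal (CGamma q) _ _ HS)) in H.
Qed.

Lemma cosexp_0 (k : nat) (s : R) (d : nat) : cosexp k 0 s d = INR (S d) ^ k * exp (- (INR (S d) * s)).
Proof. unfold cosexp. rewrite Rmult_0_r, cos_0. ring. Qed.

(** The exponential bound with exponent k + 2 leaves d^(-2) against d^k and u^(-k-2) over the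
    lattice, a product majorant. *)
Lemma Series_lattice_swap (k : nat) (th c t : R) : 0 < th < 1 -> 0 < c -> 0 < t ->
  is_series (fun j => Series (cosexp k 0 (c * (INR j + th) * t)) + Series (cosexp k 0 (c * (INR j + 1 - th) * t)))
   (Series (fun d => INR (S d) ^ k * Series (expterm (INR (S d) * c) th t))).
Proof.
intros Hth Hc Ht. set (P := INR k + 2). assert (Hk := pos_INR k).
set (a := fun j d => cosexp k 0 (c * (INR j + th) * t) d + cosexp k 0 (c * (INR j + 1 - th) * t) d).
assert (Hpos : forall j, 0 < c * (INR j + th) * t /\ 0 < c * (INR j + 1 - th) * t).
{ intros j. destruct (shift_pos th j Hth) as [H1 H2]. split; apply Rmult_lt_0_compat; auto; nra. }
assert (Hrow : forall j, Series (a j) =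
  Series (cosexp k 0 (c * (INR j + th) * t)) + Series (cosexp k 0 (c * (INR j + 1 - th) * t))).
{ intros j. destruct (Hpos j) as [H1 H2]. apply Series_plus; now apply ex_series_cosexp. }
assert (Hcol : forall d, Series (fun j => a j d) = INR (S d) ^ k * Series (expterm (INR (S d) * c) th t)).
{ intros d. rewrite <- Series_scal_l. apply Series_ext. intros j. unfold a, expterm. rewrite !cosexp_0.
  replace (INR (S d) * c * (INR j + th) * t) with (INR (S d) * (c * (INR j + th) * t)) by ring.
  replace (INR (S d) * c * (INR j + 1 - th) * t) with (INR (S d) * (c * (INR j + 1 - th) * t)) by ring. ring. }
apply is_series_ext with (1 := Hrow). rewrite <- (Series_ext _ _ Hcol).
apply (is_series_swap a (fun j => Rpower P P * Rpower c (- P) * Rpower t (- P) * hurwitz_pair P th j) quad_tail).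
- intros j d. destruct (Hpos j) as [H1 H2]. destruct (shift_pos th j Hth) as [G1 G2].
  unfold a, hurwitz_pair. apply Rle_trans with (1 := Rabs_triang _ _).
  assert (B1 := cosexp_bound k 0 (c * (INR j + th) * t) (c * (INR j + th) * t) d ltac:(lra)).
  assert (B2 := cosexp_bound k 0 (c * (INR j + 1 - th) * t) (c * (INR j + 1 - th) * t) d ltac:(lra)).
  rewrite <- !Rpower_mult_distr in B1, B2 by (auto; nra).
  fold P in B1, B2. lra.
- intros j. unfold hurwitz_pair. assert (E1 := Rpower_pos P P). assert (E2 := Rpower_pos c (- P)).
  assert (E3 := Rpower_pos t (- P)). assert (E4 := Rpower_pos (INR j + th) (- P)).
  assert (E5 := Rpower_pos (INR j + 1 - th) (- P)).
  apply Rmult_le_pos; [|lra]. apply Rmult_le_pos; [|lra]. nra.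
- intros d. left; apply quad_tail_pos.
- apply ex_series_scal_R, ex_series_hurwitz_pair; auto. unfold P; lra.
- apply ex_series_quad_tail.
Qed.

(** The modular identity at s = y/t, sorted by powers of t: t^(2l), 1 and t. Against t^(nu-1) e^(-t)
    they lead to Gamma at nu + k + 1, nu and nu + 1. *)
Lemma divsum_exp_modular (l : nat) (th y t : R) : (1 <= l)%nat -> 0 < th < 1 -> 0 < y -> 0 < t ->
  Series (fun n => divsum_cos (2 * l - 1) th (S n) * exp (- (INR (S n) * (y / t)))) =
  (-1) ^ l / 2 * (2 * PI / y) ^ (2 * l) * t ^ (2 * l) *
    Series (fun d => INR (S d) ^ (2 * l - 1) * Series (expterm (INR (S d) * (4 * PI ^ 2 / y)) th t))
  - (-1) ^ l / 2 * INR (fact (2 * l - 1)) / (2 * PI) ^ (2 * l)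
    * (hurwitz_zeta (INR (2 * l - 1) + 1) th + hurwitz_zeta (INR (2 * l - 1) + 1) (1 - th))
  - (if Nat.eqb l 1 then / (2 * y) else 0) * t.
Proof.
intros Hl Hth Hy Ht. assert (HPI := PI_RGT_0). set (k := (2 * l - 1)%nat).
assert (Hs : 0 < y / t) by now apply Rdiv_lt_0_compat.
rewrite Series_divsum_exp by auto.
assert (H := modular_identity l th (y / t) Hl Hth Hs). fold k in H.
assert (Hc : 0 < 4 * PI ^ 2 / y) by (apply Rdiv_lt_0_compat; nra).
assert (H1 := Series_lattice_swap k th (4 * PI ^ 2 / y) t Hth Hc Ht).
set (G := Series (fun d => INR (S d) ^ k * Series (expterm (INR (S d) * (4 * PI ^ 2 / y)) th t))) in *.
assert (Hk : INR k + 1 = INR (2 * l)).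
{ rewrite <- S_INR. f_equal. unfold k. lia. }
assert (H2l : 1 < INR (2 * l)).
{ replace 1 with (INR 1) by reflexivity. apply lt_INR. lia. }
assert (exZ1 : ex_series (fun j => Rpower (INR j + th) (- INR (2 * l)))) by (apply ex_series_Rpower_shift; lra).
assert (exZ2 : ex_series (fun j => Rpower (INR j + (1 - th)) (- INR (2 * l)))) by (apply ex_series_Rpower_shift; lra).
set (Z := hurwitz_zeta (INR k + 1) th + hurwitz_zeta (INR k + 1) (1 - th)).
assert (H2 : is_series (fun j => Rpower (INR j + th) (- INR (2 * l)) + Rpower (INR j + (1 - th)) (- INR (2 * l))) Z).
{ unfold Z, hurwitz_zeta. rewrite Hk.
  exact (is_series_plus (V := R_NormedModule) _ _ _ _ (Series_correct _ exZ1) (Series_correct _ exZ2)). }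
set (A := (-1) ^ l / 2 * (2 * PI / (y / t)) ^ (2 * l)).
set (B := (-1) ^ l / 2 * INR (fact k) / (2 * PI) ^ (2 * l)).
assert (H3 := is_series_minus (V := R_NormedModule) _ _ _ _
  (is_series_scal (V := R_NormedModule) A _ _ H1) (is_series_scal (V := R_NormedModule) B _ _ H2)).
assert (HA : A = (-1) ^ l / 2 * (2 * PI / y) ^ (2 * l) * t ^ (2 * l)).
{ unfold A. rewrite Rmult_assoc, <- Rpow_mult_distr. do 2 f_equal. field. lra. }
assert (E : Series (fun m => Series (cosexp k th (INR (S m) * (y / t)))) + (if Nat.eqb l 1 then / (2 * (y / t)) else 0)
  = A * G - B * Z).
{ rewrite <- (is_series_unique _ _ H). apply is_series_unique.
  apply is_series_ext with (2 := H3).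
  intros j. destruct (shift_pos th j Hth) as [G1 G2].
  replace (2 * PI / (y / t) * (2 * PI * (INR j + th))) with (4 * PI ^ 2 / y * (INR j + th) * t) by (field; lra).
  replace (2 * PI / (y / t) * (2 * PI * (INR j + 1 - th))) with (4 * PI ^ 2 / y * (INR j + 1 - th) * t) by (field; lra).
  replace (INR j + (1 - th)) with (INR j + 1 - th) by ring.
  rewrite <- !inv_pow_Rpower by auto.
  set (L1 := Series (cosexp k 0 (4 * PI ^ 2 / y * (INR j + th) * t))).
  set (L2 := Series (cosexp k 0 (4 * PI ^ 2 / y * (INR j + 1 - th) * t))).
  transitivity (A * (L1 + L2) - B * ((/ (INR j + th)) ^ (2 * l) + (/ (INR j + 1 - th)) ^ (2 * l)));
    [reflexivity|].
  unfold A, B. rewrite !(Rpow_mult_distr (2 * PI)), !pow_inv, !Rinv_mult. unfold Rdiv. Rring. }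
fold A in HA. rewrite <- HA. fold B. fold Z.
assert (Ed : (if Nat.eqb l 1 then / (2 * (y / t)) else 0) = (if Nat.eqb l 1 then / (2 * y) else 0) * t).
{ destruct (Nat.eqb l 1); [field; lra|ring]. }
rewrite Ed in E. unfold B in *. lra.
Qed.

Lemma CSeries_ext (a b : nat -> C) : (forall n, a n = b n) -> CSeries a = CSeries b.
Proof. intros H. unfold CSeries. f_equal; apply Series_ext; intros n; now rewrite H. Qed.

Lemma gamma_kernel_plus_INR (nu : C) (n : nat) (t : R) : 0 < t ->
  gamma_kernel (nu + RtoC (INR n))%C t = (gamma_kernel nu t * RtoC (t ^ n))%C.
Proof.
intros Ht. unfold gamma_kernel. rewrite <- cpowR_INR by auto.
replace (nu + RtoC (INR n) - RtoC 1)%C with (nu - RtoC 1 + RtoC (INR n))%C by ring.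
rewrite cpowR_plus. ring.
Qed.

(** With 2c the Bessel argument, c^2 = yN, so c^(-nu) = y^(-nu/2) N^(-nu/2). The weight N^(nu/2)
    cancels the second factor and the dependence on N stays inside the integral. *)
Lemma BesselK_summand (nu : C) (a x N : R) : 0 < a -> 0 < x -> 0 < N -> 0 < Re nu ->
  (cpowR N (nu / RtoC 2) * BesselK nu (a * sqrt (N * x)))%C =
  (RtoC (/ 2) * cpowR (a ^ 2 * x / 4) (- (nu / RtoC 2)) * CInt0inf (bessel_integrand nu (a ^ 2 * x / 4 * N)))%C.
Proof.
intros Ha Hx HN Hnu. set (y := a ^ 2 * x / 4).
assert (HNx : 0 < N * x) by nra.
assert (Hsq := sqrt_lt_R0 _ HNx).
set (c := a / 2 * sqrt (N * x)). assert (Hc : 0 < c) by (unfold c; nra).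
assert (Hcc : c * c = y * N).
{ unfold c, y. transitivity (a / 2 * (a / 2) * (sqrt (N * x) * sqrt (N * x))); [ring|].
  rewrite sqrt_sqrt by lra. field. }
assert (Hy : 0 < y) by (unfold y; assert (0 < a ^ 2) by nra; nra).
replace (a * sqrt (N * x)) with (2 * c) by (unfold c; field).
rewrite BesselK_bessel_integrand by auto.
replace (c ^ 2) with (y * N) by (rewrite <- Hcc; ring).
assert (E : cpowR c (- nu) = (cpowR y (- (nu / RtoC 2)) * cpowR N (- (nu / RtoC 2)))%C).
{ rewrite <- cpowR_mult, <- Hcc, cpowR_mult, <- cpowR_plus by auto. f_equal. field. }
rewrite E.
transitivity ((cpowR N (- (nu / RtoC 2)) * cpowR N (nu / RtoC 2)) *
  (RtoC (/ 2) * cpowR y (- (nu / RtoC 2)) * CInt0inf (bessel_integrand nu (y * N))))%C; [ring|].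
rewrite cpowR_opp_l by auto. ring.
Qed.

Lemma divsum_bessel_integrand_value (l : nat) (th y : R) (nu : C) : (1 <= l)%nat -> 0 < th < 1 -> 0 < y -> 0 < Re nu ->
  let k := (2 * l - 1)%nat in
  let q := (nu + RtoC (INR k + 1))%C in
  CSeries (fun n => RtoC (divsum_cos k th (S n)) * CInt0inf (bessel_integrand nu (y * INR (S n))))%C =
  (RtoC ((-1) ^ l / 2 * (2 * PI / y) ^ (2 * l)) *
     (CGamma q * CSeries (fun d => RtoC (INR (S d) ^ k) * CSeries (powterm q (INR (S d) * (4 * PI ^ 2 / y)) th)))
   - RtoC ((-1) ^ l / 2 * INR (fact k) / (2 * PI) ^ (2 * l)
        * (hurwitz_zeta (INR k + 1) th + hurwitz_zeta (INR k + 1) (1 - th))) * CGamma nu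
   - RtoC (if Nat.eqb l 1 then / (2 * y) else 0) * CGamma (RtoC 1 + nu))%C.
Proof.
intros Hl Hth Hy Hnu k q. assert (HPI := PI_RGT_0).
assert (Hc : 0 < 4 * PI ^ 2 / y) by (apply Rdiv_lt_0_compat; nra).
destruct (divsum_bessel_integrand_integral k th y nu Hy Hnu) as [_ H].
assert (H1 := lattice_integral k th nu (4 * PI ^ 2 / y) Hth Hnu Hc). fold q in H1.
assert (H2 := is_CInt_0_oo_CGamma nu Hnu).
assert (H3 : is_CInt_0_oo (fun t => gamma_kernel (nu + RtoC (INR 1)) t)%C (CGamma (RtoC 1 + nu))).
{ replace (RtoC 1 + nu)%C with (nu + RtoC (INR 1))%C by (simpl INR; ring).
  apply is_CInt_0_oo_CGamma. change (0 < Re nu + 1). lra. }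
set (A := (-1) ^ l / 2 * (2 * PI / y) ^ (2 * l)).
set (B := (-1) ^ l / 2 * INR (fact k) / (2 * PI) ^ (2 * l)
        * (hurwitz_zeta (INR k + 1) th + hurwitz_zeta (INR k + 1) (1 - th))).
set (D := if Nat.eqb l 1 then / (2 * y) else 0).
apply (is_CInt_0_oo_unique _ _ _ H).
assert (H4 := is_CInt_0_oo_plus _ _ _ _ (is_CInt_0_oo_plus _ _ _ _ (is_CInt_0_oo_scal (RtoC A) _ _ H1) (is_CInt_0_oo_scal (RtoC (- B)) _ _ H2))
   (is_CInt_0_oo_scal (RtoC (- D)) _ _ H3)).
match type of H4 with is_CInt_0_oo _ ?L => match goal with |- is_CInt_0_oo _ ?L' => replace L' with L end end.
- apply is_CInt_0_oo_ext with (2 := H4). intros t Ht.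
  assert (HM := divsum_exp_modular l th y t Hl Hth Hy Ht). fold k A B D in HM. rewrite HM.
  fold (gamma_kernel nu t).
  replace q with (nu + RtoC (INR (2 * l)))%C.
  + rewrite !gamma_kernel_plus_INR by auto. rewrite pow_1.
    generalize (Series (fun d => INR (S d) ^ k * Series (expterm (INR (S d) * (4 * PI ^ 2 / y)) th t))). intros G.
    rewrite !RtoC_minus, !RtoC_mult, !RtoC_opp. ring.
  + unfold q. do 2 f_equal. rewrite <- S_INR. f_equal. unfold k. lia.
- rewrite !RtoC_opp. ring.
Qed.

Theorem theorem2p8 (a x theta : R) (k : nat) (nu : C)
  (ha : 0 < a) (hx : 0 < x) (ht0 : 0 < theta) (ht1 : theta < 1)
  (hk : Nat.Odd k) (hnu : 0 < Re nu) :
  (cpowR (a ^ 2 * x / 4) (nu / RtoC 2 + RtoC (INR k + 1)) *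
   CSeries (fun n' => let n := S n' in
     cpowR (INR n) (nu / RtoC 2) * BesselK nu (a * sqrt (INR n * x))
       * RtoC (divsum_cos k theta n)))%C
  =
  (RtoC ((-1) ^ ((k - 1) / 2) * a ^ (2 * k + 2) * INR (fact k)
          / (2 ^ (2 * k + 4) * (2 * PI) ^ (k + 1)))
     * CGamma nu
     * RtoC (hurwitz_zeta (INR k + 1) theta + hurwitz_zeta (INR k + 1) (1 - theta))
     * RtoC (x ^ (k + 1))
   + RtoC ((-1) ^ ((k + 1) / 2) * (2 * PI) ^ (k + 1) / 4)
     * CGamma (nu + RtoC (INR k + 1))
     * CSeries (fun d' => let d := S d' in
         RtoC (INR d ^ k) *
         CSeries (fun m =>
           cpowR (16 * PI ^ 2 / a ^ 2 * (INR d * (INR m + theta)) / x + 1)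
                 (- (nu + RtoC (INR k + 1)))
           + cpowR (16 * PI ^ 2 / a ^ 2 * (INR d * (INR m + 1 - theta)) / x + 1)
                 (- (nu + RtoC (INR k + 1)))))
   - RtoC ((if Nat.eqb k 1 then 1 else 0) * a ^ 2 / 16)
     * CGamma (RtoC 1 + nu) * RtoC x)%C.
Proof.
(* For k = 2m + 1 the parameter l = m + 1 is half the weight k + 1, and the integer divisions in the
   signs give m and l exactly. *)
destruct hk as [m Hm]. set (l := S m).
assert (Hk : k = (2 * l - 1)%nat) by (unfold l; lia).
assert (Hl : (1 <= l)%nat) by (unfold l; lia).
assert (Hk1 : (k + 1 = 2 * l)%nat) by lia.
assert (Hdiv1 : ((k - 1) / 2 = m)%nat).
{ replace (k - 1)%nat with (m * 2)%nat by lia. now apply Nat.div_mul. }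
assert (Hdiv2 : ((k + 1) / 2 = l)%nat).
{ replace (k + 1)%nat with (l * 2)%nat by lia. now apply Nat.div_mul. }
assert (HPI := PI_RGT_0).
set (y := a ^ 2 * x / 4). assert (Hy : 0 < y) by (unfold y; assert (0 < a ^ 2) by nra; nra).
set (q := (nu + RtoC (INR k + 1))%C).
assert (Hser : is_Cseries (fun n => RtoC (divsum_cos k theta (S n)) * CInt0inf (bessel_integrand nu (y * INR (S n))))%C
   (CSeries (fun n => RtoC (divsum_cos k theta (S n)) * CInt0inf (bessel_integrand nu (y * INR (S n))))%C)).
{ apply (divsum_bessel_integrand_integral k theta y nu Hy hnu). }
assert (Hval := divsum_bessel_integrand_value l theta y nu Hl (conj ht0 ht1) Hy hnu). cbv zeta in Hval.
rewrite <- Hk in Hval. fold q in Hval. rewrite Hval in Hser.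
set (J := CSeries (fun d => RtoC (INR (S d) ^ k) * CSeries (powterm q (INR (S d) * (4 * PI ^ 2 / y)) theta))%C) in *.
assert (HJ : CSeries (fun d' => let d := S d' in
         RtoC (INR d ^ k) *
         CSeries (fun m =>
           cpowR (16 * PI ^ 2 / a ^ 2 * (INR d * (INR m + theta)) / x + 1) (- q)
           + cpowR (16 * PI ^ 2 / a ^ 2 * (INR d * (INR m + 1 - theta)) / x + 1) (- q)))%C = J).
{ apply CSeries_ext. intros d. cbv zeta. f_equal. apply CSeries_ext. intros j. unfold powterm.
  f_equal; f_equal; unfold y; field; lra. }
rewrite HJ.
set (Sv := (RtoC ((-1) ^ l / 2 * (2 * PI / y) ^ (2 * l)) * (CGamma q * J)
   - RtoC ((-1) ^ l / 2 * INR (fact k) / (2 * PI) ^ (2 * l)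
        * (hurwitz_zeta (INR k + 1) theta + hurwitz_zeta (INR k + 1) (1 - theta))) * CGamma nu
   - RtoC (if Nat.eqb l 1 then / (2 * y) else 0) * CGamma (RtoC 1 + nu))%C) in *.
assert (HL : CSeries (fun n' => let n := S n' in
     cpowR (INR n) (nu / RtoC 2) * BesselK nu (a * sqrt (INR n * x)) * RtoC (divsum_cos k theta n))%C
  = (RtoC (/ 2) * cpowR y (- (nu / RtoC 2)) * Sv)%C).
{ apply is_Cseries_CSeries.
  apply is_Cseries_ext with (2 := is_Cseries_scal (RtoC (/ 2) * cpowR y (- (nu / RtoC 2))) _ _ Hser).
  intros n. cbv zeta. rewrite BesselK_summand by (auto; apply lt_0_INR; lia). fold y. ring. }
rewrite HL.
(* The complex powers y^(nu/2) and y^(-nu/2) cancel, leaving the real factor y^(2l)/2; only real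
   constants remain to be matched. *)
assert (Hpre : (cpowR y (nu / RtoC 2 + RtoC (INR k + 1)) * (RtoC (/ 2) * cpowR y (- (nu / RtoC 2)) * Sv))%C
  = (RtoC (y ^ (2 * l) / 2) * Sv)%C).
{ replace (INR k + 1) with (INR (2 * l)) by (rewrite <- Hk1, plus_INR; reflexivity).
  rewrite cpowR_plus, cpowR_INR by auto.
  transitivity ((cpowR y (- (nu / RtoC 2)) * cpowR y (nu / RtoC 2)) * (RtoC (y ^ (2 * l)) * RtoC (/ 2) * Sv))%C; [ring|].
  rewrite cpowR_opp_l by auto. unfold Rdiv. rewrite RtoC_mult. ring. }
rewrite Hpre. unfold Sv.
set (Z := hurwitz_zeta (INR k + 1) theta + hurwitz_zeta (INR k + 1) (1 - theta)).
assert (Hyl : y ^ (2 * l) <> 0) by (apply pow_nonzero; lra).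
assert (H2PI : (2 * PI) ^ (2 * l) <> 0) by (apply pow_nonzero; lra).
assert (C1 : y ^ (2 * l) / 2 * ((-1) ^ l / 2 * (2 * PI / y) ^ (2 * l)) = (-1) ^ ((k + 1) / 2) * (2 * PI) ^ (k + 1) / 4).
{ rewrite Hdiv2, Hk1.
  replace ((2 * PI / y) ^ (2 * l)) with ((2 * PI) ^ (2 * l) / y ^ (2 * l))
    by (unfold Rdiv; now rewrite (Rpow_mult_distr (2 * PI)), pow_inv).
  field. auto. }
(* The sign changes because (-1)^l = -(-1)^m; the power 2^(2k+4) collects 4^(2l) from y^(2l) and 4
   from the two halves. *)
assert (C2 : y ^ (2 * l) / 2 * ((-1) ^ l / 2 * INR (fact k) / (2 * PI) ^ (2 * l) * Z) =
  - ((-1) ^ ((k - 1) / 2) * a ^ (2 * k + 2) * INR (fact k) / (2 ^ (2 * k + 4) * (2 * PI) ^ (k + 1)) * Z * x ^ (k + 1))).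
{ rewrite Hdiv1, Hk1. replace (2 * k + 2)%nat with (2 * (2 * l))%nat by lia.
  replace (2 * k + 4)%nat with (2 * (2 * l) + 2)%nat by lia.
  rewrite pow_add, !(pow_mult _ 2 (2 * l)). unfold y, Rdiv.
  rewrite !(Rpow_mult_distr _ _ (2 * l)), pow_inv. replace (2 ^ 2) with 4 by ring.
  assert (H4 : 4 ^ (2 * l) <> 0) by (apply pow_nonzero; lra).
  assert (HP : PI ^ (2 * l) <> 0) by (apply pow_nonzero; lra).
  assert (H2 : 2 ^ (2 * l) <> 0) by (apply pow_nonzero; lra).
  replace ((-1) ^ l) with (- (-1) ^ m) by (unfold l; simpl; ring).
  field. auto. }
assert (C3 : y ^ (2 * l) / 2 * (if Nat.eqb l 1 then / (2 * y) else 0) = (if Nat.eqb k 1 then 1 else 0) * a ^ 2 / 16 * x).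
{ destruct (Nat.eqb_spec l 1) as [E|E].
  - rewrite E. replace (Nat.eqb k 1) with true by (symmetry; apply Nat.eqb_eq; lia).
    change (2 * 1)%nat with 2%nat.
    replace (y ^ 2 / 2 * / (2 * y)) with (y / 4) by (field; lra). unfold y. field.
  - destruct (Nat.eqb_spec k 1); [exfalso; lia|]. unfold Rdiv. ring. }
transitivity (RtoC (y ^ (2 * l) / 2 * ((-1) ^ l / 2 * (2 * PI / y) ^ (2 * l))) * (CGamma q * J)
  - RtoC (y ^ (2 * l) / 2 * ((-1) ^ l / 2 * INR (fact k) / (2 * PI) ^ (2 * l) * Z)) * CGamma nu
  - RtoC (y ^ (2 * l) / 2 * (if Nat.eqb l 1 then / (2 * y) else 0)) * CGamma (RtoC 1 + nu))%C.
- rewrite !(RtoC_mult (y ^ (2 * l) / 2)). ring.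
- rewrite C1, C2, C3. rewrite RtoC_opp, !(RtoC_mult _ x), !(RtoC_mult _ (x ^ (k + 1))), (RtoC_mult _ Z). ring.
Qed.
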